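(* Let $f\in L^\infty(\mathbb R;\mathbb C)$ satisfy: (i) $f(x)=f(|x|)$ for a.e. $x\in\mathbb R$; (ii) there exist $\rho>1$ and $C>0$ such that $|f(x)|\le C\langle x\rangle^{-\rho}$ for a.e. $x\in\mathbb R$; (iii) there exists $\delta>0$ such that $f=1$ on $(-\delta,\delta)$. Let $H_0:=Q$ and let $H$ be a selfadjoint operator in $\mathcal H=L^2(\mathbb R)$ such that the wave operators $W_\pm:=\mathrm{s\text{-}}\lim_{t\to\pm\infty}\mathrm e^{itH}\mathrm e^{-itH_0}$ exist and are complete, and such that every operator $T\in\mathscr B(\mathcal H^{-s},\mathcal H)$ with $s>1/2$ is locally $H$-smooth on $\mathbb R\setminus\sigma_{\rm pp}(H)$. Then: (a) For each $r>0$ and $\varphi\in\mathcal H$ one has $$T^0_r(\varphi)=r\|\varphi\|^2\int_{\mathbb R}\mathrm dx\,f(x),\qquad T^0_r(\varphi)=T^0_r(S\varphi),\qquad \tau_r^{\rm in}(\varphi)=\tau_r(\varphi),$$ the last identity being understood whenever $T_r(\varphi)$ is well defined. (b) Suppose that $f\ge 0$ and let $\varphi\in\mathscr D_0$ be such that $$\int_{-\infty}^0\mathrm dt\,\|(W_--1)\mathrm e^{-itH_0}\varphi\|<\infty,\qquad \int_0^{\infty}\mathrm dt\,\|(W_+-1)\mathrm e^{-itH_0}S\varphi\|<\infty .$$ Then $$\lim_{r\to\infty}\tau_r^{\rm in}(\varphi)=\lim_{r\to\infty}\tau_r(\varphi)=\lim_{r\to\infty}\tau_r^{\rm free}(\varphi),$$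 in the sense that if one of these limits exists then all three exist and are equal.
   Context: $\mathcal H:=L^2(\mathbb R)$ with scalar product $\langle\cdot,\cdot\rangle$ (antilinear in the first argument) and norm $\|\cdot\|$; $Q$ is the operator of multiplication by $x$, $P=-i\,\mathrm d/\mathrm dx$, $\langle x\rangle:=(1+|x|^2)^{1/2}$. For $s\in\mathbb R$, $\mathcal H^s$ is the usual Sobolev space on $\mathbb R$, i.e. the completion of the Schwartz space for the norm $\|\langle P\rangle^s\varphi\|$. $\mathscr B(\mathcal H_1,\mathcal H_2)$ is the set of bounded operators from $\mathcal H_1$ to $\mathcal H_2$. Completeness of $W_\pm$ means that their ranges equal the absolutely continuous subspace of $H$; then the scattering operator $S:=W_+^*W_-$ is unitary. $\sigma_{\rm pp}(H)$ is the set of eigenvalues of $H$. An operator $T$ is locally $H$-smooth on a set $\Omega\subset\mathbb R$ if for each compact $K\subset\Omega$ there is $C_K>0$ such that $\int_{\mathbb R}\mathrm dt\,\|T\mathrm e^{-itH}E^H(K)\psi\|^2\le C_K\|\psi\|^2$ for all $\psi\in\mathcal H$, where $E^H$ is the spectral measure of $H$. $$\mathscr D_0:=\{\varphi\in\mathcal H\mid \chi_J(Q)\varphi=\varphi\text{ for some compact set }J\subset\mathbb R\setminus\sigma_{\rm pp}(H)\}.$$ For $r>0$, $$T^0_r(\varphi):=\int_{\mathbb R}\mathrm dt\,\langle \mathrm e^{-itH_0}\varphi,f(P/r)\mathrm e^{-itH_0}\varphi\rangle,\qquad T_r(\varphi):=\int_{\mathbb R}\mathrm dt\,\langle \mathrm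 e^{-itH}W_-\varphi,f(P/r)\mathrm e^{-itH}W_-\varphi\rangle,$$ $$\tau_r^{\rm in}(\varphi):=T_r(\varphi)-T_r^0(\varphi),\qquad \tau_r(\varphi):=T_r(\varphi)-\tfrac12\big[T^0_r(\varphi)+T^0_r(S\varphi)\big],$$ \begin{align*} \tau_r^{\rm free}(\varphi):=&\ \tfrac12\int_0^\infty\mathrm dt\,\big\langle S\varphi,\big[\mathrm e^{itH_0}f(P/r)\mathrm e^{-itH_0}-\mathrm e^{-itH_0}f(P/r)\mathrm e^{itH_0}\big]S\varphi\big\rangle\\ &-\tfrac12\int_0^\infty\mathrm dt\,\big\langle\varphi,\big[\mathrm e^{itH_0}f(P/r)\mathrm e^{-itH_0}-\mathrm e^{-itH_0}f(P/r)\mathrm e^{itH_0}\big]\varphi\big\rangle . \end{align*} For $\varphi\in\mathscr D_0$ the number $T_r(\varphi)$ is finite for each $r>0$ (a consequence of the local smoothness assumption). *)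

(* Defs.v *)
From HB Require Import structures.
From mathcomp Require Import all_boot all_order all_algebra.
From mathcomp Require Import complex.
From mathcomp Require Import all_classical all_reals all_analysis.

Set Implicit Arguments.
Unset Strict Implicit.
Unset Printing Implicit Defensive.
Import Order.TTheory GRing.Theory Num.Theory.
Import numFieldNormedType.Exports.
Local Open Scope classical_set_scope.
Local Open Scope quotient_scope.
Local Open Scope ring_scope.

Section ComplexFunctions.
Context {R : realType}.

Definition cexpi (x : R) : R[i] := Complex (cos x) (sin x).

Definition cabs (z : R[i]) : R := complex.Re `|z|.

Definition cmeasurable (g : R -> R[i]) : Prop :=
  measurable_fun setT (fun x => complex.Re (g x)) /\
  measurable_fun setT (fun x => complex.Im (g x)).

Definition cintegrable (mu : set R -> \bar R) (D : set R) (g : R -> R[i]) :=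
  mu.-integrable D (EFin \o (fun x => complex.Re (g x))) /\
  mu.-integrable D (EFin \o (fun x => complex.Im (g x))).

Definition cintegral (mu : set R -> \bar R) (D : set R) (g : R -> R[i]) :=
  Complex (fine (\int[mu]_(x in D) (complex.Re (g x))%:E))
          (fine (\int[mu]_(x in D) (complex.Im (g x))%:E)).

End ComplexFunctions.

(* The complex space L^2(R): functions whose real and imaginary parts are
   square integrable, modulo equality almost everywhere *)
Section L2.
Context {R : realType}.
Local Notation mu := (@lebesgue_measure R).

Definition L2pred : {pred R -> R[i]} :=
  fun g => ((fun x => complex.Re (g x)) \in Lfun mu 2%:E) &&
           ((fun x => complex.Im (g x)) \in Lfun mu 2%:E).

Let le12 : (1 <= 2%:E :> \bar R)%E.
Proof. by rewrite lee_fin ler1n. Qed.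

Let LfunL a b (f g : R -> R) : f \in Lfun mu 2%:E -> g \in Lfun mu 2%:E ->
  (fun x => a * f x + b * g x) \in Lfun mu 2%:E.
Proof.
move=> fL gL.
have [_ h] := Lfun_submod_closed mu le12.
have -> : (fun x => a * f x + b * g x) = a *: f + (b *: g + 0) by rewrite addr0.
by apply: (h) => //; apply: (h) => //; have [] := Lfun_submod_closed mu le12.
Qed.

Lemma L2pred_submod : submod_closed L2pred.
Proof.
split.
  have [h _] := Lfun_submod_closed mu le12.
  by apply/andP; split; exact: h.
move=> a f g /andP[f1 f2] /andP[g1 g2]; apply/andP; split.
  have -> : (fun x => complex.Re ((a *: f + g) x)) =
     (fun x => 1 * (complex.Re a * complex.Re (f x) +
        (- complex.Im a) * complex.Im (f x)) + 1 * complex.Re (g x)).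
    apply/funext => x /=; rewrite !mul1r.
    rewrite -[(a *: f + g) x]/(a * f x + g x).
    by case: a => ? ?; case: (f x) => ? ?; case: (g x) => ? ? /=; rewrite mulNr.
  by apply: LfunL => //; exact: LfunL.
have -> : (fun x => complex.Im ((a *: f + g) x)) =
   (fun x => 1 * (complex.Re a * complex.Im (f x) +
      complex.Im a * complex.Re (f x)) + 1 * complex.Im (g x)).
  apply/funext => x /=; rewrite !mul1r.
  rewrite -[(a *: f + g) x]/(a * f x + g x).
  by case: a => ? ?; case: (f x) => ? ?; case: (g x) => ? ?.
by apply: LfunL => //; exact: LfunL.
Qed.

HB.instance Definition _ :=
  GRing.isSubmodClosed.Build _ _ L2pred L2pred_submod.

Record L2fun := MkL2fun { L2fun_val :> R -> R[i]; _ : L2fun_val \in L2pred }.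
HB.instance Definition _ := [isSub for L2fun_val].
HB.instance Definition _ := [Choice of L2fun by <:].
HB.instance Definition _ := [SubChoice_isSubLmodule of L2fun by <:].

Definition L2null : {pred L2fun} :=
  fun g => `[< {ae mu, forall x, g x = 0} >].

Lemma L2null_submod : submod_closed L2null.
Proof.
split; first by apply/asboolP; exact: aeW.
move=> a f g /asboolP f0 /asboolP g0; apply/asboolP.
have F : Filter (nbhs (almost_everywhere mu)) by exact: ae_filter_ringOfSetsType.
move: f0 g0; apply: filterS2 => x fx gx.
by rewrite -[(a *: f + g) x]/(a * f x + g x) fx gx mulr0 addr0.
Qed.

HB.instance Definition _ :=
  GRing.isSubmodClosed.Build _ _ L2null L2null_submod.

Definition L2 : Type := Quotient.quot L2null.

HB.instance Definition _ := GRing.Zmodule.on L2.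
HB.instance Definition _ := EqQuotient.on L2.

Definition L2scale (a : R[i]) (phi : L2) : L2 := \pi_L2 (a *: repr phi).

Lemma pi_L2scale a (g : L2fun) : L2scale a (\pi_L2 g) = \pi_L2 (a *: g).
Proof.
apply/eqP; rewrite /L2scale -Quotient.idealrBE -scalerBr.
by apply: rpredZ; rewrite Quotient.idealrBE reprK.
Qed.

Let scaleA a b v : L2scale a (L2scale b v) = L2scale (a * b) v.
Proof. by elim/quotW: v => g; rewrite (pi_L2scale b) !pi_L2scale scalerA. Qed.

Let scale1 : left_id 1 L2scale.
Proof. by elim/quotW => g; rewrite pi_L2scale scale1r. Qed.

Let scaleDr : right_distributive L2scale +%R.
Proof.
move=> a; elim/quotW => u; elim/quotW => v.
by rewrite -[\pi u + \pi v]Quotient.pi_add !pi_L2scale scalerDr;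
  exact: Quotient.pi_add.
Qed.

Let scaleDl v : {morph L2scale^~ v : a b / a + b}.
Proof.
move=> a b /=; elim/quotW: v => v; rewrite !pi_L2scale scalerDl.
exact: Quotient.pi_add.
Qed.

HB.instance Definition _ := GRing.Zmodule_isLmodule.Build R[i] L2
  scaleA scale1 scaleDr scaleDl.

Definition L2val (phi : L2) : R -> R[i] := L2fun_val (repr phi).

(* The class of g, with value 0 when g is not square integrable *)
Definition toL2 (g : R -> R[i]) : L2 := \pi_L2 (insubd (0 : L2fun) g).

Definition ip (phi psi : L2) : R[i] :=
  cintegral mu setT (fun x => (L2val phi x)^*%C * L2val psi x).

Definition L2norm (phi : L2) : R := Num.sqrt (complex.Re (ip phi phi)).

Definition L2cvg {T : Type} (F : set_system T) (u : T -> L2) (phi : L2) :=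
  L2norm (u t - phi) @[t --> F] --> (0 : R).

End L2.

Arguments L2 : clear implicits.
Coercion L2val : L2 >-> Funclass.

Section OperatorsOfPositionAndMomentum.
Context {R : realType}.
Implicit Types (phi psi chi : L2 R) (g : R -> R[i]).
Local Notation mu := (@lebesgue_measure R).

(* The operator g(Q) *)
Definition mulop g phi : L2 R := toL2 (fun x => g x * phi x).

(* e^{-itH_0} for H_0 = Q *)
Definition evol0 (t : R) : L2 R -> L2 R := mulop (fun x => cexpi (- (t * x))).

Definition fourier_trunc (n : nat) phi (k : R) : R[i] :=
  ((Num.sqrt (2 * pi))^-1)%:C%C *
  cintegral mu `[- n%:R, n%:R] (fun x => cexpi (- (k * x)) * phi x).

Definition is_fourier phi chi : Prop :=
  (\int[mu]_k ((cabs (fourier_trunc n phi k - chi k)) ^+ 2)%:E)%E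
    @[n --> \oo] --> 0%E.

(* The Fourier transform on L^2(R), as the limit in the mean *)
Definition fourier phi : L2 R := xget 0 [set chi | is_fourier phi chi].

(* The operator g(P), P = -i d/dx: multiplication by g in Fourier variables.
   For unbounded g, the value is meaningful on the domain of g(P) only. *)
Definition funP g phi : L2 R :=
  xget 0 [set chi |
    {ae mu, forall k, fourier chi k = g k * fourier phi k}].

End OperatorsOfPositionAndMomentum.

Section Sobolev.
Context {R : realType}.
Implicit Types (phi psi : L2 R) (u v : nat -> L2 R) (s : R).

Definition real_schwartz (h : R -> R) : Prop :=
  (forall n x, derivable (derive1n n h) x 1) /\
  forall m n, exists C, forall x, `|x| ^+ m * `|derive1n n h x| <= C.

Definition schwartz phi : Prop := exists g : R -> R[i],
  [/\ real_schwartz (fun x => complex.Re (g x)),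
      real_schwartz (fun x => complex.Im (g x)) & phi = toL2 g].

(* The Japanese bracket <x> *)
Definition jap (x : R) : R := Num.sqrt (1 + `|x| ^+ 2).

Definition sobnorm s phi : R :=
  L2norm (funP (fun k => ((jap k) `^ s)%:C%C) phi).

(* H^s is the completion of the Schwartz space for sobnorm s: an element of
   H^s is represented by a Cauchy sequence of Schwartz functions, two sequences
   representing the same element when Sobolev_norm s of their difference is 0. *)
Definition Sobolev s : set (nat -> L2 R) :=
  [set u | (forall n, schwartz (u n)) /\
    forall e, 0 < e -> exists N, forall m n,
      (N <= m)%N -> (N <= n)%N -> sobnorm s (u m - u n) < e].

Definition Sobolev_norm s u : R := lim (sobnorm s (u n) @[n --> \oo]).

(* T belongs to B(H^s, L^2). By the bound, T depends only on the element
   represented by the Cauchy sequence. *)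
Definition bounded_Sobolev s (T : (nat -> L2 R) -> L2 R) : Prop :=
  (forall a u v, Sobolev s u -> Sobolev s v ->
     T (a *: u + v) = a *: T u + T v) /\
  exists C : R, forall u, Sobolev s u -> L2norm (T u) <= C * Sobolev_norm s u.

(* The inclusion of L^2 in H^s, for s <= 0 *)
Definition L2_to_Sobolev s phi : nat -> L2 R :=
  xget (fun=> 0) [set u | Sobolev s u /\
    sobnorm s (u n - phi) @[n --> \oo] --> (0 : R)].

End Sobolev.

Section SpectralTheory.
Context {R : realType}.
Implicit Types (phi psi chi : L2 R).
Local Notation mu := (@lebesgue_measure R : set R -> \bar R).

(* The values of app outside dom are irrelevant *)
Record unbounded_op := UnboundedOp { dom : set (L2 R); app :> L2 R -> L2 R }.

Definition selfadjoint (H : unbounded_op) : Prop :=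
  [/\ dom H 0 /\ (forall a phi psi, dom H phi -> dom H psi ->
        dom H (a *: phi + psi) /\ H (a *: phi + psi) = a *: H phi + H psi),
      forall phi e, 0 < e -> exists2 psi, dom H psi & L2norm (phi - psi) < e &
      forall phi chi,
        (dom H phi /\ chi = H phi) <->
        (forall psi, dom H psi -> ip phi (H psi) = ip chi psi)].

Definition is_eigenvalue (H : unbounded_op) (l : R) : Prop :=
  exists phi, [/\ dom H phi, phi <> 0 & H phi = l%:C%C *: phi].

Definition sigma_pp (H : unbounded_op) : set R := [set l | is_eigenvalue H l].

Definition orthogonal_projection (A : L2 R -> L2 R) : Prop :=
  [/\ linear A, forall phi, A (A phi) = A phi &
      forall phi psi, ip phi (A psi) = ip (A phi) psi].

Definition projection_valued_measure (E : set R -> L2 R -> L2 R) : Prop :=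
  [/\ forall B, measurable B -> orthogonal_projection (E B),
      forall phi, E setT phi = phi &
      forall B : nat -> set R, (forall n, measurable (B n)) -> trivIset setT B ->
        forall phi, L2cvg \oo (fun n => \sum_(k < n) E (B k) phi)
                          (E (\bigcup_n B n) phi)].

(* B |-> <phi, E(B) phi> = |E(B) phi|^2 *)
Definition spectral_distr (E : set R -> L2 R -> L2 R) phi (B : set R) : \bar R :=
  ((L2norm (E B phi)) ^+ 2)%:E.

(* H = \int l dE(l). By polarization the quadratic forms determine H. *)
Definition spectral_measure_of (H : unbounded_op) (E : set R -> L2 R -> L2 R) :=
  [/\ projection_valued_measure E,
      dom H = [set phi | (\int[spectral_distr E phi]_l (l ^+ 2)%:E < +oo)%E] &
      forall phi, dom H phi ->
        ip phi (H phi) = cintegral (spectral_distr E phi) setT (fun l => l%:C%C)].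

(* g(H) = \int g(l) dE(l) for bounded g, the linear operator determined by its
   diagonal matrix elements (polarization) *)
Definition funcalc (E : set R -> L2 R -> L2 R) (g : R -> R[i]) : L2 R -> L2 R :=
  xget (fun=> 0) [set A | linear A /\
    forall phi, ip phi (A phi) = cintegral (spectral_distr E phi) setT g].

(* e^{-itH} *)
Definition evol (E : set R -> L2 R -> L2 R) (t : R) : L2 R -> L2 R :=
  funcalc E (fun l => cexpi (- (t * l))).

Definition ac_subspace (E : set R -> L2 R -> L2 R) : set (L2 R) :=
  [set phi | spectral_distr E phi `<< mu].

Definition locally_smooth (E : set R -> L2 R -> L2 R) (T : L2 R -> L2 R)
    (Omega : set R) : Prop :=
  forall K, compact K -> K `<=` Omega -> exists2 C : R, 0 < C & forall psi,
    (\int[mu]_t ((L2norm (T (evol E t (E K psi)))) ^+ 2)%:E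
       <= (C * L2norm psi ^+ 2)%:E)%E.

End SpectralTheory.

Arguments unbounded_op : clear implicits.

Section Scattering.
Context {R : realType}.
Implicit Types (phi psi chi : L2 R) (E : set R -> L2 R -> L2 R).
Implicit Types (f : R -> R[i]) (W S : L2 R -> L2 R) (r : R).
Local Notation mu := (@lebesgue_measure R : set R -> \bar R).

(* W is the strong limit of e^{itH} e^{-itH_0} as t tends to F *)
Definition wave_operator E (F : set_system R) W : Prop :=
  forall phi, L2cvg F (fun t => evol E (- t) (evol0 t phi)) (W phi).

Definition adjoint W phi : L2 R :=
  xget 0 [set chi | forall psi, ip chi psi = ip phi (W psi)].

Definition scattering (Wm Wp : L2 R -> L2 R) phi : L2 R := adjoint Wp (Wm phi).

Definition D0 (H : unbounded_op R) : set (L2 R) :=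
  [set phi | exists J : set R, [/\ compact J, J `<=` ~` sigma_pp H &
     mulop (fun x => (\1_J x)%:C%C) phi = phi]].

(* <phi_t, f(P/r) phi_t> for the evolution t |-> phi_t *)
Definition localization f r (phit : R -> L2 R) (t : R) : R[i] :=
  ip (phit t) (funP (fun k => f (k / r)) (phit t)).

Definition Tr0_integrand f r phi : R -> R[i] :=
  localization f r (fun t => evol0 t phi).

Definition Tr0 f r phi : R[i] := cintegral mu setT (Tr0_integrand f r phi).

Definition Tr_integrand E Wm f r phi : R -> R[i] :=
  localization f r (fun t => evol E t (Wm phi)).

Definition Tr E Wm f r phi : R[i] :=
  cintegral mu setT (Tr_integrand E Wm f r phi).

Definition tau_in E Wm f r phi : R[i] := Tr E Wm f r phi - Tr0 f r phi.

Definition tau E Wm S f r phi : R[i] :=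
  Tr E Wm f r phi - 2^-1 * (Tr0 f r phi + Tr0 f r (S phi)).

Definition tau_free_integrand f r psi (t : R) : R[i] :=
  ip psi (evol0 (- t) (funP (fun k => f (k / r)) (evol0 t psi))
          - evol0 t (funP (fun k => f (k / r)) (evol0 (- t) psi))).

Definition tau_free S f r phi : R[i] :=
  2^-1 * cintegral mu `[0, +oo[ (tau_free_integrand f r (S phi))
  - 2^-1 * cintegral mu `[0, +oo[ (tau_free_integrand f r phi).

Definition cvg_to_pinfty (u : R -> R[i]) (l : R[i]) : Prop :=
  cabs (u r - l) @[r --> +oo] --> (0 : R).

End Scattering.

(* Main.v *)
(* Write [U_t] for the free evolution and [F_r] for [f(P/r)].  In Fourier
   variables [U_t] is the translation by [t], so
   [<U_t phi, F_r U_t phi>] is the integral of [f(k/r) |phi^(k+t)|^2 dk], and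
   part (a) is Fubini's theorem together with the isometry of [S].  For part
   (b), [W_- phi = W_+ (S phi)] and the intertwining relation give
   [e^{-itH} W_- phi = W_- U_t phi = W_+ U_t S phi].  Using the first form for
   [t <= 0] and the second for [t >= 0], the integrand of [T_r] differs from
   the free one, for [phi] resp. [S phi], by at most a constant times
   [|(W_- - 1) U_t phi|] resp. [|(W_+ - 1) U_t S phi|], which are integrable.
   As [r] grows, [F_r] tends strongly to [1] and the difference tends to
   [|W U_t psi|^2 - |U_t psi|^2 = 0], so by dominated convergence
   [T_r(phi)] is asymptotic to the sum of the free integral of [phi] over
   [t <= 0] and that of [S phi] over [t >= 0].  Subtracting
   [T^0_r(phi) = T^0_r(S phi)] leaves exactly [tau_r^free].

   Plancherel's theorem is obtained from the real Hartley transform, the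
   integral of [(cos(kx) + sin(kx)) u(x)]: damping the [k] integral by
   [e^{-e|k|}] produces the Poisson kernel, whence the transform is a
   contraction and an involution.  The group [e^{-itH}] is the strong limit
   of the operators attached to step functions approximating [e^{-it l}]. *)

(* Most operators involved are selected by [xget]: the Fourier transform, [g(P)], [g(H)], the
   adjoint of [W_+]. Such a definition says nothing until a witness is exhibited and shown unique,
   and much of the length goes there: surjectivity of the Fourier transform yields the witness for
   [g(P)], completeness of [L2] the one for [e^{-itH}], equality of the two ranges the one for [S].

   The Hartley kernel is real and symmetric, so its transform is formally its own adjoint and, once
   normalized, its own inverse; a contraction that is an involution is an isometry. Inversion is
   tested against interval indicators only, whose Poisson averages are explicit differences of
   arctangents. The Fourier transform then differs from the Hartley transform by a unitary
   combination with the reflection.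

   Dominated convergence works along sequences and needs measurable integrands: limits in [r] are
   taken along arbitrary sequences, and measurability in [t] comes from continuity of the evolved
   vectors. The dominating function does not depend on [r] because rescaling the argument of [f]
   keeps its essential bound. *)
From HB Require Import structures.
Require Import Defs.
From mathcomp Require Import all_boot all_order all_algebra.
From mathcomp Require Import complex.
From mathcomp Require Import all_classical all_reals all_analysis.
From mathcomp Require Import measurable_realfun.
From mathcomp Require Import ring lra.
Import Order.TTheory GRing.Theory Num.Theory.
Import numFieldNormedType.Exports.
Local Open Scope classical_set_scope.
Local Open Scope quotient_scope.
Local Open Scope ring_scope.

Local Notation Re := (@complex.Re _).
Local Notation Im := (@complex.Im _).
(* [functions.funP] of MathComp-Analysis hides the operator [g(P)] of [Defs]. *)
Local Notation funP := Defs.funP.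

(** * Complex numbers and complex integrals *)

Section ComplexModulus.
Context {R : realType}.
Implicit Types z w : R[i].

(** The square of the modulus, kept beside [cabs] because it is polynomial in the two parts:
    measurability and integrability are obtained without a square root. *)
Definition csq z : R := Re z ^+ 2 + Im z ^+ 2.

Lemma csq_ge0 z : 0 <= csq z.
Proof. by rewrite addr_ge0 ?sqr_ge0. Qed.

Lemma cabsE z : cabs z = Num.sqrt (csq z).
Proof. by case: z. Qed.

Lemma sqr_cabs z : cabs z ^+ 2 = csq z.
Proof. by rewrite cabsE sqr_sqrtr ?csq_ge0. Qed.

Lemma cabs_ge0 z : 0 <= cabs z.
Proof. by rewrite cabsE sqrtr_ge0. Qed.

Lemma normC_cabs z : `|z| = (cabs z)%:C%C.
Proof. by rewrite cabsE; case: z. Qed.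

Lemma cabsD z w : cabs (z + w) <= cabs z + cabs w.
Proof.
have := ler_normD z w; rewrite !normC_cabs -rmorphD /= lecE /=.
by case/andP.
Qed.

Lemma cabsM z w : cabs (z * w) = cabs z * cabs w.
Proof.
have := normrM z w; rewrite !normC_cabs -rmorphM /=.
by move=> /(congr1 Re).
Qed.

Lemma csqM z w : csq (z * w) = csq z * csq w.
Proof. by rewrite -!sqr_cabs cabsM exprMn. Qed.

Lemma csqN z : csq (- z) = csq z.
Proof. by case: z => a b; rewrite /csq /= !sqrrN. Qed.

Lemma csqJ z : csq z^*%C = csq z.
Proof. by case: z => a b; rewrite /csq /= !sqrrN. Qed.

Lemma csq_eq0 z : csq z = 0 -> z = 0.
Proof.
case: z => a b; rewrite /csq /= => /eqP.
by rewrite paddr_eq0 ?sqr_ge0// !sqrf_eq0 => /andP[/eqP-> /eqP->].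
Qed.

Lemma csqD z w : csq (z + w) <= 2 * (csq z + csq w).
Proof.
case: z w => a b [c d]; rewrite /csq /=.
have := sqr_ge0 (a - c); have := sqr_ge0 (b - d); nra.
Qed.

Lemma csq_cexpi (x : R) : csq (cexpi x) = 1.
Proof. by rewrite /csq /= cos2Dsin2. Qed.

Lemma cexpiD (x y : R) : cexpi (x + y) = cexpi x * cexpi y.
Proof.
rewrite /cexpi cosD sinD; apply/eqP; rewrite eq_complex /=.
by rewrite !eqxx /= addrC (mulrC (cos x)) (mulrC (sin x)) eqxx.
Qed.

Lemma cexpi0 : cexpi (0 : R) = 1.
Proof. by rewrite /cexpi cos0 sin0. Qed.

Lemma Re_cabs z : `|Re z| <= cabs z.
Proof.
rewrite cabsE -sqrtr_sqr ler_sqrt ?csq_ge0//.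
by rewrite /csq lerDl sqr_ge0.
Qed.

Lemma Im_cabs z : `|Im z| <= cabs z.
Proof.
rewrite cabsE -sqrtr_sqr ler_sqrt ?csq_ge0//.
by rewrite /csq lerDr sqr_ge0.
Qed.

Lemma cabs_le z : cabs z <= `|Re z| + `|Im z|.
Proof.
rewrite cabsE -[leRHS]ger0_norm ?addr_ge0// -sqrtr_sqr ler_sqrt ?sqr_ge0//.
rewrite /csq sqrrD !real_normK ?num_real// -addrA lerD2l lerDr.
by rewrite mulrn_wge0 ?mulr_ge0.
Qed.

Lemma cReM z w : Re (z * w) = Re z * Re w - Im z * Im w.
Proof. by case: z w => a b [c d]. Qed.
Lemma cImM z w : Im (z * w) = Re z * Im w + Im z * Re w.
Proof. by case: z w => a b [c d]. Qed.
Lemma cReD z w : Re (z + w) = Re z + Re w.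
Proof. by case: z w => a b [c d]. Qed.
Lemma cImD z w : Im (z + w) = Im z + Im w.
Proof. by case: z w => a b [c d]. Qed.
Lemma cReN z : Re (- z) = - Re z.
Proof. by case: z. Qed.
Lemma cImN z : Im (- z) = - Im z.
Proof. by case: z. Qed.
Lemma cReJ z : Re z^*%C = Re z.
Proof. by case: z. Qed.
Lemma cImJ z : Im z^*%C = - Im z.
Proof. by case: z. Qed.
Lemma cReC (x : R) : Re x%:C%C = x. Proof. by []. Qed.
Lemma cImC (x : R) : Im x%:C%C = 0. Proof. by []. Qed.
Definition cReImE := (cReM, cImM, cReD, cImD, cReN, cImN, cReJ, cImJ, cReC, cImC).

Lemma complex_eq z w : Re z = Re w -> Im z = Im w -> z = w.
Proof. by case: z w => a b [c d] /= -> ->. Qed.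

End ComplexModulus.

(* [lebesgue_measure] lives on [measurableTypeR R], whose measurable structure
   carries another display than the canonical one of [R]; [leb] is the same
   function as a measure on [R] itself. *)
Section LebesgueOnR.
Context {R : realType}.

Definition leb : set R -> \bar R := @lebesgue_measure R.

Let leb0 : leb set0 = 0%E. Proof. exact: measure0. Qed.
Let leb_ge0 x : (0 <= leb x)%E. Proof. exact: (measure_ge0 lebesgue_measure). Qed.
Let leb_sadd : semi_sigma_additive leb.
Proof. exact: (@measure_semi_sigma_additive _ _ _ (@lebesgue_measure R)). Qed.
HB.instance Definition _ := isMeasure.Build _ R R leb leb0 leb_ge0 leb_sadd.
Let leb_sf : sigma_finite setT leb.
Proof. exact: (@sigma_finiteT _ _ _ (@lebesgue_measure R)). Qed.
HB.instance Definition _ := Measure_isSigmaFinite.Build _ R R leb leb_sf.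

Let idR : measurableTypeR R -> R := id.

Let midR : measurable_fun setT idR.
Proof. exact: (@measurable_id _ (measurableTypeR R)). Qed.

(** The identity map pushes [lebesgue_measure] forward to [leb]; it is measurable because both
    structures on the line have the same measurable sets. *)
Lemma ge0_integral_leb (D : set R) (f : R -> \bar R) : measurable D ->
  measurable_fun D f -> (forall x, D x -> 0 <= f x)%E ->
  (\int[lebesgue_measure]_(x in D) f x = \int[leb]_(x in D) f x)%E.
Proof.
move=> mD mf f0.
have f0' : {in D, forall x, (0 <= f x)%E} by move=> x /set_mem/f0.
have := @ge0_integral_pushforward _ _ (measurableTypeR R) R R idR midR
  (@lebesgue_measure R) D f mD mf f0'.
by move=> <-; apply: eq_measure_integral.
Qed.

Lemma integrable_leb (D : set R) (f : R -> \bar R) : measurable D ->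
  lebesgue_measure.-integrable D f <-> leb.-integrable D f.
Proof.
move=> mD; split=> /integrableP[mf fi]; apply/integrableP; split => //;
  apply: le_lt_trans fi; rewrite ge0_integral_leb//; exact: measurableT_comp.
Qed.

Lemma integral_leb (D : set R) (f : R -> \bar R) : measurable D ->
  measurable_fun D f ->
  (\int[lebesgue_measure]_(x in D) f x = \int[leb]_(x in D) f x)%E.
Proof.
move=> mD mf; rewrite integralE [RHS]integralE; congr (_ - _)%E.
  by apply: ge0_integral_leb => //; exact: measurable_funepos.
by apply: ge0_integral_leb => //; exact: measurable_funeneg.
Qed.

(** [Lfun] is defined through the norm, a power 1/2 of the integral; that power is finite as soon as
    the integral is, and conversely. *)
Lemma Lfun2P (u : R -> R) : u \in Lfun lebesgue_measure 2%:E <->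
  measurable_fun setT u /\ (\int[leb]_x (u x ^+ 2)%:E < +oo)%E.
Proof.
have E : measurable_fun setT u -> (\int[lebesgue_measure]_x (u x ^+ 2)%:E =
    \int[leb]_x (u x ^+ 2)%:E)%E.
  move=> mu_; apply: ge0_integral_leb => //.
    by apply/measurable_EFinP; exact: measurable_funX.
  by move=> x _; rewrite lee_fin sqr_ge0.
split=> [uL|[mu_ iu]].
  have mu_ : measurable_fun setT u by move: uL; rewrite inE => /andP[]; rewrite inE.
  split => //; rewrite -E//.
  apply: (@integrable_lty _ _ _ lebesgue_measure setT measurableT
    (fun x => (u x ^+ 2)%:E)).
  exact: Lfun2_integrable_sqr.
rewrite inE; apply/andP; split; first by rewrite inE.
rewrite inE /finite_norm /= unlock.
apply: poweR_lty; under eq_integral.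
  move=> x _; rewrite -[X in (X `^ _)%E]/(`|u x|%:E) poweR_EFin.
  rewrite powR_mulrn// real_normK ?num_real//.
  over.
by rewrite E.
Qed.

End LebesgueOnR.

Section ComplexIntegral.
Context {R : realType}.
Variable mu : {measure set R -> \bar R}.
Variable D : set R.
Hypothesis mD : measurable D.
Implicit Types g h : R -> R[i].

Lemma cintegrableD g h : cintegrable mu D g -> cintegrable mu D h ->
  cintegrable mu D (fun x => g x + h x).
Proof.
move=> [g1 g2] [h1 h2]; split.
  apply: (eq_integrable mD) (integrableD mD g1 h1) => x _ /=.
  by rewrite cReD EFinD.
apply: (eq_integrable mD) (integrableD mD g2 h2) => x _ /=.
by rewrite cImD EFinD.
Qed.

Lemma cintegrableZ a g : cintegrable mu D g ->
  cintegrable mu D (fun x => a * g x).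
Proof.
move=> [g1 g2]; split.
  apply: (eq_integrable mD)
   (integrableD mD (integrableZl mD (Re a) g1) (integrableZl mD (- Im a) g2)).
  by move=> x _ /=; rewrite cReM -!EFinM -EFinD mulNr.
apply: (eq_integrable mD)
  (integrableD mD (integrableZl mD (Re a) g2) (integrableZl mD (Im a) g1)).
by move=> x _ /=; rewrite cImM -!EFinM -EFinD.
Qed.

Lemma cintegralD g h : cintegrable mu D g -> cintegrable mu D h ->
  cintegral mu D (fun x => g x + h x) = cintegral mu D g + cintegral mu D h.
Proof.
move=> [g1 g2] [h1 h2]; apply: complex_eq; rewrite ?cReD ?cImD /=.
  rewrite -(RintegralD mD g1 h1); congr fine.
  by apply: eq_integral => x _; rewrite cReD.
rewrite -(RintegralD mD g2 h2); congr fine.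
by apply: eq_integral => x _; rewrite cImD.
Qed.

Lemma cintegralZ a g : cintegrable mu D g ->
  cintegral mu D (fun x => a * g x) = a * cintegral mu D g.
Proof.
move=> [g1 g2]; apply: complex_eq; rewrite ?cReM ?cImM /=.
  rewrite -!RintegralZl//; rewrite -RintegralB//.
  - by apply: eq_Rintegral => x _; rewrite cReM.
  - exact: (integrableZl mD (Re a) g1).
  - exact: (integrableZl mD (Im a) g2).
rewrite -!RintegralZl//; rewrite -RintegralD//.
- by apply: eq_Rintegral => x _; rewrite cImM.
- exact: (integrableZl mD (Re a) g2).
- exact: (integrableZl mD (Im a) g1).
Qed.

Lemma cintegral_conj g : cintegrable mu D g ->
  cintegral mu D (fun x => (g x)^*%C) = (cintegral mu D g)^*%C.
Proof.
move=> [g1 g2]; apply: complex_eq; rewrite ?cReJ ?cImJ /=.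
  by congr fine; apply: eq_integral => x _; rewrite cReJ.
rewrite -[LHS]/(Rintegral mu D (fun x => Im (g x)^*%C)).
rewrite -mulN1r -[X in -1 * X]/(Rintegral mu D (fun x => Im (g x))).
rewrite -RintegralZl//; congr fine; apply: eq_integral => x _.
by rewrite cImJ mulN1r.
Qed.

Lemma eq_cintegral g h : (forall x, D x -> g x = h x) ->
  cintegral mu D g = cintegral mu D h.
Proof.
move=> gh; congr Complex; congr fine; apply: eq_integral => x xD;
  by rewrite gh//; exact: set_mem.
Qed.

Lemma eq_cintegrable g h : (forall x, D x -> g x = h x) ->
  cintegrable mu D g -> cintegrable mu D h.
Proof.
move=> gh [g1 g2]; split; [apply: eq_integrable g1|apply: eq_integrable g2] =>//;
  by move=> x xD /=; rewrite gh//; exact: set_mem.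
Qed.

End ComplexIntegral.

Section AlmostEverywhere.
Context {R : realType}.
Local Notation mu := (@leb R).
Implicit Types (P Q S : R -> Prop) (g h : R -> R[i]).

Lemma aeS P Q : (forall x, P x -> Q x) ->
  {ae mu, forall x, P x} -> {ae mu, forall x, Q x}.
Proof.
have F : Filter (nbhs (almost_everywhere mu)) by exact: ae_filter_ringOfSetsType.
by move=> PQ; apply: filterS => x; exact: PQ.
Qed.

Lemma aeS2 P Q S : (forall x, P x -> Q x -> S x) ->
  {ae mu, forall x, P x} -> {ae mu, forall x, Q x} -> {ae mu, forall x, S x}.
Proof.
have F : Filter (nbhs (almost_everywhere mu)) by exact: ae_filter_ringOfSetsType.
by move=> PQ; apply: filterS2 => x; exact: PQ.
Qed.

Lemma cmeasurableD g h : cmeasurable g -> cmeasurable h ->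
  cmeasurable (fun x => g x + h x).
Proof.
move=> [g1 g2] [h1 h2]; split.
  by under eq_fun do rewrite cReD; exact: measurable_funD.
by under eq_fun do rewrite cImD; exact: measurable_funD.
Qed.

Lemma cmeasurableM g h : cmeasurable g -> cmeasurable h ->
  cmeasurable (fun x => g x * h x).
Proof.
move=> [g1 g2] [h1 h2]; split.
  under eq_fun do rewrite cReM.
  by apply: measurable_funB; exact: measurable_funM.
under eq_fun do rewrite cImM.
by apply: measurable_funD; exact: measurable_funM.
Qed.

Lemma cmeasurable_conj g : cmeasurable g -> cmeasurable (fun x => (g x)^*%C).
Proof.
move=> [g1 g2]; split.
  by under eq_fun do rewrite cReJ.
under eq_fun do rewrite cImJ.
by apply: (measurableT_comp (f := @GRing.opp R)) => //; exact: oppr_measurable.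
Qed.

Lemma cmeasurable_cst (a : R[i]) : @cmeasurable R (fun=> a).
Proof. by split; exact: measurable_cst. Qed.

Lemma cmeasurable_csq g : cmeasurable g -> measurable_fun setT (fun x => csq (g x)).
Proof. by move=> [g1 g2]; apply: measurable_funD; exact: measurable_funX. Qed.

Lemma cmeasurable_cabs g : cmeasurable g ->
  measurable_fun setT (fun x => cabs (g x)).
Proof.
move=> mg; under eq_fun do rewrite cabsE.
apply: (measurableT_comp (f := @Num.sqrt R)); last exact: cmeasurable_csq.
by apply: continuous_measurable_fun => x; exact: sqrt_continuous.
Qed.

Lemma cintegral_ae g h : cmeasurable g -> cmeasurable h ->
  {ae mu, forall x, g x = h x} -> cintegral mu setT g = cintegral mu setT h.
Proof.
move=> [g1 g2] [h1 h2] gh; congr Complex; congr fine; apply: ae_eq_integral => //.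
- exact/measurable_EFinP.
- exact/measurable_EFinP.
- by apply: aeS gh => x -> .
- exact/measurable_EFinP.
- exact/measurable_EFinP.
- by apply: aeS gh => x -> .
Qed.

Lemma cintegrable_cabs g : cmeasurable g ->
  cintegrable mu setT g <-> mu.-integrable setT (fun x => (cabs (g x))%:E).
Proof.
move=> mg; have [g1 g2] := mg; split=> [[i1 i2]|i].
  apply: (le_integrable measurableT)
    (integrableD measurableT (integrable_abse i1) (integrable_abse i2)).
    by apply/measurable_EFinP; exact: cmeasurable_cabs.
  move=> x _; rewrite -[leRHS]/(`|(`|Re (g x)| + `|Im (g x)|)%:E|)%E lee_fin.
  by rewrite (ger0_norm (cabs_ge0 _)) (ger0_norm (addr_ge0 _ _))// cabs_le.
split; apply: (le_integrable measurableT) i => //=.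
- exact/measurable_EFinP.
- by move=> x _; rewrite lee_fin (ger0_norm (cabs_ge0 _)) Re_cabs.
- exact/measurable_EFinP.
- by move=> x _; rewrite lee_fin (ger0_norm (cabs_ge0 _)) Im_cabs.
Qed.

End AlmostEverywhere.

(** * The Hilbert space L2 *)

Section HilbertSpace.
Context {R : realType}.
Local Notation mu := (@leb R).
Implicit Types (g h : R -> R[i]) (phi psi chi : L2 R).

Lemma L2predP g : g \in L2pred <->
  cmeasurable g /\ (\int[mu]_x (csq (g x))%:E < +oo)%E.
Proof.
rewrite unfold_in; split.
  move=> /andP[/Lfun2P[g1 i1] /Lfun2P[g2 i2]]; split => //.
  have -> : (\int[mu]_x (csq (g x))%:E =
      \int[mu]_x (Re (g x) ^+ 2)%:E + \int[mu]_x (Im (g x) ^+ 2)%:E)%E.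
    rewrite -ge0_integralD//.
    - by move=> x _; rewrite lee_fin sqr_ge0.
    - by apply/measurable_EFinP; exact: measurable_funX.
    - by move=> x _; rewrite lee_fin sqr_ge0.
    - by apply/measurable_EFinP; exact: measurable_funX.
  exact: lte_add_pinfty.
move=> [mg ig]; have [g1 g2] := mg; apply/andP; split; apply/Lfun2P; split => //.
  apply: le_lt_trans ig; apply: ge0_le_integral => //.
  - by move=> x _; rewrite lee_fin sqr_ge0.
  - by apply/measurable_EFinP; exact: measurable_funX.
  - by apply/measurable_EFinP; exact: cmeasurable_csq.
  - by move=> x _; rewrite lee_fin lerDl sqr_ge0.
apply: le_lt_trans ig; apply: ge0_le_integral => //.
- by move=> x _; rewrite lee_fin sqr_ge0.
- by apply/measurable_EFinP; exact: measurable_funX.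
- by apply/measurable_EFinP; exact: cmeasurable_csq.
- by move=> x _; rewrite lee_fin lerDr sqr_ge0.
Qed.

Lemma L2valP phi : (phi : R -> R[i]) \in L2pred.
Proof. exact: (valP (repr phi)). Qed.

Lemma L2pred_meas g : g \in L2pred -> cmeasurable g.
Proof. by move=> /L2predP[]. Qed.

Lemma toL2_ae g : g \in L2pred -> {ae mu, forall x, toL2 g x = g x}.
Proof.
move=> gL; have /asboolP : repr (toL2 g) - insubd 0 g \in L2null.
  by rewrite Quotient.idealrBE reprK.
apply: aeS => x; rewrite -[X in X = 0]/(toL2 g x - (insubd 0 g : L2fun) x) => /eqP.
by rewrite subr_eq0 => /eqP ->; rewrite -[LHS]/(val (insubd 0 g : L2fun) x) insubdK.
Qed.

Lemma L2_eqP phi psi : phi = psi <-> {ae mu, forall x, phi x = psi x}.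
Proof.
split=> [->|h]; first exact: aeW.
rewrite -[phi]reprK -[psi]reprK; apply/eqP; rewrite -Quotient.idealrBE.
apply/asboolP; apply: aeS h => x h.
by rewrite -[LHS]/(phi x - psi x) h subrr.
Qed.

Lemma L2D_ae phi psi : {ae mu, forall x, (phi + psi : L2 R) x = phi x + psi x}.
Proof.
have /asboolP : repr (phi + psi) - (repr phi + repr psi) \in L2null.
  rewrite Quotient.idealrBE; apply/eqP.
  by rewrite reprK [RHS]Quotient.pi_add !reprK.
by apply: aeS => x /eqP; rewrite -[X in X == 0]/((phi + psi : L2 R) x - (phi x + psi x))
  subr_eq0 => /eqP.
Qed.

Lemma L2Z_ae a phi : {ae mu, forall x, (a *: phi : L2 R) x = a * phi x}.
Proof.
have /asboolP : repr (a *: phi) - (a *: repr phi) \in L2null.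
  by rewrite Quotient.idealrBE; apply/eqP; rewrite reprK.
by apply: aeS => x /eqP; rewrite -[X in X == 0]/((a *: phi : L2 R) x - (a * phi x))
  subr_eq0 => /eqP.
Qed.

Lemma L2N_ae phi : {ae mu, forall x, (- phi : L2 R) x = - phi x}.
Proof.
by rewrite -scaleN1r; apply: aeS (L2Z_ae (-1) phi) => x ->; rewrite mulN1r.
Qed.

Lemma L2B_ae phi psi : {ae mu, forall x, (phi - psi : L2 R) x = phi x - psi x}.
Proof. by apply: aeS2 (L2D_ae phi (- psi)) (L2N_ae psi) => x -> ->. Qed.

(** Domination by [|g| |h| <= |g|^2 + |h|^2]. This makes [ip] a convergent integral, so that its
    algebraic rules follow from those of [cintegral]. *)
Lemma L2pred_conjM g h : g \in L2pred -> h \in L2pred ->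
  cintegrable mu setT (fun x => (g x)^*%C * h x).
Proof.
move=> /L2predP[mg ig] /L2predP[mh ih].
have mgh : cmeasurable (fun x => (g x)^*%C * h x).
  by apply: cmeasurableM => //; exact: cmeasurable_conj.
have ii : mu.-integrable setT (fun x => (csq (g x))%:E + (csq (h x))%:E)%E.
  apply: integrableD => //; apply/integrableP; split;
    do ?[by apply/measurable_EFinP; exact: cmeasurable_csq].
    by under eq_integral do rewrite gee0_abs ?lee_fin ?csq_ge0//.
  by under eq_integral do rewrite gee0_abs ?lee_fin ?csq_ge0//.
apply/cintegrable_cabs => //; apply: le_integrable ii => //.
  by apply/measurable_EFinP; exact: cmeasurable_cabs.
move=> x _; rewrite -[leRHS]/(`|csq (g x) + csq (h x)|%:E) lee_fin.
rewrite (ger0_norm (cabs_ge0 _)) (ger0_norm (addr_ge0 (csq_ge0 _) (csq_ge0 _))).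
rewrite cabsM -!sqr_cabs.
have -> : cabs (g x)^*%C = cabs (g x) by rewrite !cabsE csqJ.
by have := sqr_ge0 (cabs (g x) - cabs (h x)); have := sqr_ge0 (cabs (g x) + cabs (h x)); nra.
Qed.

Lemma ipE phi psi : ip phi psi = cintegral mu setT (fun x => (phi x)^*%C * psi x).
Proof. by []. Qed.

Lemma ip_ae phi psi g h : g \in L2pred -> h \in L2pred ->
  {ae mu, forall x, phi x = g x} -> {ae mu, forall x, psi x = h x} ->
  ip phi psi = cintegral mu setT (fun x => (g x)^*%C * h x).
Proof.
move=> gL hL pg ph; apply: cintegral_ae.
- by apply: cmeasurableM; [apply: cmeasurable_conj|]; apply/L2pred_meas/L2valP.
- by apply: cmeasurableM; [apply: cmeasurable_conj|]; apply/L2pred_meas.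
- by apply: aeS2 pg ph => x -> ->.
Qed.

Lemma ip_integrable phi psi :
  cintegrable mu setT (fun x => (phi x)^*%C * psi x).
Proof. by apply: L2pred_conjM; exact: L2valP. Qed.

Lemma L2predD g h : g \in L2pred -> h \in L2pred ->
  (fun x => g x + h x) \in L2pred.
Proof. exact: rpredD. Qed.

Lemma L2predZ a g : g \in L2pred -> (fun x => a * g x) \in L2pred.
Proof. exact: (rpredZ a). Qed.

Lemma ipDr phi psi chi : ip phi (psi + chi) = ip phi psi + ip phi chi.
Proof.
rewrite (@ip_ae phi _ phi (fun x => psi x + chi x)) ?L2valP//.
- rewrite !ipE -cintegralD//; [|exact: ip_integrable..].
  by apply: eq_cintegral => x _; rewrite mulrDr.
- exact: L2predD (L2valP _) (L2valP _).
- exact: aeW.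
- exact: L2D_ae.
Qed.

Lemma ipZr a phi psi : ip phi (a *: psi) = a * ip phi psi.
Proof.
rewrite (@ip_ae phi _ phi (fun x => a * psi x)) ?L2valP//.
- rewrite !ipE -cintegralZ//; last exact: ip_integrable.
  by apply: eq_cintegral => x _; rewrite mulrCA.
- exact: L2predZ (L2valP _).
- exact: aeW.
- exact: L2Z_ae.
Qed.

Lemma ip_conj phi psi : ip psi phi = (ip phi psi)^*%C.
Proof.
rewrite !ipE -cintegral_conj//; last exact: ip_integrable.
by apply: eq_cintegral => x _; rewrite rmorphM /= conjcK mulrC.
Qed.

Lemma ipDl phi psi chi : ip (psi + chi) phi = ip psi phi + ip chi phi.
Proof. by rewrite !(ip_conj phi) ipDr rmorphD. Qed.

Lemma ipZl a phi psi : ip (a *: psi) phi = a^*%C * ip psi phi.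
Proof. by rewrite !(ip_conj phi) ipZr rmorphM. Qed.

Lemma ipNr phi psi : ip phi (- psi) = - ip phi psi.
Proof. by rewrite -scaleN1r ipZr mulN1r. Qed.

Lemma ipNl phi psi : ip (- psi) phi = - ip psi phi.
Proof. by rewrite !(ip_conj phi) ipNr rmorphN. Qed.

Lemma ipBr phi psi chi : ip phi (psi - chi) = ip phi psi - ip phi chi.
Proof. by rewrite ipDr ipNr. Qed.

Lemma ipBl phi psi chi : ip (psi - chi) phi = ip psi phi - ip chi phi.
Proof. by rewrite ipDl ipNl. Qed.

Lemma ip0r phi : ip phi 0 = 0.
Proof. by rewrite -[X in ip _ X](subrr phi) ipBr subrr. Qed.

Lemma ip_csq phi : (\int[mu]_x (csq (phi x))%:E = (L2norm phi ^+ 2)%:E)%E.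
Proof.
have /L2predP[mp ip_lty] := L2valP phi.
have E : (\int[mu]_x (csq (phi x))%:E =
   \int[mu]_x (Re ((phi x)^*%C * phi x))%:E)%E.
  by apply: eq_integral => x _; rewrite cReM cReJ cImJ mulNr opprK.
rewrite /L2norm sqr_sqrtr /=.
  rewrite E fineK// -E ge0_fin_numE// integral_ge0// => x _.
  by rewrite lee_fin csq_ge0.
by rewrite -E fine_ge0// integral_ge0// => x _; rewrite lee_fin csq_ge0.
Qed.

Lemma ipxx phi : ip phi phi = (L2norm phi ^+ 2)%:C%C.
Proof.
have J := ip_conj phi phi.
have I0 : Im (ip phi phi) = 0.
  have /eqP := congr1 (fun z : R[i] => Im z) J; rewrite cImJ => /eqP ?; lra.
apply: complex_eq => //.
rewrite cReC; apply: EFin_inj; rewrite -ip_csq /=.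
have /L2predP[mp ip_lty] := L2valP phi.
have E : (\int[mu]_x (csq (phi x))%:E =
   \int[mu]_x (Re ((phi x)^*%C * phi x))%:E)%E.
  by apply: eq_integral => x _; rewrite cReM cReJ cImJ mulNr opprK.
by rewrite E fineK// -E ge0_fin_numE// integral_ge0// => x _;
  rewrite lee_fin csq_ge0.
Qed.

(** The underlying real scalar product. Polarization recovers it from norms, its limits are limits
    of real sequences, and [ip_rip] returns to the complex product through the vector [- i psi]. *)
Definition rip phi psi : R := Re (ip phi psi).

Lemma ip_rip phi psi : ip phi psi = Complex (rip phi psi) (rip phi (- 'i%C *: psi)).
Proof.
by apply: complex_eq => //=; rewrite /rip ipZr cReM /= !(oppr0, mul0r) mulN1r opprK add0r.
Qed.

Lemma ripDr phi psi chi : rip phi (psi + chi) = rip phi psi + rip phi chi.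
Proof. by rewrite /rip ipDr cReD. Qed.
Lemma ripDl phi psi chi : rip (psi + chi) phi = rip psi phi + rip chi phi.
Proof. by rewrite /rip ipDl cReD. Qed.
Lemma ripNr phi psi : rip phi (- psi) = - rip phi psi.
Proof. by rewrite /rip ipNr cReN. Qed.
Lemma ripNl phi psi : rip (- psi) phi = - rip psi phi.
Proof. by rewrite /rip ipNl cReN. Qed.
Lemma ripC phi psi : rip phi psi = rip psi phi.
Proof. by rewrite /rip ip_conj cReJ. Qed.
Lemma ripZr (a : R) phi psi : rip phi (a%:C%C *: psi) = a * rip phi psi.
Proof. by rewrite /rip ipZr cReM cReC cImC mul0r subr0. Qed.
Lemma ripxx phi : rip phi phi = L2norm phi ^+ 2.
Proof. by rewrite /rip ipxx. Qed.

Lemma L2norm_ge0 phi : 0 <= L2norm phi.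
Proof. exact: sqrtr_ge0. Qed.

Lemma L2norm_eq0 phi : L2norm phi = 0 -> phi = 0.
Proof.
move=> n0; have := ip_csq phi; rewrite n0 expr0n /= => /eqP I0.
have /L2predP[mp _] := L2valP phi.
apply/L2_eqP.
have /(ae_eq_integral_abs mu measurableT) h : measurable_fun setT (fun x => (csq (phi x))%:E).
  by apply/measurable_EFinP; exact: cmeasurable_csq.
have {}h : ae_eq mu setT (fun x => (csq (phi x))%:E) (cst 0%E).
  apply/h; move/eqP : I0 => I0; rewrite -[RHS]I0; apply: eq_integral => x _.
  by rewrite gee0_abs// lee_fin csq_ge0.
have z : {ae mu, forall x, (0 : L2 R) x = 0}.
  have := L2Z_ae 0 (0 : L2 R); rewrite scale0r; apply: aeS => x ->.
  by rewrite mul0r.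
apply: aeS2 h z => x /= h -> ; apply: csq_eq0.
by have := h Logic.I => -[].
Qed.

Lemma L2norm0 : L2norm (0 : L2 R) = 0.
Proof. by rewrite /L2norm ip0r /= sqrtr0. Qed.

Lemma L2norm_sqrD phi psi : L2norm (phi + psi) ^+ 2 =
  L2norm phi ^+ 2 + 2 * rip phi psi + L2norm psi ^+ 2.
Proof.
rewrite -!ripxx !(ripDl, ripDr) (ripC psi phi).
by move: (rip _ _) (rip _ _) (rip _ _) => a b c; ring.
Qed.

Lemma L2normZ a phi : L2norm (a *: phi) = cabs a * L2norm phi.
Proof.
apply/eqP; rewrite -(@eqrXn2 _ 2)// ?L2norm_ge0 ?mulr_ge0 ?cabs_ge0 ?L2norm_ge0//.
apply/eqP; rewrite -ripxx /rip ipZr ipZl ipxx exprMn sqr_cabs.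
by rewrite /csq !cReImE; ring.
Qed.

Lemma L2normN phi : L2norm (- phi) = L2norm phi.
Proof.
apply/eqP; rewrite -(@eqrXn2 _ 2)// ?L2norm_ge0//.
by rewrite -!ripxx ripNr ripNl opprK.
Qed.

Lemma L2norm_distC phi psi : L2norm (phi - psi) = L2norm (psi - phi).
Proof. by rewrite -L2normN opprB. Qed.

(** Cauchy-Schwarz, by expanding the square of the norm of [|psi| phi - |phi| psi]. Dividing by
    [|phi| |psi|] forces the two degenerate cases apart. *)
Lemma rip_le phi psi : rip phi psi <= L2norm phi * L2norm psi.
Proof.
have [/eqP p0|p0] := eqVneq (L2norm psi) 0.
  move: p0 => /eqP p0; rewrite p0 mulr0 (L2norm_eq0 _ p0).
  by rewrite /rip ip0r.
have pp : 0 < L2norm psi by rewrite lt_neqAle eq_sym p0 L2norm_ge0.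
have := sqr_ge0 (L2norm ((L2norm psi)%:C%C *: phi - (L2norm phi)%:C%C *: psi)).
rewrite L2norm_sqrD L2normN ripNr ripZr ripC ripZr !L2normZ.
have ca (x : R) : 0 <= x -> cabs x%:C%C = x.
  by move=> x0; rewrite cabsE /csq /= expr0n addr0 sqrtr_sqr ger0_norm.
rewrite !ca ?L2norm_ge0// (ripC psi) => h.
have [/eqP f0|f0] := eqVneq (L2norm phi) 0.
  move: f0 => /eqP f0; rewrite f0 mul0r (L2norm_eq0 _ f0) ripC.
  by rewrite /rip ip0r.
have fp : 0 < L2norm phi by rewrite lt_neqAle eq_sym f0 L2norm_ge0.
rewrite -(ler_pM2l fp) -(ler_pM2l pp); nra.
Qed.

Lemma rip_norm_le phi psi : `|rip phi psi| <= L2norm phi * L2norm psi.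
Proof.
rewrite ler_norml rip_le andbT lerNl -ripNr.
by rewrite (le_trans (rip_le _ _))// L2normN.
Qed.

Lemma L2norm_triangle phi psi : L2norm (phi + psi) <= L2norm phi + L2norm psi.
Proof.
rewrite -(@ler_pXn2r _ 2)// ?nnegrE ?addr_ge0 ?L2norm_ge0//.
rewrite L2norm_sqrD; have := rip_le phi psi; nra.
Qed.

Lemma L2norm_triangleB phi psi chi :
  L2norm (phi - chi) <= L2norm (phi - psi) + L2norm (psi - chi).
Proof. by rewrite -[X in L2norm X](subrKA psi) L2norm_triangle. Qed.

Lemma L2norm_dist phi psi : `|L2norm phi - L2norm psi| <= L2norm (phi - psi).
Proof.
have h (f g : L2 R) : L2norm f - L2norm g <= L2norm (f - g).
  by rewrite lerBlDr -[X in L2norm X <= _](subrK g) L2norm_triangle.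
by rewrite ler_norml h andbT lerNl opprB L2norm_distC h.
Qed.

Lemma rip_polar phi psi :
  rip phi psi = (L2norm (phi + psi) ^+ 2 - L2norm (phi - psi) ^+ 2) / 4.
Proof.
rewrite (L2norm_sqrD phi psi) (L2norm_sqrD phi (- psi)) L2normN ripNr.
by move: (rip _ _) (L2norm phi) (L2norm psi) => a b c; field.
Qed.

(** Polarization gives the real part of the product from norms; linearity over the complex scalars
    gives the imaginary part through multiplication by [-i]. *)
Lemma linear_isometry_ip (T : L2 R -> L2 R) : linear T ->
  (forall phi, L2norm (T phi) = L2norm phi) ->
  forall phi psi, ip (T phi) (T psi) = ip phi psi.
Proof.
move=> lT nT.
have TD phi psi : T (phi + psi) = T phi + T psi.
  by rewrite -[X in X + psi]scale1r lT scale1r.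
have T0 : T 0 = 0 by apply: L2norm_eq0; rewrite nT L2norm0.
have TZ a phi : T (a *: phi) = a *: T phi by rewrite -[a *: phi]addr0 lT T0 addr0.
have rT phi psi : rip (T phi) (T psi) = rip phi psi.
  have TN : T (- psi) = - T psi by rewrite -scaleN1r TZ scaleN1r.
  by rewrite !rip_polar -TN -!TD !nT.
by move=> phi psi; rewrite !ip_rip -TZ !rT.
Qed.

Lemma ip_eq phi psi : (forall chi, ip chi phi = ip chi psi) -> phi = psi.
Proof.
move=> h; apply/eqP; rewrite -subr_eq0; apply/eqP; apply: L2norm_eq0.
have : L2norm (phi - psi) ^+ 2 = 0 by rewrite -ripxx /rip ipBr h subrr.
by move/eqP; rewrite sqrf_eq0 => /eqP.
Qed.

End HilbertSpace.

Section Measurability.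
Context {R : realType}.
Implicit Types g h : R -> R[i].

Lemma cmeasurableB g h : cmeasurable g -> cmeasurable h ->
  cmeasurable (fun x => g x - h x).
Proof.
move=> [g1 g2] [h1 h2]; split.
  by under eq_fun do rewrite cReD cReN; exact: measurable_funB.
by under eq_fun do rewrite cImD cImN; exact: measurable_funB.
Qed.

Lemma cmeasurable_indic (A : set R) : measurable A ->
  cmeasurable (fun x => (\1_A x)%:C%C : R[i]).
Proof. by move=> mA; split; [exact: measurable_indic|exact: measurable_cst]. Qed.

Lemma cmeasurable_L2 (phi : L2 R) : cmeasurable phi.
Proof. exact: L2pred_meas (L2valP phi). Qed.

End Measurability.

(** * Limit theorems for real-valued integrals *)

Section ConvergenceTheorems.
Context {R : realType}.
Variables (mu : {measure set R -> \bar R}) (D : set R).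
Hypothesis mD : measurable D.

Lemma Rdominated_convergence (f_ : nat -> R -> R) (f g : R -> R) :
  (forall n, measurable_fun D (f_ n)) -> measurable_fun D f ->
  {ae mu, forall x, D x -> f_ n x @[n --> \oo] --> f x} ->
  mu.-integrable D (EFin \o g) -> (forall n x, D x -> `|f_ n x| <= g x) ->
  mu.-integrable D (EFin \o f) /\
  Rintegral mu D (f_ n) @[n --> \oo] --> Rintegral mu D f.
Proof.
move=> mf_ mf cf ig fg.
have [|||||i _ c] := @dominated_convergence _ _ _ mu D mD
  (fun n => EFin \o f_ n) (EFin \o f) (EFin \o g).
- by move=> n; exact/measurable_EFinP.
- exact/measurable_EFinP.
- have F : Filter (nbhs (almost_everywhere mu)) by exact: ae_filter_ringOfSetsType.
  by move: cf; apply: filterS => x cf Dx; apply/cvg_EFin; [exact: nearW|exact: cf].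
- exact: ig.
- by apply: aeW => x n Dx; rewrite lee_fin fg.
split => //; rewrite /Rintegral; apply: fine_cvg; rewrite fineK//.
exact: integrable_fin_num.
Qed.

(** Fatou as lower semicontinuity: a common bound on the integrals survives a pointwise limit
    without any domination. *)
Lemma fatou_le (f_ : nat -> R -> R) (f : R -> R) (M : \bar R) :
  (forall n, measurable_fun D (f_ n)) -> (forall n x, D x -> 0 <= f_ n x) ->
  (forall x, D x -> f_ n x @[n --> \oo] --> f x) ->
  (forall n, \int[mu]_(x in D) (f_ n x)%:E <= M)%E ->
  (\int[mu]_(x in D) (f x)%:E <= M)%E.
Proof.
move=> mf_ f0 cf fM.
have := @fatou _ _ _ mu D mD (fun n x => (f_ n x)%:E)
  (fun n => (measurable_EFinP _ _).2 (mf_ n)) (fun n x Dx => f0 n x Dx).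
have -> : (\int[mu]_(x in D) limn_einf (fun n => (f_ n x)%:E) =
  \int[mu]_(x in D) (f x)%:E)%E.
  apply: eq_integral => x /set_mem Dx.
  have c : (f_ n x)%:E @[n --> \oo] --> (f x)%:E.
    by apply/cvg_EFin; [exact: nearW|exact: cf].
  rewrite is_cvg_limn_einfE; first exact/cvg_lim.
  by apply/cvg_ex; exists (f x)%:E.
move=> /le_trans; apply; rewrite limn_einf_lim; apply: lime_le.
  exact: is_cvg_einfs.
apply: nearW => n; apply: le_trans (fM n).
by apply: ereal_inf_lbound; exists n => //=.
Qed.

End ConvergenceTheorems.

(** * Completeness of L2 *)

Section Completeness.
Context {R : realType}.
Local Notation mu := (@leb R).

Lemma weighted_increments_cvg (a : nat -> R) (M : R) :
  (forall n, \sum_(k < n) (2 ^ k)%:R * (a k.+1 - a k) ^+ 2 <= M) -> cvgn a.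
Proof.
move=> aM.
have -> : a = (fun n => a 0%N + series (telescope a) n).
  by apply/funext => n; exact: eq_sum_telescope.
apply: is_cvgD; first exact: is_cvg_cst.
apply: normed_cvg; apply: nondecreasing_is_cvgn.
  by apply: nondecreasing_series => n _ _; exact: normr_ge0.
(* Each increment [d] satisfies [2 |d| <= 2^k d^2 + 2^-k]; the bound is [M] for the weighted squares
   plus 2 for the geometric series. *)
exists (M + 2) => _ [n _ <-]; rewrite /normed_series_of /series /= big_mkord.
have h2 m : \sum_(k < m) ((2 ^ k)%:R : R)^-1 = 2 - 2 * ((2 ^ m)%:R)^-1.
  elim: m => [|m IH]; first by rewrite big_ord0 expn0 invr1 mulr1 subrr.
  rewrite big_ord_recr /= IH expnS natrM invfM mulrA divff ?mul1r ?pnatr_eq0//.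
  by move: (_^-1) => z; ring.
apply: (@le_trans _ _ (\sum_(k < n) ((2 ^ k)%:R * (a k.+1 - a k) ^+ 2 + ((2 ^ k)%:R)^-1))).
  apply: ler_sum => k _; rewrite /telescope.
  have p0 : 0 < (2 ^ k)%:R :> R by rewrite ltr0n expn_gt0.
  move: p0; set p := (2 ^ k)%:R => p0; set d := _ - _.
  have -> : p * d ^+ 2 + p^-1 = (p * `|d| - 1) ^+ 2 / p + 2 * `|d|.
    rewrite -[d ^+ 2]real_normK ?num_real//; move: `|d| => e.
    by field; rewrite gt_eqF.
  have := normr_ge0 d; have : 0 <= (p * `|d| - 1) ^+ 2 / p.
    by rewrite divr_ge0 ?sqr_ge0// ltW.
  lra.
rewrite big_split /= h2; apply: lerD; first exact: aM.
by rewrite lerBlDr lerDl mulr_ge0// invr_ge0 ler0n.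
Qed.

Lemma L2cvg_uniq T (F : set_system T) (FF : ProperFilter F) (u : T -> L2 R) phi psi :
  L2cvg F u phi -> L2cvg F u psi -> phi = psi.
Proof.
move=> up uq; apply/eqP; rewrite -subr_eq0; apply/eqP/L2norm_eq0/eqP.
apply: contrapT => /negP n0.
have e0 : 0 < L2norm (phi - psi) / 2.
  by rewrite divr_gt0// lt_neqAle eq_sym n0 L2norm_ge0.
have [t [h1 h2]] := filter_ex (filterI (cvgr0_norm_lt _ up _ e0) (cvgr0_norm_lt _ uq _ e0)).
move: h1 h2; rewrite !ger0_norm ?L2norm_ge0// => h1 h2.
have := L2norm_triangleB phi (u t) psi; rewrite [L2norm (phi - u t)]L2norm_distC.
move: h1 h2; move: (L2norm _) (L2norm _) (L2norm _) => a b c; lra.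
Qed.

(* Along a subsequence whose k-th increment [d k] has norm less than
   2^-(k+1), the series of the [2^k |d k|^2] has a finite integral; so it
   converges almost everywhere, and there AM-GM makes the increments summable. *)
Lemma L2_complete (u : nat -> L2 R) :
  (forall e, 0 < e -> exists N, forall m n, (N <= m)%N -> (N <= n)%N ->
     L2norm (u m - u n) < e) -> exists phi, L2cvg \oo u phi.
Proof.
move=> uC.
have {}uC k : {N | forall m n, (N <= m)%N -> (N <= n)%N ->
     L2norm (u m - u n) < ((2 ^ k.+1)%:R)^-1}.
  by apply/cid/uC; rewrite invr_gt0 ltr0n expn_gt0.
pose N k := sval (uC k).
(* Summing the thresholds gives indices that are monotone and at least [N k] by construction. *)
pose i k := (\sum_(j < k.+1) N j)%N.
have Ni k : (N k <= i k)%N by rewrite /i big_ord_recr /= leq_addl.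
have ii k : (i k <= i k.+1)%N by rewrite /i [leqRHS]big_ord_recr /= leq_addr.
pose v k := (u (i k) : R -> R[i]).
have mv k : cmeasurable (v k) by exact: cmeasurable_L2.
pose d k x := v k.+1 x - v k x.
have md k : cmeasurable (d k).
  exact: cmeasurableB.
have dE (m n : nat) : (\int[mu]_x (csq (v m x - v n x))%:E =
    (L2norm (u (i m) - u (i n)) ^+ 2)%:E)%E.
  rewrite -ip_csq; apply: ae_eq_integral => //.
  - apply/measurable_EFinP; apply: cmeasurable_csq.
    exact: cmeasurableB.
  - apply/measurable_EFinP; exact: (cmeasurable_csq _ (cmeasurable_L2 _)).
  - by apply: aeS (L2B_ae (u (i m)) (u (i n))) => x -> .
pose w k x := ((2 ^ k)%:R * csq (d k x))%:E : \bar R.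
have mw k : measurable_fun setT (w k).
  apply/measurable_EFinP; apply: measurable_funM => //.
  exact: cmeasurable_csq.
have w0 k x : (0 <= w k x)%E by rewrite lee_fin mulr_ge0 ?csq_ge0.
pose G x := (\sum_(k <oo) w k x)%E.
have mG : measurable_fun setT G by apply: ge0_emeasurable_sum => //.
have iG : (\int[mu]_x G x < +oo)%E.
  rewrite integral_nneseries//; apply: (@le_lt_trans _ _ 1%:E); last exact: ltry.
  apply: le_trans (epsilon_trick0 xpredT (ler01 : 0 <= 1 :> R)).
  apply: lee_nneseries => k _; first by rewrite integral_ge0.
  rewrite /w; under eq_integral do rewrite EFinM.
  rewrite ge0_integralZl_EFin//; first last.
  - by apply/measurable_EFinP; exact: cmeasurable_csq.
  - by move=> x _; rewrite lee_fin csq_ge0.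
  rewrite dE -EFinM lee_fin div1r.
  have /ltW h : L2norm (u (i k.+1) - u (i k)) < ((2 ^ k.+1)%:R)^-1.
    by apply: (svalP (uC k)); rewrite ?(leq_trans (Ni k)).
  have p0 : 0 < (2 ^ k)%:R :> R by rewrite ltr0n expn_gt0.
  move: h; rewrite expnS natrM; set p := (2 ^ k)%:R in p0 *.
  have q0 : 0 < (2 * p)^-1 by rewrite invr_gt0 mulr_gt0.
  have pq : p * (2 * p)^-1 = 2^-1 by field; rewrite gt_eqF.
  have := L2norm_ge0 (u (i k.+1) - u (i k)); move: (L2norm _) => z z0 zq.
  have : z ^+ 2 <= (2 * p)^-1 ^+ 2 by rewrite ler_pXn2r// nnegrE ltW.
  move=> /(ler_wpM2l (ltW p0)) /le_trans; apply.
  rewrite expr2 mulrA pq ler_pdivrMl// ler_peMl//; lra.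
pose A := [set x | (G x < +oo)%E].
have mA : measurable A.
  rewrite -[A]setTI; exact: emeasurable_fun_infty_o.
have aeA : {ae mu, forall x, A x}.
  have : mu.-integrable setT G.
    apply/integrableP; split => //.
    by under eq_integral do rewrite gee0_abs ?nneseries_ge0//.
  move=> /(integrable_ae measurableT); apply: aeS => x /(_ Logic.I).
  by rewrite fin_numE => /andP[_ Gx]; rewrite /A /= ltey.
have cA x : A x -> cvgn (fun k => Re (v k x)) /\ cvgn (fun k => Im (v k x)).
  move=> Ax.
  have Gx : G x \is a fin_num.
    by rewrite ge0_fin_numE// /G nneseries_ge0.
  have h n : \sum_(k < n) (2 ^ k)%:R * csq (d k x) <= fine (G x).
    rewrite -lee_fin fineK// -sumEFin /G.
    rewrite -(big_mkord xpredT (fun k => ((2 ^ k)%:R * csq (d k x))%:E)).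
    by apply: nneseries_lim_ge => k _ _; exact: w0.
  split; apply: (@weighted_increments_cvg _ (fine (G x))) => n;
    apply: le_trans (h n); apply: ler_sum => k _;
    rewrite ler_wpM2l// /csq /d ?(cReD, cReN, cImD, cImN) ?lerDl ?lerDr ?sqr_ge0//.
(* Multiplication by the indicator of [A] makes the limit exist at every point, so the limit
   function is measurable with no exceptional set. *)
pose r (p : R[i] -> R) x := limn (fun k => p (v k x) * \1_A x).
have cr (p : R[i] -> R) : (forall x, A x -> cvgn (fun k => p (v k x))) ->
    forall x, p (v k x) * \1_A x @[k --> \oo] --> r p x.
  move=> pc x; rewrite /r indicE; case: (boolP (x \in A)) => [/set_mem Ax|nAx] /=.
    by apply: is_cvgM; [exact: pc|exact: is_cvg_cst].
  by under eq_fun do rewrite mulr0; apply: is_cvg_cst.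
have mr (p : R[i] -> R) : (forall k, measurable_fun setT (fun x => p (v k x))) ->
    (forall x, A x -> cvgn (fun k => p (v k x))) -> measurable_fun setT (r p).
  move=> mp pc; apply: (measurable_fun_cvg (h := fun k x => p (v k x) * \1_A x)).
    by move=> k; apply: measurable_funM.
  by move=> x _; exact: cr.
pose g x := Complex (r Re x) (r Im x).
have mg : cmeasurable g.
  split; [apply: mr|apply: mr] => [k|x Ax|k|x Ax].
  - by have [] := mv k.
  - by have [] := cA x Ax.
  - by have [] := mv k.
  - by have [] := cA x Ax.
(* Fatou in the second index of the Cauchy estimate. With [m = 0] and [e = 1] it shows that [g] is
   square integrable, and with the small thresholds it gives the convergence. *)
have bound (m : nat) (e : R) : 0 <= e ->
    (forall k, (m <= k)%N -> L2norm (u (i m) - u (i k)) <= e) ->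
    (\int[mu]_x (csq ((v m x - g x) * (\1_A x)%:C%C))%:E <= (e ^+ 2)%:E)%E.
  move=> e0 he.
  pose F k x := csq ((v m x - v (k + m)%N x) * (\1_A x)%:C%C).
  have mF k : measurable_fun setT (F k).
    apply: cmeasurable_csq; apply: cmeasurableM.
      have [a1 a2] := mv m; have [b1 b2] := mv (k + m)%N; split.
        by under eq_fun do rewrite cReD cReN; exact: measurable_funB.
      by under eq_fun do rewrite cImD cImN; exact: measurable_funB.
    exact: cmeasurable_indic.
  apply: (@fatou_le _ mu setT measurableT F) => //.
  - by move=> k x _; exact: csq_ge0.
  - move=> x _; rewrite /F /csq; under eq_fun do rewrite !cReImE !mulr0 subr0 add0r.
    have c1 := cr Re (fun x Ax => (cA x Ax).1) x.
    have c2 := cr Im (fun x Ax => (cA x Ax).2) x.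
    have E (p : R[i] -> R) : {morph p : a b / a + b} -> {morph p : a / - a} ->
      (forall x, A x -> cvgn (fun k => p (v k x))) ->
      ((p (v m x) - p (v (k + m)%N x)) * \1_A x) ^+ 2 @[k --> \oo] -->
      ((p (v m x) - r p x) * \1_A x) ^+ 2.
      move=> pD pN pc; rewrite expr2; under eq_fun do rewrite expr2.
      have h : (p (v m x) - p (v (k + m)%N x)) * \1_A x @[k --> \oo] -->
        (p (v m x) - r p x) * \1_A x.
        rewrite mulrBl; under eq_fun do rewrite mulrBl.
        apply: cvgB; first exact: cvg_cst.
        have -> : r p x * \1_A x = r p x.
          rewrite /r indicE; case: (x \in A); first by rewrite mulr1.
          rewrite mulr0; under eq_fun do rewrite mulr0.
          by rewrite lim_cst.
        rewrite (cvg_shiftn m (fun k => p (v k x) * \1_A x)).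
        exact: cr.
      exact: cvgM.
    rewrite !cReImE !mulr0 subr0 add0r; apply: cvgD.
      exact: (E _ cReD cReN (fun x Ax => (cA x Ax).1)).
    exact: (E _ cImD cImN (fun x Ax => (cA x Ax).2)).
  - move=> k; apply: (@le_trans _ _ (\int[mu]_x (csq (v m x - v (k + m)%N x))%:E)%E).
      apply: ge0_le_integral => //.
      + by move=> x _; rewrite lee_fin csq_ge0.
      + exact/measurable_EFinP.
      + apply/measurable_EFinP; apply: cmeasurable_csq.
        have [a1 a2] := mv m; have [b1 b2] := mv (k + m)%N; split.
          by under eq_fun do rewrite cReD cReN; exact: measurable_funB.
        by under eq_fun do rewrite cImD cImN; exact: measurable_funB.
      + move=> x _; rewrite lee_fin /F csqM indicE.
        by case: (x \in A); rewrite /csq /= ?expr0n ?expr1n ?addr0 ?mulr1 ?mulr0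
          ?addr_ge0 ?sqr_ge0.
    rewrite dE lee_fin ler_pXn2r ?nnegrE ?L2norm_ge0//.
    by apply: he; rewrite leq_addl.
have mi m n : (m <= n)%N -> (i m <= i n)%N.
  move=> /subnK <-; elim: (n - m)%N => // k IH.
  by rewrite addSn (leq_trans IH).
have aeB m (phi : L2 R) : {ae mu, forall x, phi x = g x} ->
    (\int[mu]_x (csq ((v m x - g x) * (\1_A x)%:C%C))%:E =
     (L2norm (u (i m) - phi) ^+ 2)%:E)%E.
  move=> pg; rewrite -ip_csq; apply: ae_eq_integral => //.
  - apply/measurable_EFinP; apply: cmeasurable_csq; apply: cmeasurableM.
      exact: cmeasurableB.
    exact: cmeasurable_indic.
  - apply/measurable_EFinP; exact: (cmeasurable_csq _ (cmeasurable_L2 _)).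
  have h : {ae mu, forall x, A x /\ phi x = g x} by apply: aeS2 aeA pg.
  apply: aeS2 h (L2B_ae (u (i m)) phi) => x [Ax pgx] -> _; rewrite pgx indicE mem_set//.
  by rewrite mulr1.
have gL : g \in L2pred.
  apply/L2predP; split => //.
  have b0 := bound 0%N 1 ler01 _.
  apply: (@le_lt_trans _ _ (\int[mu]_x (2%:E * ((csq ((v 0 x - g x) * (\1_A x)%:C%C))%:E
    + (csq (v 0 x))%:E)))%E).
    apply: ae_ge0_le_integral => //.
    - by move=> x _; rewrite lee_fin csq_ge0.
    - by apply/measurable_EFinP; apply: cmeasurable_csq.
    - by move=> x _; rewrite mule_ge0 ?adde_ge0 ?lee_fin ?csq_ge0.
    - apply/measurable_EFinP; apply: measurable_funM => //; apply: measurable_funD.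
        apply: cmeasurable_csq; apply: cmeasurableM.
          exact: cmeasurableB.
        exact: cmeasurable_indic.
      exact: cmeasurable_csq.
    - apply: aeS aeA => x Ax _; rewrite indicE mem_set// mulr1 -EFinD -EFinM lee_fin.
      have := csqD (- (v 0 x - g x)) (v 0 x).
      by rewrite csqN opprB subrK.
  rewrite ge0_integralZl_EFin//; first last.
  - apply: emeasurable_funD; apply/measurable_EFinP.
      apply: cmeasurable_csq; apply: cmeasurableM.
        exact: cmeasurableB.
      exact: cmeasurable_indic.
    exact: cmeasurable_csq.
  - by move=> x _; rewrite adde_ge0 ?lee_fin ?csq_ge0.
  rewrite ge0_integralD//; first last.
  - by apply/measurable_EFinP; apply: cmeasurable_csq.
  - by move=> x _; rewrite lee_fin csq_ge0.
  - apply/measurable_EFinP; apply: cmeasurable_csq; apply: cmeasurableM.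
      exact: cmeasurableB.
    exact: cmeasurable_indic.
  - by move=> x _; rewrite lee_fin csq_ge0.
  rewrite ip_csq; apply: lte_mul_pinfty => //.
  apply: lte_add_pinfty; last exact: ltry.
  apply: le_lt_trans (b0 _) _; last exact: ltry.
  move=> k _; apply/ltW/(@lt_le_trans _ _ ((2 ^ 1)%:R^-1)).
    by apply: (svalP (uC 0%N)); [exact: Ni|apply: leq_trans (Ni 0%N) _; exact: mi].
  by rewrite invf_le1// ler1n.
exists (toL2 g); apply/cvgr0Pnorm_le => e e0.
have [m hm] : exists m, ((2 ^ m)%:R)^-1 < e.
  have [m _ hm] := near_infty_natSinv_lt (PosNum e0).
  exists m; apply: le_lt_trans (hm m (leqnn m)).
  rewrite lef_pV2 ?posrE ?ltr0n ?expn_gt0// ler_nat.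
  exact: ltn_expl.
exists (i m) => // n /= mn; rewrite ger0_norm ?L2norm_ge0//.
rewrite (le_trans (L2norm_triangleB _ (u (i m)) _))//.
have h k : (i m <= k)%N -> L2norm (u (i m) - u k) <= ((2 ^ m.+1)%:R)^-1.
  by move=> mk; apply/ltW; apply: (svalP (uC m)); [exact: Ni|exact: leq_trans (Ni m) mk].
have hb : L2norm (u (i m) - toL2 g) <= ((2 ^ m.+1)%:R)^-1.
  rewrite -(@ler_pXn2r _ 2)// ?nnegrE ?L2norm_ge0 ?invr_ge0 ?ler0n//.
  rewrite -lee_fin -aeB; last exact: toL2_ae.
  by apply: bound => [|k mk]; [rewrite invr_ge0 ler0n|apply/h/mi].
rewrite L2norm_distC; apply: (le_trans (lerD (h _ mn) hb)).
rewrite expnS natrM; apply: le_trans (ltW hm); rewrite invfM.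
have := invr_ge0 ((2 ^ m)%:R : R); rewrite ler0n.
by move: (_^-1) => z; lra.
Qed.

End Completeness.

(** * Change of variables and Fubini *)

Section ChangeOfVariables.
Context {R : realType}.
Local Notation mu := (@leb R).
Variables (s : R -> R) (c : R).
Hypotheses (ms : measurable_fun setT s) (c0 : 0 <= c).
Hypothesis lebs : forall A, measurable A -> leb (s @^-1` A) = (c%:E * leb A)%E.

(** The hypothesis [lebs] says that the image of Lebesgue measure under [s] is [c] times Lebesgue
    measure. Thus [c] is an inverse Jacobian: 1 for shifts and the reflection, [r] for division by
    [r]. *)
Let ge0_integral_comp_in (D : set R) (f : R -> \bar R) : measurable D ->
  measurable_fun D f ->
  (forall x, D x -> 0 <= f x)%E ->
  (\int[mu]_(x in s @^-1` D) f (s x) = c%:E * \int[mu]_(x in D) f x)%E.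
Proof.
move=> mD mf f0.
have f0' : {in D, forall x, (0 <= f x)%E} by move=> x /set_mem/f0.
have := @ge0_integral_pushforward _ _ R R R s ms mu D f mD mf f0'.
move=> <-; rewrite -(ge0_integral_mscale mu mD (NngNum c0) mf f0) /=.
by apply: eq_measure_integral => A mA _; exact: lebs.
Qed.

Lemma ge0_integral_comp (f : R -> \bar R) : measurable_fun setT f ->
  (forall x, 0 <= f x)%E -> (\int[mu]_x f (s x) = c%:E * \int[mu]_x f x)%E.
Proof. by move=> mf f0; rewrite -ge0_integral_comp_in. Qed.

Lemma integrable_comp_in (D : set R) (f : R -> R) : measurable D ->
  mu.-integrable D (EFin \o f) ->
  mu.-integrable (s @^-1` D) (EFin \o (f \o s)).
Proof.
move=> mD /integrableP[/measurable_EFinP mf fi]; apply/integrableP; split.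
  apply/measurable_EFinP; apply: (measurable_comp mD) => //.
    by move=> _ [x Dx <-].
  exact: measurable_funTS.
have := @ge0_integral_comp_in D (fun x => `|f x|%:E) mD.
move=> ->//; last by apply/measurable_EFinP; exact: measurableT_comp.
by rewrite lte_mul_pinfty.
Qed.

Lemma integrable_comp (f : R -> R) : mu.-integrable setT (EFin \o f) ->
  mu.-integrable setT (EFin \o (f \o s)).
Proof. exact: (@integrable_comp_in setT). Qed.

Lemma Rintegral_comp_in (D : set R) (f : R -> R) : measurable D ->
  mu.-integrable D (EFin \o f) ->
  Rintegral mu (s @^-1` D) (f \o s) = c * Rintegral mu D f.
Proof.
move=> mD fi; have /integrableP[mf _] := fi.
rewrite /Rintegral -[c]/(fine c%:E) -fineM//; last first.
  exact: integrable_fin_num.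
congr fine; rewrite integralE [in RHS]integralE.
rewrite muleBr//; last first.
  rewrite fin_num_adde_defl// fin_numN.
  by apply: integrable_neg_fin_num.
congr (_ - _)%E.
  rewrite -ge0_integral_comp_in; [by apply: eq_integral => x _; rewrite unlock|by []|exact: measurable_funepos|].
  by move=> x _; exact: funepos_ge0.
rewrite -ge0_integral_comp_in; [by apply: eq_integral => x _; rewrite unlock|by []|exact: measurable_funeneg|].
by move=> x _; exact: funeneg_ge0.
Qed.

Lemma Rintegral_comp (f : R -> R) : mu.-integrable setT (EFin \o f) ->
  Rintegral mu setT (f \o s) = c * Rintegral mu setT f.
Proof. exact: (@Rintegral_comp_in setT). Qed.

End ChangeOfVariables.

Section AffineMaps.
Context {R : realType}.
Local Notation mu := (@leb R).

Lemma leb_opp (A : set R) : measurable A -> leb (-%R @^-1` A) = (1%:E * leb A)%E.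
Proof. by move=> mA; rewrite mul1e; exact: lebesgue_measureN. Qed.

(** Uniqueness of Lebesgue measure: [a] times the image measure gives every half-open interval its
    length. *)
Lemma leb_affine (a b : R) : 0 < a -> forall A, measurable A ->
  leb ((fun x => a * x + b) @^-1` A) = (a^-1%:E * leb A)%E.
Proof.
move=> a0 A mA.
pose s0 : measurableTypeR R -> measurableTypeR R := fun x => a * x + b.
have ms0 : measurable_fun setT s0.
  by apply: measurable_funD => //; exact: measurable_funM.
pose m : {measure set (measurableTypeR R) -> \bar R} :=
  mscale (NngNum (ltW a0)) (pushforward lebesgue_measure s0).
have h : forall A, measurable A -> lebesgue_measure A = m ms0 A.
  apply: lebesgue_measure_unique => _ [[x y] _ <-].
  have E : s0 @^-1` `]x, y] = `](x - b) / a, (y - b) / a]%classic.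
    apply/seteqP; split => z /=; rewrite /s0 !in_itv /=.
      by move=> /andP[? ?]; rewrite ltr_pdivrMr// ler_pdivlMr// mulrC ltrBlDr lerBrDr; apply/andP.
    by rewrite ltr_pdivrMr// ler_pdivlMr// mulrC ltrBlDr lerBrDr.
  rewrite -[RHS]/(a%:E * lebesgue_measure (s0 @^-1` `]x, y]))%E E.
  rewrite !lebesgue_measure_itv /= !lte_fin ltr_pM2r ?invr_gt0// ltrD2r.
  case: ifPn => _; last by rewrite mule0.
  rewrite -!EFinD -EFinM; congr EFin; field; exact: lt0r_neq0.
rewrite /leb [in RHS]h// /m /mscale /= /pushforward muleA -EFinM.
by rewrite mulVf ?lt0r_neq0// mul1e.
Qed.

Lemma measurable_affine (a b : R) : measurable_fun setT (fun x : R => a * x + b).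
Proof. by apply: measurable_funD => //; exact: measurable_funM. Qed.

Lemma leb_shift (b : R) A : measurable A ->
  leb ((fun x => x + b) @^-1` A) = (1%:E * leb A)%E.
Proof.
move=> mA; rewrite -[in RHS]invr1 -(leb_affine 1 b ltr01 _ mA).
by have -> : (fun x => x + b) = (fun x => 1 * x + b) by apply/funext => x; rewrite mul1r.
Qed.

Lemma measurable_shift (b : R) : measurable_fun setT (fun x : R => x + b).
Proof. exact: measurable_funD. Qed.

End AffineMaps.

Section BoundedKernel.
Context {R : realType}.
Local Notation mu := (@leb R).
Implicit Types a b : R -> R.

Lemma integrable_bounded_mul (f b : R -> R) (M : R) : measurable_fun setT f ->
  (forall x, `|f x| <= M) -> mu.-integrable setT (EFin \o b) ->
  mu.-integrable setT (EFin \o (fun x => f x * b x)).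
Proof.
move=> mf fM ib; have /integrableP[/measurable_EFinP mb _] := ib.
apply: (le_integrable measurableT) (integrableZl measurableT M ib).
  by apply/measurable_EFinP; exact: measurable_funM.
move=> x _; rewrite -EFinM /= lee_fin !normrM ler_wpM2r//.
by rewrite (le_trans (fM x))// ler_norm.
Qed.

Variables (K : R * R -> R) (M : R).
Hypotheses (mK : measurable_fun setT K) (KM : forall z, `|K z| <= M).

Lemma measurable_partial_integral (f : R * R -> \bar R) :
  measurable_fun setT f -> (forall z, 0 <= f z)%E ->
  measurable_fun setT (fun x => \int[mu]_y f (x, y))%E.
Proof. exact: (measurable_fun_fubini_tonelli_F (m2 := mu)). Qed.

(** The integrand is signed, so it is split into positive and negative parts, to each of which the
    Tonelli measurability statement applies. *)
Lemma measurable_kernel_integral b : measurable_fun setT b ->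
  measurable_fun setT (fun x => Rintegral mu setT (fun y => K (x, y) * b y)).
Proof.
move=> mb; apply: measurableT_comp => //.
pose f (z : R * R) := (K z * b z.2)%:E.
have mf : measurable_fun setT f.
  apply/measurable_EFinP; apply: measurable_funM => //.
  exact: measurableT_comp measurable_snd.
under eq_fun do rewrite integralE.
apply: emeasurable_funB.
  have E x : (\int[mu]_y ((fun y => (K (x, y) * b y)%:E)^\+ y) =
      \int[mu]_y (f^\+ (x, y)))%E by apply: eq_integral => y _; rewrite unlock.
  under eq_fun do rewrite E.
  exact: (measurable_partial_integral (f^\+)%E (measurable_funepos mf)
    (funepos_ge0 f)).
have E x : (\int[mu]_y ((fun y => (K (x, y) * b y)%:E)^\- y) =
    \int[mu]_y (f^\- (x, y)))%E by apply: eq_integral => y _; rewrite unlock.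
under eq_fun do rewrite E.
exact: (measurable_partial_integral (f^\-)%E (measurable_funeneg mf)
  (funeneg_ge0 f)).
Qed.

Lemma kernel_integral_bound b x : mu.-integrable setT (EFin \o b) ->
  `|Rintegral mu setT (fun y => K (x, y) * b y)| <=
     M * Rintegral mu setT (fun y => `|b y|).
Proof.
move=> ib.
have mKx : measurable_fun setT (fun y => K (x, y)) by exact: measurableT_comp.
have ik := @integrable_bounded_mul _ b M mKx (fun y => KM (x, y)) ib.
apply: (le_trans (le_normr_Rintegral measurableT ik)).
have ib' : mu.-integrable setT (EFin \o (fun y => `|b y|)) by exact: integrable_norm.
rewrite -RintegralZl//; apply: le_Rintegral => //.
- exact: integrable_norm.
- exact: (integrableZl measurableT M ib').
- by move=> y _; rewrite normrM ler_wpM2r.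
Qed.

(** A bounded kernel against two integrable functions is dominated on the plane by [M |a x| |b y|].
    All exchanges of integrals for the Hartley transform are instances. *)
Lemma kernel_fubini a b : mu.-integrable setT (EFin \o a) ->
  mu.-integrable setT (EFin \o b) ->
  Rintegral mu setT (fun x => a x * Rintegral mu setT (fun y => K (x, y) * b y)) =
  Rintegral mu setT (fun y => b y * Rintegral mu setT (fun x => K (x, y) * a x)).
Proof.
move=> ia ib; have /integrableP[/measurable_EFinP ma ia_] := ia.
have /integrableP[/measurable_EFinP mb ib_] := ib.
pose f (z : R * R) := (a z.1 * (K z * b z.2))%:E.
have mf : measurable_fun setT f.
  apply/measurable_EFinP; apply: measurable_funM.
    exact: measurableT_comp measurable_fst.
  apply: measurable_funM => //.
  exact: measurableT_comp measurable_snd.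
have M0 : 0 <= M by apply: le_trans (KM (0, 0)).
have fi : (mu \x mu)%E.-integrable setT f.
  apply/integrable12ltyP => //.
  apply: (@le_lt_trans _ _ (\int[mu]_x ((M * `|a x|)%:E * \int[mu]_y `|(b y)%:E|))%E).
    apply: ge0_le_integral => //.
    - by move=> x _; exact: integral_ge0.
    - apply: (measurable_partial_integral (abse \o f)).
        exact: measurableT_comp.
      by move=> z; exact: abse_ge0.
    - apply: emeasurable_funM => //; apply/measurable_EFinP.
      by apply: measurable_funM => //; exact: measurableT_comp.
    - move=> x _; rewrite -ge0_integralZl_EFin//; last 2 first.
      + by apply: measurableT_comp => //; exact/measurable_EFinP.
      + by rewrite mulr_ge0.
      apply: ge0_le_integral => //.
      + apply: measurableT_comp => //; apply/measurable_EFinP.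
        rewrite /=; apply: measurable_funM; first exact: measurable_cst.
        by apply: measurable_funM => //; exact: measurableT_comp.
      + apply: emeasurable_funM => //; apply: measurableT_comp => //.
        exact/measurable_EFinP.
      + move=> y _; rewrite /f /= -EFinM lee_fin !normrM (mulrC M) -mulrA.
        by rewrite ler_wpM2l// ler_wpM2r.
  under eq_integral do rewrite EFinM muleC muleA.
  rewrite ge0_integralZl//; last 2 first.
  - by apply/measurable_EFinP; exact: measurableT_comp.
  - by rewrite mule_ge0// integral_ge0.
  rewrite lte_mul_pinfty ?mule_ge0 ?integral_ge0//.
  rewrite fin_numM// ge0_fin_numE//.
  exact: integral_ge0.
have := Fubini fi; rewrite /f /= => F.
have mKx x : measurable_fun setT (fun y => K (x, y)) by exact: measurableT_comp.
have mKy y : measurable_fun setT (fun x => K (x, y)) by exact: measurableT_comp.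
rewrite /Rintegral; congr fine; transitivity (\int[mu]_x \int[mu]_y (a x * (K (x, y) * b y))%:E)%E.
  apply: eq_integral => x _.
  have ik := @integrable_bounded_mul _ b M (mKx x) (fun y => KM (x, y)) ib.
  under [RHS]eq_integral do rewrite EFinM.
  rewrite integralZl// EFinM fineK//.
  exact: integrable_fin_num.
rewrite F; apply: eq_integral => y _.
have ik := @integrable_bounded_mul _ a M (mKy y) (fun x => KM (x, y)) ia.
transitivity (\int[mu]_x ((b y)%:E * (K (x, y) * a x)%:E))%E.
  by apply: eq_integral => x _; rewrite -EFinM; congr EFin; ring.
rewrite integralZl// EFinM fineK//.
exact: integrable_fin_num.
Qed.

End BoundedKernel.

(** * The Poisson kernel *)

Section ExponentialDamping.
Context {R : realType}.
Local Notation mu := (@leb R).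
Implicit Types e z x y k : R.

Lemma is_derive_scale (a x : R) : is_derive x 1 (fun k : R => a * k) a.
Proof.
have h := is_deriveM (is_derive_cst a x 1) (is_derive_id x (1 : R)).
apply: (is_derive_eq h).
by rewrite /GRing.scale /= mulr1 mulr0 addr0.
Qed.

Lemma damped_cvg0 e (w : R -> R) (M : R) : 0 < e -> (forall k, `|w k| <= M) ->
  expR (- (e * k)) * w k @[k --> +oo] --> 0.
Proof.
move=> e0 wM; have M0 : 0 <= M by apply: le_trans (wM 0).
apply/cvgr0Pnorm_lt => d d0; near=> k.
(* The threshold comes from [expR (e k) >= 1 + e k], which gives [M < d (e k) <= d expR (e k)]. *)
have k0 : M / d / e < k by near: k; apply: nbhs_pinfty_gt; exact: num_real.
rewrite normrM (gtr0_norm (expR_gt0 _)) expRN mulrC ltr_pdivrMr ?expR_gt0//.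
apply: le_lt_trans (wM k) _.
have h : M < d * (e * k) by rewrite -ltr_pdivrMl// -ltr_pdivrMl// mulrC (mulrC d^-1).
apply: lt_le_trans h _; rewrite ler_pM2l//.
by apply: le_trans (expR_ge1Dx _); rewrite lerDr.
Unshelve. all: by end_near. Qed.

(** A primitive of [e^{-e k} (1 + cos (z k))]. The summand 1 makes the integrand nonnegative, as the
    fundamental theorem on a half line asks; it is subtracted again in [integral_damp_cos]. *)
Let G e z k := expR (- (e * k)) *
  ((- e^-1) + (- (e / (e ^+ 2 + z ^+ 2))) * cos (z * k) +
   (z / (e ^+ 2 + z ^+ 2)) * sin (z * k)).

Let dG e z x : 0 < e ->
  is_derive x 1 (G e z) (expR (- (e * x)) * (1 + cos (z * x))).
Proof.
move=> e0; have ez : 0 < e ^+ 2 + z ^+ 2 by rewrite ltr_pwDl ?sqr_ge0// exprn_gt0.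
pose E k := expR (- (e * k)); pose C k := cos (z * k); pose S k := sin (z * k).
have dE : is_derive x 1 E (- e * E x).
  have -> : E = expR \o (fun k => (- e) * k).
    by apply/funext => k; rewrite /E /= mulNr.
  have h := is_derive_scale (- e) x.
  by apply: is_derive_eq; rewrite /= mulNr mulrC.
have dC : is_derive x 1 C (- z * S x).
  have h := is_derive_scale z x.
  have -> : C = cos \o (fun k => z * k) by [].
  by apply: is_derive_eq; rewrite /= /S; ring.
have dS : is_derive x 1 S (z * C x).
  have h := is_derive_scale z x.
  have -> : S = sin \o (fun k => z * k) by [].
  by apply: is_derive_eq; rewrite /= /C; ring.
have d1 := is_deriveM (is_derive_cst (- (e / (e ^+ 2 + z ^+ 2))) x 1) dC.
have d2 := is_deriveM (is_derive_cst (z / (e ^+ 2 + z ^+ 2)) x 1) dS.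
have h := is_deriveM dE (is_deriveD (is_deriveD (is_derive_cst (- e^-1) x 1) d1) d2).
apply: (is_derive_eq h).
rewrite -[RHS]/(E x * (1 + C x)) -[LHS]/(E x *
  (0 + (- (e / (e ^+ 2 + z ^+ 2)) * (- z * S x) + C x * 0) +
   (z / (e ^+ 2 + z ^+ 2) * (z * C x) + S x * 0)) +
  (- e^-1 + - (e / (e ^+ 2 + z ^+ 2)) * C x + z / (e ^+ 2 + z ^+ 2) * S x) *
    (- e * E x)).
by field; rewrite !gt_eqF.
Qed.

Let g e z k := expR (- (e * `|k|)) * (1 + cos (z * k)).

Let continuous_g e z : continuous (g e z).
Proof.
move=> x; apply: cvgM.
  apply: (continuous_comp (f := fun k : R => - (e * `|k|)) (g := expR)); last exact: continuous_expR.
  apply: cvgN; apply: cvgM; first exact: cvg_cst.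
  exact: norm_continuous.
apply: cvgD; first exact: cvg_cst.
apply: (continuous_comp (f := fun k : R => z * k) (g := cos)); last exact: continuous_cos.
by apply: cvgM; [exact: cvg_cst|exact: cvg_id].
Qed.

(** By evenness the integral is twice that over [k >= 0], where [G] tends to 0 at infinity; so the
    value is [- 2 G(0)]. *)
Let integral_g e z : 0 < e ->
  (\int[mu]_k (g e z k)%:E = (2 * (e^-1 + e / (e ^+ 2 + z ^+ 2)))%:E)%E.
Proof.
move=> e0.
have g0 k : 0 <= g e z k.
  by rewrite mulr_ge0 ?expR_ge0//; have := cos_geN1 (z * k); lra.
rewrite -ge0_integral_leb//; last 2 first.
- by apply/measurable_EFinP; apply: continuous_measurable_fun; exact: continuous_g.
- by move=> x _; rewrite lee_fin.
have gN : g e z =1 g e z \o -%R by move=> x; rewrite /g /= normrN mulrN cosN.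
rewrite (@ge0_symfun_integralT R (g e z) g0 (continuous_g e z) gN).
have -> : [set x : R | 0 <= x] = `[0, +oo[%classic.
  by apply/seteqP; split => x /=; rewrite in_itv /= andbT.
rewrite (@ge0_continuous_FTC2y _ _ (G e z) _ 0).
- rewrite /G !mulr0 oppr0 expR0 cos0 sin0 -EFinB -EFinM; congr EFin.
  by ring.
- by move=> x _; exact: g0.
- exact/continuous_subspaceT/continuous_g.
- apply: (@damped_cvg0 e _ (e^-1 + `|e / (e ^+ 2 + z ^+ 2)| + `|z / (e ^+ 2 + z ^+ 2)|)) => // k.
  apply: le_trans (ler_normD _ _) _; apply: lerD.
    apply: le_trans (ler_normD _ _) _; apply: lerD.
      by rewrite normrN gtr0_norm// invr_gt0.
    by rewrite normrM normrN ler_piMr// cos_max.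
  by rewrite normrM ler_piMr// sin_max.
- by move=> x x0; have [] := dG e z x e0.
- have : {for 0, continuous (G e z)}.
    by apply/differentiable_continuous/derivable1_diffP; have [] := dG e z 0 e0.
  by move=> h; exact: cvg_at_right_filter.
- move=> x; rewrite in_itv /= andbT => x0; rewrite derive1E.
  have [_ ->] := dG e z x e0; rewrite /g gtr0_norm//.
Qed.

Let measurable_g e z : measurable_fun setT (g e z).
Proof. by apply: continuous_measurable_fun; exact: continuous_g. Qed.

Let integrable_g e z : 0 < e -> mu.-integrable setT (EFin \o g e z).
Proof.
move=> e0; apply/integrableP; split; first by apply/measurable_EFinP; exact: measurable_g.
under eq_integral.
  move=> x _; rewrite gee0_abs; last first.
    by rewrite lee_fin mulr_ge0 ?expR_ge0//; have := cos_geN1 (z * x); lra.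
  over.
by rewrite integral_g// ltry.
Qed.

Definition damp e k := expR (- (e * `|k|)).

Lemma damp_gt0 e k : 0 < damp e k. Proof. exact: expR_gt0. Qed.

Lemma damp_le1 e k : 0 < e -> damp e k <= 1.
Proof. by move=> e0; rewrite -expR0 ler_expR oppr_le0 mulr_ge0// ltW. Qed.

Lemma continuous_damp e : continuous (damp e).
Proof.
move=> x; apply: (continuous_comp (f := fun k : R => - (e * `|k|)) (g := expR)); last exact: continuous_expR.
apply: cvgN; apply: cvgM; first exact: cvg_cst.
exact: norm_continuous.
Qed.

Lemma measurable_damp e : measurable_fun setT (damp e).
Proof. by apply: continuous_measurable_fun; exact: continuous_damp. Qed.

Lemma damp_cvg1 k : damp n.+1%:R^-1 k @[n --> \oo] --> (1 : R).
Proof.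
have h : - (n.+1%:R^-1 * `|k|) @[n --> \oo] --> (0 : R).
  rewrite -oppr0; apply: cvgN; rewrite -[X in _ --> X](mul0r `|k|).
  by apply: cvgM; [exact: cvg_harmonic|exact: cvg_cst].
have := @continuous_cvg nat R R \oo _ _ expR 0 (@continuous_expR R 0) h.
by rewrite expR0; apply.
Qed.

Lemma integrable_damp e : 0 < e -> mu.-integrable setT (EFin \o damp e).
Proof.
move=> e0; apply: eq_integrable (integrableZl measurableT 2^-1 (integrable_g e 0 e0)) => //.
move=> x _ /=; rewrite /g mul0r cos0 -EFinM; congr EFin.
by rewrite /damp; field.
Qed.

(** [damp e] is half of [g e 0], because [1 + cos 0 = 2]; removing it from [g e z] leaves the cosine
    integral. *)
Lemma integral_damp_cos e z : 0 < e ->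
  Rintegral mu setT (fun k => damp e k * cos (z * k)) = 2 * (e / (e ^+ 2 + z ^+ 2)).
Proof.
move=> e0.
have E : Rintegral mu setT (damp e) = 2 / e.
  transitivity (2^-1 * Rintegral mu setT (g e 0)).
    rewrite -RintegralZl//; last exact: integrable_g.
    apply: eq_Rintegral => x _; rewrite /g mul0r cos0 /damp.
    by field.
  by rewrite /Rintegral integral_g//= expr0n addr0; field; exact: lt0r_neq0.
transitivity (Rintegral mu setT (g e z) - Rintegral mu setT (damp e)).
  rewrite -RintegralB//; [|exact: integrable_g|exact: integrable_damp].
  by apply: eq_Rintegral => x _; rewrite /g /damp; ring.
by rewrite E /Rintegral integral_g//=; ring.
Qed.

Lemma Rintegral_odd (q : R -> R) : mu.-integrable setT (EFin \o q) ->
  (forall k, q (- k) = - q k) -> Rintegral mu setT q = 0.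
Proof.
have mo : measurable_fun setT (@GRing.opp R) by exact: oppr_measurable.
move=> iq oq; have := Rintegral_comp -%R 1 mo ler01 leb_opp q iq.
have -> : q \o -%R = (fun k => -1 * q k) by apply/funext => k /=; rewrite oq mulN1r.
by rewrite RintegralZl// mul1r => h; lra.
Qed.

(** The Hartley kernel. Unlike [cos] or [sin] alone it sees both even and odd functions, and
    [cas (k x)] stays real and symmetric in [k] and [x]. *)
Definition cas z : R := cos z + sin z.

Lemma cas_le2 z : `|cas z| <= 2.
Proof.
apply: le_trans (ler_normD _ _) _; have := cos_max z; have := sin_max z; lra.
Qed.

Lemma continuous_cas : continuous cas.
Proof. by move=> x; apply: cvgD; [exact: continuous_cos|exact: continuous_sin]. Qed.

Lemma measurable_cas : measurable_fun setT cas.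
Proof. by apply: continuous_measurable_fun; exact: continuous_cas. Qed.

Lemma measurable_casM : measurable_fun setT (fun z : R * R => cas (z.1 * z.2)).
Proof.
apply: measurableT_comp; first exact: measurable_cas.
by apply: measurable_funM; [exact: measurable_fst|exact: measurable_snd].
Qed.

Lemma measurable_cas_l x : measurable_fun setT (fun k => cas (k * x)).
Proof.
apply: measurableT_comp; first exact: measurable_cas.
exact: measurable_funM.
Qed.

(** Product formula [cas a cas b = cos (a - b) + sin (a + b)]: the sine term is odd in [k] and
    integrates to 0 against the even damping. *)
Lemma integral_damp_cas e x y : 0 < e ->
  Rintegral mu setT (fun k => damp e k * cas (k * x) * cas (k * y)) =
  2 * (e / (e ^+ 2 + (x - y) ^+ 2)).
Proof.
move=> e0; rewrite -(integral_damp_cos e (x - y) e0).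
have bI (h : R -> R) : continuous h -> (forall k, `|h k| <= 1) ->
    mu.-integrable setT (EFin \o (fun k => damp e k * h k)).
  move=> ch h1; have mh := continuous_measurable_fun ch.
  have := integrable_bounded_mul h (damp e) 1 mh h1 (integrable_damp e e0).
  by apply: eq_integrable => // k _ /=; rewrite mulrC.
have cz z : continuous (fun k : R => cos (z * k)).
  move=> k; apply: (continuous_comp (f := fun k : R => z * k) (g := cos)); last exact: continuous_cos.
  by apply: cvgM; [exact: cvg_cst|exact: cvg_id].
have sz z : continuous (fun k : R => sin (z * k)).
  move=> k; apply: (continuous_comp (f := fun k : R => z * k) (g := sin)); last exact: continuous_sin.
  by apply: cvgM; [exact: cvg_cst|exact: cvg_id].
have iC := bI _ (cz (x - y)) (fun k => cos_max _).
have iS := bI _ (sz (x + y)) (fun k => sin_max _).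
have S0 := Rintegral_odd _ iS.
rewrite -[RHS]addr0 -S0; last by move=> k; rewrite /damp normrN mulrN sinN mulrN.
rewrite -RintegralD//; apply: eq_Rintegral => k _.
rewrite -mulrA -mulrDr; congr (_ * _); rewrite /cas.
have -> : (x - y) * k = k * x - k * y by ring.
have -> : (x + y) * k = k * x + k * y by ring.
by rewrite cosB sinD; ring.
Qed.

End ExponentialDamping.

Section PoissonKernel.
Context {R : realType}.
Local Notation mu := (@leb R).
Implicit Types e z x y : R.

(** The Poisson kernel of the half plane at height [e], of total mass 1. The damped integral of two
    [cas] factors equals [2 pi] times it, and the two Hartley normalizations absorb this [2 pi]. *)
Definition poisson e z := pi^-1 * (e / (e ^+ 2 + z ^+ 2)).

Lemma poisson_den e z : 0 < e -> 0 < e ^+ 2 + z ^+ 2.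
Proof. by move=> e0; rewrite ltr_pwDl ?sqr_ge0// exprn_gt0. Qed.

Lemma poisson_ge0 e z : 0 < e -> 0 <= poisson e z.
Proof.
move=> e0; rewrite mulr_ge0 ?invr_ge0 ?pi_ge0// divr_ge0 ?ltW//.
exact: poisson_den.
Qed.

Lemma poisson_le e z : 0 < e -> poisson e z <= pi^-1 * e^-1.
Proof.
move=> e0; rewrite ler_wpM2l ?invr_ge0 ?pi_ge0//.
rewrite ler_pdivrMr ?poisson_den// mulrDr.
rewrite expr2 mulrA mulVf ?lt0r_neq0// mul1r lerDl.
by rewrite mulr_ge0 ?sqr_ge0// invr_ge0 ltW.
Qed.

Lemma continuous_poisson e : 0 < e -> continuous (poisson e).
Proof.
move=> e0 x; apply: cvgM; first exact: cvg_cst.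
apply: cvgM; first exact: cvg_cst.
apply: cvgV; first exact/lt0r_neq0/poisson_den.
apply: cvgD; first exact: cvg_cst.
exact: exprn_continuous.
Qed.

Lemma measurable_poisson e : 0 < e -> measurable_fun setT (poisson e).
Proof. by move=> e0; apply: continuous_measurable_fun; exact: continuous_poisson. Qed.

Lemma is_derive_poisson_primitive e x y : 0 < e ->
  is_derive y 1 (fun y => pi^-1 * atan (e^-1 * (y - x))) (poisson e (y - x)).
Proof.
move=> e0.
have d1 : is_derive y 1 (fun y : R => e^-1 * (y - x)) e^-1.
  apply: (@is_derive_eq _ _ _ (cst e^-1 * (id - cst x) : R -> R)).
  by rewrite /GRing.scale /= subr0 mulr1 mulr0 addr0.
have d2 : is_derive y 1 (atan \o (fun y : R => e^-1 * (y - x)))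
    ((1 + (e^-1 * (y - x)) ^+ 2)^-1 * e^-1).
  by apply: is_derive_eq.
apply: (@is_derive_eq _ _ _ (cst pi^-1 * (atan \o (fun y : R => e^-1 * (y - x))) : R -> R)).
rewrite /GRing.scale /= mulr0 addr0 /poisson; congr (_ * _).
by field; rewrite !gt_eqF ?poisson_den//.
Qed.

Lemma poissonN e z : poisson e (- z) = poisson e z.
Proof. by rewrite /poisson sqrrN. Qed.

(** Translation and evenness reduce to the half line, where the arctangent primitive rises from 0 to
    [pi^-1 (pi / 2)], that is 1/2. *)
Lemma integral_poisson e x : 0 < e -> (\int[mu]_y (poisson e (x - y))%:E = 1)%E.
Proof.
move=> e0.
have mp := measurable_poisson e e0.
have mP : measurable_fun setT (EFin \o poisson e) by exact/measurable_EFinP.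
transitivity (\int[mu]_y (poisson e (y + - x))%:E)%E.
  by apply: eq_integral => y _; rewrite -poissonN opprB.
rewrite (ge0_integral_comp _ 1 (measurable_shift (- x)) ler01 (leb_shift (- x))
  (fun y => (poisson e y)%:E))//; last by move=> y; rewrite lee_fin poisson_ge0.
rewrite mul1e -ge0_integral_leb//; last by move=> y _; rewrite lee_fin poisson_ge0.
rewrite ge0_symfun_integralT; last 3 first.
- by move=> y; exact: poisson_ge0.
- exact: continuous_poisson.
- by move=> y; rewrite /= poissonN.
have -> : [set x : R | 0 <= x] = `[0, +oo[%classic.
  by apply/seteqP; split => z /=; rewrite in_itv /= andbT.
have dF y := is_derive_poisson_primitive e 0 y e0.
rewrite (@ge0_continuous_FTC2y _ _ (fun y => pi^-1 * atan (e^-1 * (y - 0))) _ 2^-1).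
- by rewrite subr0 mulr0 atan0 mulr0 sube0 -EFinM divff.
- by move=> y _; exact: poisson_ge0.
- exact/continuous_subspaceT/continuous_poisson.
- have -> : 2^-1 = pi^-1 * (pi / 2) :> R by rewrite mulrA mulVf ?mul1r// gt_eqF ?pi_gt0.
  apply: cvgM; first exact: cvg_cst.
  under eq_fun do rewrite subr0.
  have h : e^-1 * y @[y --> +oo] --> +oo by apply: gt0_cvgMry; rewrite ?invr_gt0.
  by move=> A /cvgy_atan; exact: h.
- by move=> y y0; have [] := dF y.
- have : {for 0, continuous (fun y => pi^-1 * atan (e^-1 * (y - 0)))}.
    by apply/differentiable_continuous/derivable1_diffP; have [] := dF 0.
  by move=> h; exact: cvg_at_right_filter.
- by move=> y _; rewrite derive1E; have [_ ->] := dF y; rewrite subr0.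
Qed.

Lemma integral_poisson_itv e x a b : 0 < e -> a < b ->
  (\int[mu]_(y in `[a, b]) (poisson e (x - y))%:E =
   (pi^-1 * atan (e^-1 * (b - x)) - pi^-1 * atan (e^-1 * (a - x)))%:E)%E.
Proof.
move=> e0 ab.
have dF y := is_derive_poisson_primitive e x y e0.
have cF : continuous (fun y => pi^-1 * atan (e^-1 * (y - x))).
  by move=> y; apply/differentiable_continuous/derivable1_diffP; have [] := dF y.
have cp : continuous (fun y => poisson e (y - x)).
  move=> y; apply: (continuous_comp (f := fun y : R => y - x)); last exact: continuous_poisson.
  by apply: cvgB; [exact: cvg_id|exact: cvg_cst].
transitivity (\int[mu]_(y in `[a, b]) (poisson e (y - x))%:E)%E.
  by apply: eq_integral => y _; rewrite -poissonN opprB.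
rewrite -ge0_integral_leb//; last 2 first.
- apply/measurable_EFinP; apply: measurable_funTS.
  exact: continuous_measurable_fun.
- by move=> y _; rewrite lee_fin poisson_ge0.
rewrite (@continuous_FTC2 _ _ (fun y => pi^-1 * atan (e^-1 * (y - x))))//.
- exact: continuous_subspaceT.
- split => [y _| |]; first by have [] := dF y.
    by apply: cvg_at_right_filter; exact: cF.
  by apply: cvg_at_left_filter; exact: cF.
- by move=> y _; rewrite derive1E; have [_ ->] := dF y.
Qed.

End PoissonKernel.

(** * The Hartley transform *)

Section Hartley.
Context {R : realType}.
Local Notation mu := (@leb R).
Implicit Types (u v : R -> R) (e x y k a b : R).

Definition hartley u k : R :=
  (Num.sqrt (2 * pi))^-1 * Rintegral mu setT (fun x => cas (k * x) * u x).

Let K (z : R * R) := cas (z.1 * z.2).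
Let mK : measurable_fun setT K := measurable_casM.
Let K2 z : `|K z| <= 2 := cas_le2 _.

Let c := (Num.sqrt (2 * pi))^-1 : R.
Let c_ge0 : 0 <= c. Proof. by rewrite invr_ge0 sqrtr_ge0. Qed.
Let cc : c * c = (2 * pi)^-1.
Proof. by rewrite -invfM -expr2 sqr_sqrtr// mulr_ge0 ?pi_ge0. Qed.

Lemma measurable_hartley u : measurable_fun setT u ->
  measurable_fun setT (hartley u).
Proof.
move=> mu_; apply: measurable_funM => //.
exact: (measurable_kernel_integral _ mK).
Qed.

Lemma hartley_bound u : mu.-integrable setT (EFin \o u) -> forall k,
  `|hartley u k| <= c * (2 * Rintegral mu setT (fun x => `|u x|)).
Proof.
move=> iu k; rewrite normrM (ger0_norm c_ge0) ler_wpM2l//.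
exact: (kernel_integral_bound _ _ mK K2).
Qed.

(** Fubini and the symmetry of [cas (k x)] under exchange of its two variables. *)
Lemma hartley_adjoint u v : mu.-integrable setT (EFin \o u) ->
  mu.-integrable setT (EFin \o v) ->
  Rintegral mu setT (fun k => u k * hartley v k) =
  Rintegral mu setT (fun k => v k * hartley u k).
Proof.
move=> iu iv.
have E w w' : mu.-integrable setT (EFin \o w) -> mu.-integrable setT (EFin \o w') ->
    Rintegral mu setT (fun k => w k * hartley w' k) =
    c * Rintegral mu setT (fun k => w k *
      Rintegral mu setT (fun x => K (k, x) * w' x)).
  move=> iw iw'; have /integrableP[/measurable_EFinP mw' _] := iw'.
  rewrite -RintegralZl//; first by apply: eq_Rintegral => k _; rewrite mulrCA.
  have m := measurable_kernel_integral _ mK _ mw'.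
  have := integrable_bounded_mul _ _ _ m (fun k => kernel_integral_bound _ _ mK K2 _ k iw') iw.
  by apply: eq_integrable => // k _ /=; rewrite mulrC.
have E1 := kernel_fubini _ _ mK K2 _ _ iu iv.
rewrite (E u v iu iv) (E v u iv iu) E1; congr (_ * _).
apply: eq_Rintegral => y _; congr (_ * _); apply: eq_Rintegral => x _.
by rewrite /K /= (mulrC y).
Qed.

(** Without damping the triple integral over [k], [x], [y] need not converge absolutely. With it,
    two applications of Fubini bring the [k] integral inside, where [integral_damp_cas] turns it
    into the Poisson kernel. *)
Lemma hartley_abel e u v : 0 < e -> mu.-integrable setT (EFin \o u) ->
  mu.-integrable setT (EFin \o v) ->
  Rintegral mu setT (fun k => damp e k * (hartley u k * hartley v k)) =
  Rintegral mu setT (fun x => u x *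
    Rintegral mu setT (fun y => poisson e (x - y) * v y)).
Proof.
move=> e0 iu iv.
pose U w k := Rintegral mu setT (fun x => K (k, x) * w x).
have mU w : mu.-integrable setT (EFin \o w) -> measurable_fun setT (U w).
  by move=> /integrableP[/measurable_EFinP mw _]; exact: measurable_kernel_integral.
have bU w : mu.-integrable setT (EFin \o w) -> forall k, `|U w k| <= _ :=
  fun iw k => kernel_integral_bound _ _ mK K2 _ k iw.
have id := integrable_damp e e0.
have ia : mu.-integrable setT (EFin \o (fun k => U v k * damp e k)).
  exact: (integrable_bounded_mul _ _ _ (mU v iv) (bU v iv) id).
have ic x : mu.-integrable setT (EFin \o (fun k => cas (k * x) * damp e k)).
  exact: (integrable_bounded_mul _ _ _ (measurable_cas_l x) (fun k => cas_le2 _) id).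
have E1 := kernel_fubini _ _ mK K2 _ _ ia iu.
transitivity ((2 * pi)^-1 * Rintegral mu setT (fun k => (U v k * damp e k) * U u k)).
  rewrite -RintegralZl//; last first.
    have := integrable_bounded_mul _ _ _ (mU u iu) (bU u iu) ia.
    by apply: eq_integrable => // k _ /=; rewrite mulrC.
  by apply: eq_Rintegral => k _; rewrite /hartley -/c -/(U u k) -/(U v k) -cc; ring.
rewrite [X in _ * X]E1.
have E2 x : Rintegral mu setT (fun k => K (k, x) * (U v k * damp e k)) =
    Rintegral mu setT (fun y => v y * (2 * (e / (e ^+ 2 + (x - y) ^+ 2)))).
  have := kernel_fubini _ _ mK K2 _ _ (ic x) iv.
  rewrite -[LHS]/(Rintegral mu setT (fun k => (cas (k * x) * damp e k) * U v k)) => E3.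
  transitivity (Rintegral mu setT (fun k => (cas (k * x) * damp e k) * U v k)).
    by apply: eq_Rintegral => k _; rewrite /K /=; ring.
  rewrite E3; apply: eq_Rintegral => y _; congr (_ * _).
  rewrite -integral_damp_cas//; apply: eq_Rintegral => k _.
  by rewrite /K /=; ring.
have ip x : mu.-integrable setT (EFin \o (fun y => poisson e (x - y) * v y)).
  apply: (integrable_bounded_mul _ _ (pi^-1 * e^-1)) => //.
    apply: measurableT_comp; first exact: measurable_poisson.
    by apply: measurable_funB.
  by move=> y; rewrite ger0_norm ?poisson_ge0// poisson_le.
have E4 x : Rintegral mu setT (fun k => K (k, x) * (U v k * damp e k)) =
    (2 * pi) * Rintegral mu setT (fun y => poisson e (x - y) * v y).
  rewrite E2 -RintegralZl//; apply: eq_Rintegral => y _; rewrite /poisson.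
  have p0 : pi != 0 :> R by rewrite gt_eqF ?pi_gt0.
  by move: (pi : R) p0 (e / _) => p p0 q; field.
rewrite -RintegralZl//.
  apply: eq_Rintegral => x _; rewrite E4 mulrCA; congr (_ * _).
  by rewrite mulrA mulVf ?mul1r// mulf_neq0// gt_eqF ?pi_gt0.
pose K' (z : R * R) := cas (z.2 * z.1).
have mK' : measurable_fun setT K'.
  apply: measurableT_comp; first exact: measurable_cas.
  by apply: measurable_funM; [exact: measurable_snd|exact: measurable_fst].
have K'2 z : `|K' z| <= 2 := cas_le2 _.
have /integrableP[/measurable_EFinP ma _] := ia.
have := integrable_bounded_mul _ _ _ (measurable_kernel_integral _ mK' _ ma)
  (fun x => kernel_integral_bound _ _ mK' K'2 _ x ia) iu.
by apply: eq_integrable => // x _ /=; rewrite mulrC.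
Qed.

Let integrable_poisson_l e x (w : R -> R) : 0 < e -> mu.-integrable setT (EFin \o w) ->
  mu.-integrable setT (EFin \o (fun y => poisson e (x - y) * w y)).
Proof.
move=> e0 iw; apply: (integrable_bounded_mul _ _ (pi^-1 * e^-1)) => //.
  apply: measurableT_comp; first exact: measurable_poisson.
  by apply: measurable_funB.
by move=> y; rewrite ger0_norm ?poisson_ge0// poisson_le.
Qed.

Let integrable_poisson e x : 0 < e ->
  mu.-integrable setT (EFin \o (fun y => poisson e (x - y))).
Proof.
move=> e0; apply/integrableP; split.
  apply/measurable_EFinP; apply: measurableT_comp; first exact: measurable_poisson.
  exact: measurable_funB.
under eq_integral do rewrite gee0_abs ?lee_fin ?poisson_ge0//.
by rewrite integral_poisson// ltry.
Qed.

Let measurable_poissonB e : 0 < e ->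
  measurable_fun setT (fun z : R * R => poisson e (z.1 - z.2)).
Proof.
move=> e0; apply: measurableT_comp; first exact: measurable_poisson.
by apply: measurable_funB; [exact: measurable_fst|exact: measurable_snd].
Qed.

(** Integrating first in [x], where the kernel has mass 1: Poisson averaging preserves the integral
    of a nonnegative function. *)
Let poisson_tonelli e (w : R -> R) : 0 < e -> measurable_fun setT w ->
  (forall x, 0 <= w x) ->
  (\int[mu]_x \int[mu]_y (poisson e (x - y) * w y)%:E = \int[mu]_y (w y)%:E)%E.
Proof.
move=> e0 mw w0.
have mf : measurable_fun setT (fun z : R * R => (poisson e (z.1 - z.2) * w z.2)%:E).
  apply/measurable_EFinP; apply: measurable_funM; first exact: measurable_poissonB.
  exact: measurableT_comp measurable_snd.
have := @fubini_tonelli _ _ R R R mu mu (fun z => (poisson e (z.1 - z.2) * w z.2)%:E) mf.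
move=> -> /=; last by move=> z; rewrite lee_fin mulr_ge0 ?poisson_ge0.
apply: eq_integral => y _.
transitivity (\int[mu]_x ((w y)%:E * (poisson e (y - x))%:E))%E.
  by apply: eq_integral => x _; rewrite -EFinM mulrC -[poisson e (y - x)]poissonN opprB.
rewrite ge0_integralZl_EFin//.
- by rewrite integral_poisson// mule1.
- by move=> x _; rewrite lee_fin poisson_ge0.
- apply/measurable_EFinP; apply: measurableT_comp; first exact: measurable_poisson.
  exact: measurable_funB.
Qed.

(** The damped energy is the integral of [u] times its Poisson average, which is at most the
    integral of [u^2] at each height; Fatou then removes the damping. Only an inequality results;
    equality comes later from the involution. *)
Lemma hartley_contraction u : mu.-integrable setT (EFin \o u) ->
  (\int[mu]_x (u x ^+ 2)%:E < +oo)%E ->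
  (\int[mu]_k (hartley u k ^+ 2)%:E <= \int[mu]_x (u x ^+ 2)%:E)%E.
Proof.
move=> iu iu2; have /integrableP[/measurable_EFinP mu_ _] := iu.
have mh := measurable_hartley _ mu_.
have i2 : mu.-integrable setT (EFin \o (fun x => u x ^+ 2)).
  apply/integrableP; split; first by apply/measurable_EFinP; exact: measurable_funX.
  by under eq_integral do rewrite gee0_abs ?lee_fin ?sqr_ge0//.
apply: (@fatou_le _ mu setT measurableT
  (fun n k => damp n.+1%:R^-1 k * (hartley u k ^+ 2))).
- by move=> n; apply: measurable_funM; [exact: measurable_damp|exact: measurable_funX].
- by move=> n k _; rewrite mulr_ge0 ?sqr_ge0// ltW// damp_gt0.
- move=> k _; rewrite -[X in _ --> X]mul1r; apply: cvgM; last exact: cvg_cst.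
  exact: damp_cvg1.
move=> n; set e := n.+1%:R^-1; have e0 : 0 < e by rewrite invr_gt0.
have hb := hartley_bound _ iu.
set M := c * _ in hb.
have id : mu.-integrable setT (EFin \o (fun k => damp e k * (hartley u k * hartley u k))).
  have := integrable_bounded_mul (fun k => hartley u k * hartley u k) (damp e) (M * M)
    (measurable_funM mh mh) _ (integrable_damp e e0).
  have h k : `|hartley u k * hartley u k| <= M * M by rewrite normrM ler_pM.
  by move=> /(_ h); apply: eq_integrable => // k _ /=; rewrite mulrC.
have -> : (\int[mu]_x (damp e x * hartley u x ^+ 2)%:E =
    (Rintegral mu setT (fun k => damp e k * (hartley u k * hartley u k)))%:E)%E.
  rewrite /Rintegral fineK; last exact: integrable_fin_num.
  by apply: eq_integral => k _; rewrite expr2.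
rewrite hartley_abel//.
(* [J] and [Q] are the Poisson averages of [u] and of [u^2]; [Q] has the same integral as [u^2]. *)
pose J x := Rintegral mu setT (fun y => poisson e (x - y) * u y).
pose Q x := Rintegral mu setT (fun y => poisson e (x - y) * u y ^+ 2).
have QE : (\int[mu]_x (Q x)%:E = \int[mu]_y (u y ^+ 2)%:E)%E.
  rewrite -(poisson_tonelli e (fun y => u y ^+ 2) e0)//; last 2 first.
  - exact: measurable_funX.
  - by move=> x; exact: sqr_ge0.
  apply: eq_integral => x _; rewrite /Q /Rintegral fineK//.
  by apply: integrable_fin_num => //; exact: integrable_poisson_l.
have Q0 x : 0 <= Q x.
  by apply: Rintegral_ge0 => y _; rewrite mulr_ge0 ?sqr_ge0 ?poisson_ge0.
have bP (z : R * R) : `|poisson e (z.1 - z.2)| <= pi^-1 * e^-1.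
  by rewrite ger0_norm ?poisson_ge0// poisson_le.
have mP := measurable_poissonB e e0.
have mQ : measurable_fun setT Q.
  apply: (measurable_kernel_integral (fun z => poisson e (z.1 - z.2)) mP (fun y => u y ^+ 2)).
  exact: measurable_funX.
have iQ : mu.-integrable setT (EFin \o Q).
  apply/integrableP; split; first exact/measurable_EFinP.
  by under eq_integral do rewrite gee0_abs ?lee_fin ?Q0//; rewrite QE.
have mJ : measurable_fun setT J.
  exact: (measurable_kernel_integral (fun z => poisson e (z.1 - z.2)) mP u).
have iuJ : mu.-integrable setT (EFin \o (fun x => u x * J x)).
  have := integrable_bounded_mul J u _ mJ (fun x => kernel_integral_bound
    (fun z => poisson e (z.1 - z.2)) _ mP bP u x iu) iu.
  by apply: eq_integrable => // x _ /=; rewrite mulrC.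
(* The inequality [u(x) u(y) <= (u(x)^2 + u(y)^2) / 2], averaged over [y] against a kernel of mass
   1. *)
have pw x : u x * J x <= 2^-1 * (u x ^+ 2 + Q x).
  have ip1 := integrable_poisson e x e0.
  have ip2 := integrable_poisson_l e x _ e0 i2.
  have ip3 := integrable_poisson_l e x _ e0 iu.
  have -> : u x ^+ 2 = Rintegral mu setT (fun y => u x ^+ 2 * poisson e (x - y)).
    by rewrite RintegralZl// /Rintegral integral_poisson//= mulr1.
  rewrite /Q -RintegralD//; last exact: (integrableZl measurableT (u x ^+ 2) ip1).
  rewrite /J -!RintegralZl//; last first.
    exact: (integrableD measurableT (integrableZl measurableT (u x ^+ 2) ip1) ip2).
  apply: le_Rintegral => //.
  - exact: (integrableZl measurableT (u x) ip3).
  - exact: (integrableZl measurableT 2^-1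
      (integrableD measurableT (integrableZl measurableT (u x ^+ 2) ip1) ip2)).
  - move=> y _; have := poisson_ge0 e (x - y) e0; move: (poisson _ _) => p p0.
    have -> : u x * (p * u y) = p * (u x * u y) by ring.
    have -> : 2^-1 * (u x ^+ 2 * p + p * u y ^+ 2) = p * (2^-1 * (u x ^+ 2 + u y ^+ 2)) by ring.
    by rewrite ler_wpM2l//; have := sqr_ge0 (u x - u y); nra.
apply: (@le_trans _ _ (Rintegral mu setT (fun x => 2^-1 * (u x ^+ 2 + Q x)))%:E).
  rewrite lee_fin; apply: le_Rintegral => //.
    exact: (integrableZl measurableT 2^-1 (integrableD measurableT i2 iQ)).
  by move=> x _; exact: pw.
rewrite RintegralZl//; last exact: (integrableD measurableT i2 iQ).
rewrite RintegralD//; rewrite [X in _ + X](_ : _ = Rintegral mu setT (fun x => u x ^+ 2)); last first.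
  by rewrite /Rintegral QE.
rewrite -[leRHS]fineK; last exact: integrable_fin_num.
rewrite lee_fin -[X in _ <= X]/(Rintegral mu setT (fun x => u x ^+ 2)).
by move: (Rintegral _ _ _) => z; lra.
Qed.

Lemma atan_scale_cvg x : x != 0 ->
  atan (n.+1%:R * x) @[n --> \oo] --> (if 0 < x then pi / 2 else - (pi / 2) : R).
Proof.
move=> x0.
have pos y : 0 < y -> atan (n.+1%:R * y) @[n --> \oo] --> (pi / 2 : R).
  move=> y0; have h : (fun n => n.+1%:R * y : R) n @[n --> \oo] --> +oo.
    apply/cvgryPge => A; near=> n; rewrite -ler_pdivrMr//.
    have : A / y <= n%:R :> R by near: n; exact: nbhs_infty_ger.
    by move=> /le_trans; apply; rewrite ler_nat.
    by move=> A /cvgy_atan; exact: h.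
case: ifPn => [/pos//|]; rewrite -leNgt => xle.
have nx : 0 < - x by rewrite oppr_gt0 lt_neqAle x0.
rewrite (_ : (fun n => atan (n.+1%:R * x)) = (fun n => - atan (n.+1%:R * - x)) :> (nat -> R)).
  by apply: cvgN; exact: pos.
by apply/funext => n; rewrite mulrN atanN opprK.
Unshelve. all: by end_near. Qed.

Let indic_itv_integrable a b :
  mu.-integrable setT (EFin \o (\1_(`[a, b]%classic) : R -> R)).
Proof.
have /integrable_leb h := integrable_indic_itv a b true false.
exact: h.
Qed.

(** The Poisson average of an interval indicator is a difference of two arctangents, bounded by 1
    and convergent off the endpoints. Dominated convergence therefore removes the damping on both
    sides of [hartley_abel], with no general theorem on approximate identities. *)
Lemma hartley_parseval_itv u a b : a < b -> mu.-integrable setT (EFin \o u) ->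
  (\int[mu]_x (u x ^+ 2)%:E < +oo)%E ->
  Rintegral mu setT (fun k => hartley (\1_(`[a, b]%classic)) k * hartley u k) =
  Rintegral mu setT (fun x => \1_(`[a, b]%classic) x * u x).
Proof.
move=> ab iu iu2; set I := `[a, b]%classic.
have /integrableP[/measurable_EFinP mu_ _] := iu.
have mI : measurable I by exact: measurable_itv.
have m1 : measurable_fun setT (\1_I : R -> R) by exact: measurable_indic.
have i1 := indic_itv_integrable a b.
have i12 : (\int[mu]_x ((\1_I x : R) ^+ 2)%:E < +oo)%E.
  have E : (\int[mu]_x ((\1_I x : R) ^+ 2)%:E = \int[mu]_x (\1_I x)%:E)%E.
    by apply: eq_integral => x _; rewrite indicE; case: (x \in I); rewrite ?expr1n ?expr0n.
  by rewrite E; exact: (integrable_lty measurableT i1).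
have mh w : measurable_fun setT w -> measurable_fun setT (hartley w) := @measurable_hartley w.
have ih w : mu.-integrable setT (EFin \o w) -> (\int[mu]_x (w x ^+ 2)%:E < +oo)%E ->
    mu.-integrable setT (EFin \o (fun k => hartley w k ^+ 2)).
  move=> iw iw2; have /integrableP[/measurable_EFinP mw _] := iw.
  apply/integrableP; split; first by apply/measurable_EFinP; apply: measurable_funX; exact: mh.
  under eq_integral do rewrite gee0_abs ?lee_fin ?sqr_ge0//.
  exact: le_lt_trans (hartley_contraction _ iw iw2) iw2.
(* The dominating function on the frequency side is the sum of the two squared transforms,
   integrable by the contraction. *)
have ig := integrableD measurableT (ih _ i1 i12) (ih _ iu iu2).
pose f (n : nat) k := damp n.+1%:R^-1 k * (hartley \1_I k * hartley u k).
have mhh : measurable_fun setT (fun k => hartley \1_I k * hartley u k).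
  by apply: measurable_funM; exact: mh.
have [_ L] : mu.-integrable setT (EFin \o (fun k => hartley \1_I k * hartley u k)) /\
    Rintegral mu setT (f n) @[n --> \oo] -->
    Rintegral mu setT (fun k => hartley \1_I k * hartley u k).
  apply: (@Rdominated_convergence R mu setT measurableT f _
    (fun k => hartley \1_I k ^+ 2 + hartley u k ^+ 2)) => //.
  - by move=> n; apply: measurable_funM => //; exact: measurable_damp.
  - apply: aeW => k _; rewrite -[X in _ --> X]mul1r; apply: cvgM; last exact: cvg_cst.
    exact: damp_cvg1.
  - move=> n k _; rewrite normrM (gtr0_norm (damp_gt0 _ _)).
    apply: (@le_trans _ _ (`|hartley \1_I k * hartley u k|)).
      by rewrite ler_piMl// damp_le1// invr_gt0.
    move: (hartley _ k) (hartley _ k) => p q.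
    by rewrite ler_norml; have := sqr_ge0 (p - q); have := sqr_ge0 (p + q); nra.
(* [u] times the Poisson average of the indicator at height [1 / (n + 1)], evaluated through the
   primitive. *)
pose g (n : nat) x := u x * (pi^-1 * atan (n.+1%:R * (b - x)) - pi^-1 * atan (n.+1%:R * (a - x))).
have fg n : Rintegral mu setT (f n) = Rintegral mu setT (g n).
  have e0 : 0 < n.+1%:R^-1 :> R by rewrite invr_gt0.
  transitivity (Rintegral mu setT (fun k => damp n.+1%:R^-1 k * (hartley u k * hartley \1_I k))).
    by apply: eq_Rintegral => k _; rewrite /f (mulrC (hartley u k)).
  rewrite hartley_abel//; apply: eq_Rintegral => x _; rewrite /g; congr (_ * _).
  have := integral_poisson_itv n.+1%:R^-1 x a b e0 ab; rewrite invrK.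
  rewrite integral_mkcond => /(congr1 fine) /= <-.
  congr fine; apply: eq_integral => y _.
  by rewrite patchE indicE; case: (y \in _); rewrite ?mulr1 ?mulr0.
have matan t : measurable_fun setT (fun x => atan (t * x : R)).
  apply: measurableT_comp; last exact: measurable_funM.
  by apply: continuous_measurable_fun; exact: continuous_atan.
have mg n : measurable_fun setT (g n).
  apply: measurable_funM => //; apply: measurable_funB; apply: measurable_funM => //;
  apply: (measurableT_comp (f := fun x => atan (n.+1%:R * x))) => //; exact: measurable_funB.
have [_ L'] : mu.-integrable setT (EFin \o (fun x => \1_I x * u x)) /\
    Rintegral mu setT (g n) @[n --> \oo] --> Rintegral mu setT (fun x => \1_I x * u x).
  apply: (@Rdominated_convergence R mu setT measurableT g (fun x => \1_I x * u x) (fun x => `|u x|)) => //.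
  - exact: measurable_funM.
  (* At an endpoint one arctangent is 0 and the limit is 1/2 instead of the indicator; these two
     points form the exceptional null set. *)
  - have n0 : mu ([set a] `|` [set b]) = 0%E.
      apply: null_set_setU => //.
      + exact: lebesgue_measure_set1.
      + exact: lebesgue_measure_set1.
    exists ([set a] `|` [set b]); split => //; first exact: measurableU.
    move=> x /= h; apply: contrapT => xab; apply: h => _.
    have [xa xb] : a - x != 0 /\ b - x != 0.
      rewrite !subr_eq0; split; apply/eqP => e; apply: xab; [left|right]; by rewrite e.
    rewrite mulrC; apply: cvgM; first exact: cvg_cst.
    pose l y : R := if 0 < y then pi / 2 else - (pi / 2).
    rewrite (_ : \1_I x = pi^-1 * l (b - x) - pi^-1 * l (a - x)).
      by apply: cvgB; apply: cvgM; do ?[exact: cvg_cst]; exact: atan_scale_cvg.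
    rewrite /l !subr_gt0 indicE /I; move: xa xb; rewrite !subr_eq0 => xa xb.
    have p0 : pi != 0 :> R by rewrite gt_eqF ?pi_gt0.
    have xI : (x \in `[a, b]%classic) = (a <= x <= b).
      by apply/idP/idP; rewrite inE /= in_itv.
    rewrite xI; case: (ltP x b) => hxb; case: (ltP x a) => hxa.
    + by rewrite subrr.
    + by rewrite (ltW hxb) /=; move: (pi : R) p0 => p p0; field.
    + by have := lt_trans hxa ab; rewrite ltNge hxb.
    + by rewrite subrr leNgt (_ : b < x)// lt_neqAle xb hxb.
  - exact: integrable_norm.
  - move=> n x _; rewrite normrM ler_piMr// -mulrBr normrM.
    rewrite (gtr0_norm (_ : 0 < pi^-1)) ?invr_gt0 ?pi_gt0// ler_pdivrMl ?pi_gt0// mulr1.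
    have := atan_gtNpi2 (n.+1%:R * (b - x)); have := atan_ltpi2 (n.+1%:R * (b - x)).
    have := atan_gtNpi2 (n.+1%:R * (a - x)); have := atan_ltpi2 (n.+1%:R * (a - x)).
    by rewrite ler_norml; move: (atan _) (atan _) => p q; lra.
have E : Rintegral mu setT \o f = Rintegral mu setT \o g by apply/funext => n; exact: fg.
have <- := cvg_lim (@norm_hausdorff _ _) L; have <- := cvg_lim (@norm_hausdorff _ _) L'.
by congr (lim _); rewrite -[X in X @ _]/(Rintegral mu setT \o f) E.
Qed.

End Hartley.

(** * Functions determined by their integrals over intervals *)

Section SeparationByIntervals.
Context {R : realType}.
Local Notation mu := (@leb R).

(** Lebesgue differentiation: the indefinite integral is constantly 0, and its derivative equals the
    function almost everywhere. *)
Lemma ae_eq0_of_itv (u : R -> R) : measurable_fun setT u ->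
  (forall a b, mu.-integrable `[a, b] (EFin \o u)) ->
  (forall a b, a < b -> Rintegral mu setT (fun x => \1_(`[a, b]%classic) x * u x) = 0) ->
  {ae mu, forall x, u x = 0}.
Proof.
move=> mu_ iu u0.
pose I (n : nat) : set R := `[- n.+1%:R, n.+1%:R]%classic.
have mI n : measurable (I n) by exact: measurable_itv.
(* [u] is only locally integrable, so it is cut to a bounded window before differentiating. The
   strict inequality keeps [x] away from the base point of the indefinite integral. *)
suff h n : {ae mu, forall x, - n.+1%:R < x -> (u \_ (I n)) x = 0}.
  have := ae_foralln h; apply: aeS => x h'.
  pose n := (Num.trunc `|x|).
  have xn : x \in I n.
    rewrite inE /I /= in_itv /= -ler_norml ltW//.
    by rewrite truncnS_gt.
  have nx : - n.+1%:R < x by rewrite ltrNl (le_lt_trans _ (truncnS_gt `|x|))// -normrN ler_norm.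
  by have := h' n nx; rewrite patchE xn.
pose f := u \_ (I n).
have mf : measurable_fun setT f by apply/measurable_restrict => //; exact: measurable_funTS.
have iI : lebesgue_measure.-integrable (I n) (EFin \o u).
  by apply/integrable_leb => //; exact: iu.
have ifT : mu.-integrable setT (EFin \o f).
  have := (integrable_mkcond (EFin \o u) (mI n)).1 (iu _ _).
  by rewrite restrict_EFin.
have locf := integrable_locally (mI n) iI.
have intf y : lebesgue_measure.-integrable `[- n.+1%:R, y] (EFin \o f).
  by apply/integrable_leb => //; apply: integrableS ifT.
(* Beyond the right end of the window the cut function contributes nothing, hence the upper limit
   [min x (n + 1)]. *)
have F0 x : Rintegral lebesgue_measure `[- n.+1%:R, x] f = 0.
  have [xn|nx|->] := ltgtP x (- n.+1%:R); last 2 first.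
  - rewrite -(u0 (- n.+1%:R) (Num.min x n.+1%:R)); last first.
      by rewrite lt_min nx/= gtrN.
    rewrite /Rintegral; congr fine.
    rewrite integral_leb//; last by apply/measurable_EFinP; exact: measurable_funTS.
    rewrite [LHS]integral_mkcond; apply: eq_integral => y _.
    rewrite patchE /f patchE indicE /I.
    have E c : (y \in `[- n.+1%:R, c]%classic) = (- n.+1%:R <= y <= c).
      by apply/idP/idP; rewrite inE /= in_itv.
    rewrite !E le_min; case: (- n.+1%:R <= y) => /=; last by rewrite mul0r.
    by case: (y <= x); case: (y <= n.+1%:R); rewrite /= ?mul0r ?mul1r.
  - by rewrite set_itv1 Rintegral_set1.
  - rewrite set_itv_ge ?Rintegral_set0// bnd_simp -ltNge//.
have := @FTC1 R f (BLeft (- n.+1%:R)) intf locf; apply: aeS => x.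
have -> : (fun x : R => Rintegral lebesgue_measure [set` Interval (BLeft (- n.+1%:R)) (BRight x)] f) = cst 0.
  by apply/funext => y; exact: F0.
by move=> h nx; rewrite -[LHS]/(f x); have [|_ <-] := h; rewrite ?derive1_cst ?lte_fin.
Qed.

End SeparationByIntervals.

(** * Classes of square integrable functions and convergence in norm *)

Section MakeL2.
Context {R : realType}.
Local Notation mu := (@leb R).
Implicit Types (g h : R -> R[i]) (phi psi chi : L2 R).

Lemma toL2_eq g h : g \in L2pred -> h \in L2pred ->
  {ae mu, forall x, g x = h x} -> toL2 g = toL2 h.
Proof.
move=> gL hL gh; apply/L2_eqP.
have e : {ae mu, forall x, toL2 g x = h x} by apply: aeS2 (toL2_ae _ gL) gh => x -> ->.
by apply: aeS2 e (toL2_ae _ hL) => x -> ->.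
Qed.

Lemma toL2_unique g phi : g \in L2pred ->
  {ae mu, forall x, phi x = g x} -> phi = toL2 g.
Proof. by move=> gL e; apply/L2_eqP; apply: aeS2 e (toL2_ae _ gL) => x -> ->. Qed.

Lemma toL2D g h : g \in L2pred -> h \in L2pred ->
  toL2 (fun x => g x + h x) = toL2 g + toL2 h.
Proof.
move=> gL hL; symmetry; apply: toL2_unique; first exact: L2predD.
have e : {ae mu, forall x, toL2 g x = g x /\ toL2 h x = h x}.
  by apply: aeS2 (toL2_ae _ gL) (toL2_ae _ hL).
by apply: aeS2 e (L2D_ae (toL2 g) (toL2 h)) => x [-> ->].
Qed.

Lemma toL2Z a g : g \in L2pred -> toL2 (fun x => a * g x) = a *: toL2 g.
Proof.
move=> gL; symmetry; apply: toL2_unique; first exact: L2predZ.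
by apply: aeS2 (toL2_ae _ gL) (L2Z_ae a (toL2 g)) => x ->.
Qed.

Lemma L2norm_toL2 g : g \in L2pred ->
  ((L2norm (toL2 g) ^+ 2)%:E = \int[mu]_x (csq (g x))%:E)%E.
Proof.
move=> gL; rewrite -ip_csq; apply: ae_eq_integral => //.
- apply/measurable_EFinP; exact: (cmeasurable_csq _ (cmeasurable_L2 _)).
- by apply/measurable_EFinP; apply: cmeasurable_csq; exact: L2pred_meas.
- by apply: aeS (toL2_ae _ gL) => x ->.
Qed.

Lemma L2norm_distE g phi : cmeasurable g -> g \in L2pred ->
  (\int[mu]_x (csq (g x - phi x))%:E = (L2norm (toL2 g - phi) ^+ 2)%:E)%E.
Proof.
move=> mg gL; rewrite -ip_csq; apply: ae_eq_integral => //.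
- apply/measurable_EFinP; apply: cmeasurable_csq; apply: cmeasurableB => //.
  exact: cmeasurable_L2.
- apply/measurable_EFinP; exact: (cmeasurable_csq _ (cmeasurable_L2 _)).
- by apply: aeS2 (toL2_ae _ gL) (L2B_ae (toL2 g) phi) => x <- ->.
Qed.

Lemma ip_toL2 g h : g \in L2pred -> h \in L2pred ->
  ip (toL2 g) (toL2 h) = cintegral mu setT (fun x => (g x)^*%C * h x).
Proof. by move=> gL hL; apply: ip_ae => //; exact: toL2_ae. Qed.

Lemma ip_toL2l g phi : g \in L2pred ->
  ip (toL2 g) phi = cintegral mu setT (fun x => (g x)^*%C * phi x).
Proof.
move=> gL; apply: ip_ae => //; first exact: L2valP.
  exact: toL2_ae.
exact: aeW.
Qed.

Lemma L2pred_dominated g h : cmeasurable g -> h \in L2pred ->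
  (forall x, csq (g x) <= csq (h x)) -> g \in L2pred.
Proof.
move=> mg /L2predP[mh ih] gh; apply/L2predP; split => //.
apply: le_lt_trans ih; apply: ge0_le_integral => //.
- by move=> x _; rewrite lee_fin csq_ge0.
- by apply/measurable_EFinP; exact: cmeasurable_csq.
- by apply/measurable_EFinP; exact: cmeasurable_csq.
- by move=> x _; rewrite lee_fin.
Qed.

Lemma L2pred_csq_integrable g : g \in L2pred ->
  mu.-integrable setT (EFin \o (fun x => csq (g x))).
Proof.
move=> /L2predP[mg ig]; apply/integrableP; split.
  by apply/measurable_EFinP; exact: cmeasurable_csq.
by under eq_integral do rewrite gee0_abs ?lee_fin ?csq_ge0//.
Qed.

Lemma L2cvg_lt {T : Type} (F : set_system T) (FF : Filter F) (u : T -> L2 R) phi e :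
  0 < e -> L2cvg F u phi -> \forall t \near F, L2norm (u t - phi) < e.
Proof.
move=> e0 /cvgr0Pnorm_lt/(_ _ e0); apply: filterS => t.
by rewrite ger0_norm ?L2norm_ge0.
Qed.

Lemma ltL2cvg {T : Type} (F : set_system T) (FF : Filter F) (u : T -> L2 R) phi :
  (forall e, 0 < e -> \forall t \near F, L2norm (u t - phi) < e) -> L2cvg F u phi.
Proof.
move=> h; apply/cvgr0Pnorm_lt => e e0; apply: filterS (h e e0) => t.
by rewrite ger0_norm ?L2norm_ge0.
Qed.

Lemma L2cvg_sqr {T : Type} (F : set_system T) (FF : Filter F) (u : T -> L2 R) phi :
  L2norm (u t - phi) ^+ 2 @[t --> F] --> (0 : R) -> L2cvg F u phi.
Proof.
move=> /cvgr0Pnorm_lt c; apply: ltL2cvg => e e0.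
have e2 : 0 < e ^+ 2 by rewrite exprn_gt0.
apply: filterS (c _ e2) => n; rewrite ger0_norm ?sqr_ge0//.
by rewrite ltr_pXn2r ?nnegrE ?L2norm_ge0// ltW.
Qed.

Lemma ip_continuous_r {T : Type} (F : set_system T) (FF : Filter F) (u : T -> L2 R) phi psi :
  L2cvg F u phi -> rip psi (u t) @[t --> F] --> rip psi phi.
Proof.
move=> up; apply/cvgrPdist_le => e e0.
have e1 : 0 < e / (L2norm psi + 1).
  by rewrite divr_gt0// ltr_wpDl// L2norm_ge0.
have := L2cvg_lt F FF u phi _ e1 up; apply: filterS => t /ltW h.
rewrite -ripNr -ripDr; apply: le_trans (rip_norm_le _ _) _.
rewrite L2norm_distC; apply: le_trans (ler_wpM2l (L2norm_ge0 _) h) _.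
have n0 := L2norm_ge0 psi; rewrite mulrCA ler_piMr ?ltW//.
by rewrite ltr_pdivrMr ?mul1r ?ltrDl// ltr_wpDl.
Qed.

Lemma L2norm_continuous {T : Type} (F : set_system T) (FF : Filter F) (u : T -> L2 R) phi :
  L2cvg F u phi -> L2norm (u t) @[t --> F] --> L2norm phi.
Proof.
move=> up; apply/cvgrPdist_le => e e0.
have := L2cvg_lt F FF u phi _ e0 up; apply: filterS => t /ltW h.
by apply: le_trans (L2norm_dist _ _) _; rewrite L2norm_distC.
Qed.

End MakeL2.

Section Truncation.
Context {R : realType}.
Local Notation mu := (@leb R).
Implicit Types (phi psi chi : L2 R).

Definition symm_itv (n : nat) : set R := `[- n%:R, n%:R]%classic.

(** The same cut-off as in [fourier_trunc]. On a bounded interval a square integrable function is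
    integrable, so the transforms of its truncations are convergent integrals. *)
Definition trunc (n : nat) (g : R -> R[i]) (x : R) : R[i] :=
  (\1_(symm_itv n) x)%:C%C * g x.

Lemma measurable_symm_itv n : measurable (symm_itv n).
Proof. exact: measurable_itv. Qed.

Lemma csq_trunc n g x : csq (trunc n g x) <= csq (g x).
Proof.
rewrite csqM indicE; case: (x \in _); rewrite /csq /= ?expr1n ?expr0n ?addr0 ?mul1r//.
by rewrite mul0r addr_ge0 ?sqr_ge0.
Qed.

Lemma trunc_L2pred n g : g \in L2pred -> trunc n g \in L2pred.
Proof.
move=> gL; apply: (L2pred_dominated _ g) => // [|x]; last exact: csq_trunc.
apply: cmeasurableM; last exact: L2pred_meas.
by apply: cmeasurable_indic; exact: measurable_symm_itv.
Qed.

Lemma indic_integrable a b : mu.-integrable setT (EFin \o (\1_(`[a, b]%classic) : R -> R)).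
Proof.
have /integrable_leb h := integrable_indic_itv a b true false.
exact: h.
Qed.

Lemma indic_L2pred a b :
  (fun x => (\1_(`[a, b]%classic) x)%:C%C) \in @L2pred R.
Proof.
apply/L2predP; split; first by apply: cmeasurable_indic; exact: measurable_itv.
apply: le_lt_trans (integrable_lty measurableT (indic_integrable a b)).
apply: ge0_le_integral => //.
- by move=> x _; rewrite lee_fin csq_ge0.
- apply/measurable_EFinP; apply: cmeasurable_csq; apply: cmeasurable_indic.
  exact: measurable_itv.
- by apply/measurable_EFinP; exact: measurable_indic.
- move=> x _; rewrite lee_fin /csq /= expr0n addr0 indicE.
  by case: (x \in _); rewrite ?expr1n ?expr0n.
Qed.

Lemma trunc_integrable n g : g \in L2pred -> cintegrable mu setT (trunc n g).
Proof.
move=> gL; have := L2pred_conjM _ _ (indic_L2pred (- n%:R) n%:R) gL.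
apply: eq_cintegrable => // x _; rewrite /trunc; congr (_ * _).
by apply: complex_eq; rewrite ?cReJ ?cImJ //= oppr0.
Qed.

Lemma trunc_cvg phi : L2cvg \oo (fun n => toL2 (trunc n phi)) phi.
Proof.
have pL := L2valP phi.
have mt n : cmeasurable (trunc n phi) by apply/L2pred_meas/trunc_L2pred.
have md n : cmeasurable (fun x => trunc n phi x - phi x).
  by apply: cmeasurableB => //; exact: cmeasurable_L2.
have [_ c] : mu.-integrable setT (EFin \o (fun=> 0)) /\
  Rintegral mu setT (fun x => csq (trunc n phi x - phi x)) @[n --> \oo] -->
  Rintegral mu setT (fun=> 0).
  apply: (@Rdominated_convergence R mu setT measurableT _ _ (fun x => csq (phi x))) => //.
  - by move=> n; exact: cmeasurable_csq.
  - apply: aeW => x _; apply/cvgrPdist_le => e e0; near=> n.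
    have xn : `|x| <= n%:R by near: n; exact: nbhs_infty_ger.
    rewrite /trunc indicE mem_set; last by rewrite /symm_itv /= in_itv /= -ler_norml.
    by rewrite mul1r subrr /csq /= expr0n addr0 subrr normr0 ltW.
  - exact: L2pred_csq_integrable.
  - move=> n x _; rewrite ger0_norm ?csq_ge0// /trunc indicE.
    case: (x \in _); rewrite ?mul1r ?mul0r ?subrr ?sub0r ?csqN//.
    by rewrite {1}/csq /= expr0n addr0 csq_ge0.
rewrite /Rintegral integral0 /= in c.
have E n : fine (\int[mu]_x (csq (trunc n phi x - phi x))%:E)%E =
    L2norm (toL2 (trunc n phi) - phi) ^+ 2.
  by rewrite L2norm_distE//; exact: trunc_L2pred.
have {}c : L2norm (toL2 (trunc n phi) - phi) ^+ 2 @[n --> \oo] --> (0 : R).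
  by under eq_fun do rewrite -E.
exact: L2cvg_sqr.
Unshelve. all: by end_near. Qed.

End Truncation.

(** * Extension of the Hartley transform to all square integrable functions *)

Section HartleyOnL2.
Context {R : realType}.
Local Notation mu := (@leb R).
Implicit Types (g h : R -> R[i]) (phi psi chi : L2 R).

Definition chartley g (k : R) : R[i] :=
  Complex (hartley (fun x => Re (g x)) k) (hartley (fun x => Im (g x)) k).

Definition L12 g := g \in L2pred /\ cintegrable mu setT g.

Lemma L12_Re g : L12 g ->
  [/\ measurable_fun setT (fun x => Re (g x)),
      mu.-integrable setT (EFin \o (fun x => Re (g x))) &
      (\int[mu]_x (Re (g x) ^+ 2)%:E < +oo)%E].
Proof.
move=> [/L2predP[[m1 m2] ig] [i1 i2]]; split => //.
apply: le_lt_trans ig; apply: ge0_le_integral => //.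
- by move=> x _; rewrite lee_fin sqr_ge0.
- by apply/measurable_EFinP; exact: measurable_funX.
- by apply/measurable_EFinP; apply: cmeasurable_csq; split.
- by move=> x _; rewrite lee_fin lerDl sqr_ge0.
Qed.

Lemma L12_Im g : L12 g ->
  [/\ measurable_fun setT (fun x => Im (g x)),
      mu.-integrable setT (EFin \o (fun x => Im (g x))) &
      (\int[mu]_x (Im (g x) ^+ 2)%:E < +oo)%E].
Proof.
move=> [/L2predP[[m1 m2] ig] [i1 i2]]; split => //.
apply: le_lt_trans ig; apply: ge0_le_integral => //.
- by move=> x _; rewrite lee_fin sqr_ge0.
- by apply/measurable_EFinP; exact: measurable_funX.
- by apply/measurable_EFinP; apply: cmeasurable_csq; split.
- by move=> x _; rewrite lee_fin lerDr sqr_ge0.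
Qed.

Lemma cmeasurable_chartley g : L12 g -> cmeasurable (chartley g).
Proof.
move=> gL; have [m1 _ _] := L12_Re _ gL; have [m2 _ _] := L12_Im _ gL.
by split; exact: measurable_hartley.
Qed.

Lemma integral_csqE g : cmeasurable g -> (\int[mu]_x (csq (g x))%:E =
  \int[mu]_x (Re (g x) ^+ 2)%:E + \int[mu]_x (Im (g x) ^+ 2)%:E)%E.
Proof.
move=> [g1 g2]; rewrite -ge0_integralD//.
- by move=> x _; rewrite lee_fin sqr_ge0.
- by apply/measurable_EFinP; exact: measurable_funX.
- by move=> x _; rewrite lee_fin sqr_ge0.
- by apply/measurable_EFinP; exact: measurable_funX.
Qed.

Lemma chartley_contraction g : L12 g ->
  (\int[mu]_k (csq (chartley g k))%:E <= \int[mu]_x (csq (g x))%:E)%E.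
Proof.
move=> gL; have [m1 i1 s1] := L12_Re _ gL; have [m2 i2 s2] := L12_Im _ gL.
rewrite integral_csqE; last exact: cmeasurable_chartley.
rewrite integral_csqE//; apply: leeD; exact: hartley_contraction.
Qed.

Lemma chartley_L2pred g : L12 g -> chartley g \in L2pred.
Proof.
move=> gL; apply/L2predP; split; first exact: cmeasurable_chartley.
apply: le_lt_trans (chartley_contraction _ gL) _.
by have [/L2predP[]] := gL.
Qed.

Lemma hartleyL (a b : R) (u v : R -> R) k : mu.-integrable setT (EFin \o u) ->
  mu.-integrable setT (EFin \o v) ->
  hartley (fun x => a * u x + b * v x) k = a * hartley u k + b * hartley v k.
Proof.
move=> iu iv.
have ic (w : R -> R) : mu.-integrable setT (EFin \o w) ->
    mu.-integrable setT (EFin \o (fun x => cas (k * x) * w x)).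
  apply: (integrable_bounded_mul _ _ 2) => [|x]; last exact: cas_le2.
  apply: measurableT_comp; first exact: measurable_cas.
  exact: measurable_funM.
rewrite /hartley mulrCA (mulrCA b) -mulrDr; congr (_ * _).
rewrite -!RintegralZl//; try exact: ic.
rewrite -RintegralD//.
- by apply: eq_Rintegral => x _; ring.
- exact: (integrableZl measurableT a (ic _ iu)).
- exact: (integrableZl measurableT b (ic _ iv)).
Qed.

Lemma chartleyL (a : R[i]) g h : L12 g -> L12 h ->
  chartley (fun x => a * g x + h x) = (fun k => a * chartley g k + chartley h k).
Proof.
move=> gL hL; have [_ g1 _] := L12_Re _ gL; have [_ g2 _] := L12_Im _ gL.
have [_ h1 _] := L12_Re _ hL; have [_ h2 _] := L12_Im _ hL.
have E (c d : R) (u v w : R -> R) k : mu.-integrable setT (EFin \o u) ->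
    mu.-integrable setT (EFin \o v) -> mu.-integrable setT (EFin \o w) ->
    hartley (fun x => c * u x + d * v x + w x) k =
    c * hartley u k + d * hartley v k + hartley w k.
  move=> iu iv iw; rewrite -(hartleyL c d _ _ k iu iv).
  rewrite -[X in X + _]mul1r -[hartley w k]mul1r -hartleyL//.
    by congr hartley; apply/funext => x; rewrite !mul1r.
  exact: (integrableD measurableT (integrableZl measurableT c iu)
    (integrableZl measurableT d iv)).
case: a => a b; apply/funext => k; apply: complex_eq.
  rewrite /= -mulNr -(E a (- b) _ _ _ k g1 g2 h1).
  by congr hartley; apply/funext => x; case: (g x) (h x) => ? ? [? ?] /=; rewrite mulNr.
rewrite /= -(E a b _ _ _ k g2 g1 h2).
by congr hartley; apply/funext => x; case: (g x) (h x) => ? ? [? ?].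
Qed.

Lemma L12L a g h : L12 g -> L12 h -> L12 (fun x => a * g x + h x).
Proof.
move=> [gL gi] [hL hi]; split; first exact: (L2predD _ _ (L2predZ a _ gL) hL).
by apply: cintegrableD => //; exact: cintegrableZ.
Qed.

Lemma L12_trunc n g : g \in L2pred -> L12 (trunc n g).
Proof. by move=> gL; split; [exact: trunc_L2pred|exact: trunc_integrable]. Qed.

(** The transforms agree at every frequency, each value being an integral insensitive to null
    sets. *)
Lemma eq_chartley g h : cmeasurable g -> cmeasurable h ->
  {ae mu, forall x, g x = h x} -> chartley g = chartley h.
Proof.
move=> [g1 g2] [h1 h2] gh; apply/funext => k.
have E (p : R[i] -> R) : measurable_fun setT (p \o g) -> measurable_fun setT (p \o h) ->
    hartley (fun x => p (g x)) k = hartley (fun x => p (h x)) k.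
  move=> mg mh; rewrite /hartley; congr (_ * fine _).
  have mc : measurable_fun setT (fun x => cas (k * x)).
    apply: measurableT_comp; first exact: measurable_cas.
    exact: measurable_funM.
  apply: ae_eq_integral => //.
  - by apply/measurable_EFinP; exact: measurable_funM.
  - by apply/measurable_EFinP; exact: measurable_funM.
  - by apply: aeS gh => x ->.
by rewrite /chartley (E Re)// (E Im).
Qed.

Definition hop0 g : L2 R := toL2 (chartley g).

Lemma hop0_norm g : L12 g -> L2norm (hop0 g) <= L2norm (toL2 g).
Proof.
move=> gL; rewrite -(@ler_pXn2r _ 2)// ?nnegrE ?L2norm_ge0//.
rewrite -lee_fin !L2norm_toL2; [exact: chartley_contraction|by have [] := gL|].
exact: chartley_L2pred.
Qed.

Lemma hop0L a g h : L12 g -> L12 h ->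
  hop0 (fun x => a * g x + h x) = a *: hop0 g + hop0 h.
Proof.
move=> gL hL; rewrite /hop0 chartleyL//.
have c1 := chartley_L2pred _ gL; have c2 := chartley_L2pred _ hL.
by rewrite (toL2D _ _ (L2predZ a _ c1) c2) toL2Z.
Qed.

(** Truncations converge in norm and the transform contracts, so the transforms of the truncations
    form a Cauchy sequence. *)
Lemma hop_ex phi : exists chi, L2cvg \oo (fun n => hop0 (trunc n phi)) chi.
Proof.
apply: L2_complete => e e0.
have e2 : 0 < e / 2 by rewrite divr_gt0.
have [N _ hN] := L2cvg_lt \oo _ _ _ _ e2 (trunc_cvg phi).
exists N => m n Nm Nn.
have L k := L12_trunc k _ (L2valP phi).
have -> : hop0 (trunc m phi) - hop0 (trunc n phi) =
    hop0 (fun x => -1 * trunc n phi x + trunc m phi x).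
  by rewrite hop0L// scaleN1r addrC.
apply: le_lt_trans (hop0_norm _ (L12L (-1) _ _ (L n) (L m))) _.
have tL k : trunc k phi \in L2pred by apply: trunc_L2pred; exact: L2valP.
rewrite (toL2D _ _ (L2predZ (-1) _ (tL n)) (tL m)) toL2Z// scaleN1r addrC.
apply: le_lt_trans (L2norm_triangleB _ phi _) _.
rewrite [L2norm (phi - _)]L2norm_distC.
by have := hN m Nm; have := hN n Nn; move: (L2norm _) (L2norm _) => p q /=; lra.
Qed.

Definition hop phi : L2 R := sval (cid (hop_ex phi)).

Lemma hopP phi : L2cvg \oo (fun n => hop0 (trunc n phi)) (hop phi).
Proof. exact: (svalP (cid (hop_ex phi))). Qed.

Lemma L2cvgL {T : Type} (F : set_system T) (FF : Filter F) (u v : T -> L2 R) a phi psi :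
  L2cvg F u phi -> L2cvg F v psi ->
  L2cvg F (fun t => a *: u t + v t) (a *: phi + psi).
Proof.
move=> up vp; apply: ltL2cvg => e e0.
have c0 : 0 < cabs a + 1 by rewrite ltr_wpDl// cabs_ge0.
have e1 : 0 < e / 2 / (cabs a + 1) by rewrite !divr_gt0.
have e2 : 0 < e / 2 by rewrite divr_gt0.
have := L2cvg_lt F FF v psi _ e2 vp; have := L2cvg_lt F FF u phi _ e1 up.
apply: filterS2 => t ht ht'.
have -> : a *: u t + v t - (a *: phi + psi) = a *: (u t - phi) + (v t - psi).
  by rewrite scalerBr opprD addrACA.
apply: le_lt_trans (L2norm_triangle _ _) _; rewrite L2normZ.
apply: (@le_lt_trans _ _ (e / 2 + L2norm (v t - psi))).
  rewrite lerD2r; move: ht; rewrite ltr_pdivlMr// => /ltW; apply: le_trans.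
  by rewrite mulrC ler_wpM2l ?L2norm_ge0// lerDl.
by move: ht'; move: (L2norm _) => z; lra.
Qed.

Lemma hop_linear : linear hop.
Proof.
move=> a phi psi; apply: (L2cvg_uniq _ \oo _ _ _ _ (hopP _)).
have FF : Filter (\oo : set_system nat) by exact: _.
have := L2cvgL \oo FF _ _ a _ _ (hopP phi) (hopP psi).
have L k f := L12_trunc k _ (L2valP f).
have E n : a *: hop0 (trunc n (phi : L2 R)) + hop0 (trunc n (psi : L2 R)) =
    hop0 (trunc n (a *: phi + psi : L2 R)).
  rewrite -hop0L//; congr toL2; apply: eq_chartley.
  - by have [/L2pred_meas] := L12L a _ _ (L n phi) (L n psi).
  - by have [/L2pred_meas] := L n (a *: phi + psi).
  - have e : {ae mu, forall x, (a *: phi + psi : L2 R) x = (a *: phi : L2 R) x + (psi : L2 R) x}.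
      exact: L2D_ae.
    apply: aeS2 e (L2Z_ae a phi) => x h1 h2.
    have h := etrans h1 (congr1 (fun z => z + (psi : L2 R) x) h2).
    transitivity ((\1_(symm_itv n) x)%:C%C * (a * (phi : L2 R) x + (psi : L2 R) x)).
      by rewrite mulrDr mulrCA.
    by congr (_ * _); exact: (esym h).
by rewrite /L2cvg; under eq_fun do rewrite E.
Qed.

Lemma hop_norm phi : L2norm (hop phi) <= L2norm phi.
Proof.
have FF : Filter (\oo : set_system nat) by exact: _.
have c1 := L2norm_continuous \oo FF _ _ (hopP phi).
have c2 := L2norm_continuous \oo FF _ _ (trunc_cvg phi).
apply: (ler_cvg_to c1 c2); apply: nearW => n; apply: hop0_norm.
exact: L12_trunc (L2valP phi).
Qed.

Lemma realL2 (w : R -> R) : measurable_fun setT w ->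
  (\int[mu]_x (w x ^+ 2)%:E < +oo)%E -> (fun x => (w x)%:C%C) \in L2pred.
Proof.
move=> mw iw2; apply/L2predP; split; first by split => //=; exact: measurable_cst.
apply: le_lt_trans iw2; rewrite le_eqVlt; apply/orP; left; apply/eqP.
by apply: eq_integral => x _; rewrite /csq /= expr0n addr0.
Qed.

Lemma ip_real (w : R -> R) g : measurable_fun setT w ->
  (\int[mu]_x (w x ^+ 2)%:E < +oo)%E -> g \in L2pred ->
  ip (toL2 (fun x => (w x)%:C%C)) (toL2 g) =
  Complex (Rintegral mu setT (fun k => w k * Re (g k)))
          (Rintegral mu setT (fun k => w k * Im (g k))).
Proof.
move=> mw iw2 gL; rewrite ip_toL2//; last exact: realL2.
by apply: complex_eq => /=; apply: eq_Rintegral => k _; case: (g k) => a b /=;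
  rewrite oppr0 mul0r ?subr0 ?addr0.
Qed.

End HartleyOnL2.

Section Involution.
Context {R : realType}.
Local Notation mu := (@leb R).
Implicit Types (g h : R -> R[i]) (phi psi chi : L2 R).

(** Norm convergence is used through [rip]; imaginary parts are reached by replacing the left vector
    by [i] times it. *)
Lemma ip_lim (u v : nat -> L2 R) phi chi psi psi' :
  L2cvg \oo u phi -> L2cvg \oo v chi ->
  (forall n, ip psi (u n) = ip psi' (v n)) -> ip psi phi = ip psi' chi.
Proof.
move=> uphi vchi E; have FF : Filter (\oo : set_system nat) by exact: _.
have rE (p p' : L2 R) : (forall n, rip p (u n) = rip p' (v n)) -> rip p phi = rip p' chi.
  move=> h; have c1 := ip_continuous_r \oo FF u _ p uphi.
  have c2 := ip_continuous_r \oo FF v _ p' vchi.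
  have e : (fun n => rip p (u n)) = (fun n => rip p' (v n)) by apply/funext.
  rewrite e in c1.
  have <- := cvg_lim (@norm_hausdorff _ _) c1.
  by have <- := cvg_lim (@norm_hausdorff _ _) c2.
have imE (p q : L2 R) : Im (ip p q) = rip ('i%C *: p) q.
  by rewrite /rip ipZl; case: (ip p q) => a b /=; ring.
apply: complex_eq; first by apply: (rE psi psi') => n; rewrite /rip E.
by rewrite !imE; apply: rE => n; rewrite -!imE E.
Qed.

(** Totality of the interval indicators: the real and imaginary parts of [chi] have vanishing
    integrals over all intervals. *)
Lemma L2_separated chi : (forall a b, a < b ->
  ip (toL2 (fun x => (\1_(`[a, b]%classic) x)%:C%C)) chi = 0) -> chi = 0.
Proof.
move=> h; have cL := L2valP chi; have mc := cmeasurable_L2 chi.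
have iI a b : cintegrable mu setT (fun x => ((\1_(`[a, b]%classic) x)%:C%C)^*%C * chi x).
  by apply: L2pred_conjM => //; exact: indic_L2pred.
have E0 (p : R[i] -> R) : measurable_fun setT (fun x => p (chi x)) ->
    (forall a b, mu.-integrable setT (fun x => (\1_(`[a, b]%classic) x * p (chi x))%:E)) ->
    (forall a b, a < b ->
      Rintegral mu setT (fun x => \1_(`[a, b]%classic) x * p (chi x)) = 0) ->
    {ae mu, forall x, p (chi x) = 0}.
  move=> mp ip0 h0; apply: ae_eq0_of_itv => // a b.
  apply/integrable_mkcond; first exact: measurable_itv.
  apply: eq_integrable (ip0 a b) => // x _.
  rewrite patchE indicE; case: (x \in _); rewrite ?mul1r ?mul0r//.
have hRI a b : a < b ->
   Rintegral mu setT (fun x => \1_(`[a, b]%classic) x * Re (chi x)) = 0 /\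
   Rintegral mu setT (fun x => \1_(`[a, b]%classic) x * Im (chi x)) = 0.
  move=> ab; have := h a b ab; rewrite ip_toL2l; last exact: indic_L2pred.
  move=> e; split; [have := congr1 (@complex.Re R) e|have := congr1 (@complex.Im R) e];
    rewrite /= => <-; apply: eq_Rintegral => x _; case: (chi x) => c d /=;
    by rewrite oppr0 mul0r ?subr0 ?addr0.
have e1 : {ae mu, forall x, Re (chi x) = 0}.
  apply: E0 => [|a b|a b ab]; first by have [] := mc.
    have [i _] := iI a b; apply: eq_integrable i => // x _ /=.
    by case: (chi x) => c d /=; rewrite oppr0 mul0r subr0.
  by have [] := hRI a b ab.
have e2 : {ae mu, forall x, Im (chi x) = 0}.
  apply: E0 => [|a b|a b ab]; first by have [] := mc.
    have [_ i] := iI a b; apply: eq_integrable i => // x _ /=.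
    by case: (chi x) => c d /=; rewrite oppr0 mul0r addr0.
  by have [] := hRI a b ab.
have c0 : {ae mu, forall x, chi x = 0}.
  by apply: aeS2 e1 e2 => x; case: (chi x) => c d /= -> ->.
apply: L2norm_eq0; apply/eqP; rewrite -sqrf_eq0; apply/eqP/EFin_inj.
rewrite -ip_csq; transitivity (\int[mu]_x (cst 0%E x))%E; last by rewrite integral0.
apply: ae_eq_integral => //.
  by apply/measurable_EFinP; exact: cmeasurable_csq.
by apply: aeS c0 => x ->; rewrite /csq /= expr0n addr0.
Qed.

Lemma indic_sqr_lty (a b : R) : (\int[mu]_x ((\1_(`[a, b]%classic) x : R) ^+ 2)%:E < +oo)%E.
Proof.
have E : (\int[mu]_x ((\1_(`[a, b]%classic) x : R) ^+ 2)%:E =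
    \int[mu]_x (\1_(`[a, b]%classic) x)%:E)%E.
  by apply: eq_integral => x _; rewrite indicE; case: (x \in _); rewrite ?expr1n ?expr0n.
by rewrite E; exact: (integrable_lty measurableT (indic_integrable a b)).
Qed.

(** Against the indicator [psi1] of an interval, with transform [psi2], one copy of [hop] is moved
    across by adjointness and the other is removed by Parseval. Indicators suffice by
    [L2_separated]. *)
Lemma hopK phi : hop (hop phi) = phi.
Proof.
apply/eqP; rewrite -subr_eq0; apply/eqP; apply: L2_separated => a b ab.
rewrite ipBr; apply/eqP; rewrite subr_eq0; apply/eqP.
pose w := \1_(`[a, b]%classic) : R -> R.
have mw : measurable_fun setT w by apply: measurable_indic; exact: measurable_itv.
have iw := indic_integrable a b; have iw2 := indic_sqr_lty a b.
have mh : measurable_fun setT (hartley w) by exact: measurable_hartley.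
have ih2 : (\int[mu]_x (hartley w x ^+ 2)%:E < +oo)%E.
  exact: le_lt_trans (hartley_contraction _ iw iw2) iw2.
have L k (f : L2 R) := L12_trunc k _ (L2valP f).
pose psi1 : L2 R := toL2 (fun x => (w x)%:C%C).
pose psi2 : L2 R := toL2 (fun x => (hartley w x)%:C%C).
(* Adjointness on truncations, where both factors are integrable, then passage to the limit. *)
have E1 f : ip psi1 (hop f) = ip psi2 f.
  apply: (ip_lim _ _ _ _ _ _ (hopP f) (trunc_cvg f)) => n.
  have [m1 i1 s1] := L12_Re _ (L n f); have [m2 i2 s2] := L12_Im _ (L n f).
  rewrite ip_real//; last exact: chartley_L2pred.
  rewrite ip_real//; last by have [] := L n f.
  congr Complex; rewrite /= hartley_adjoint//.
    by apply: eq_Rintegral => x _; rewrite mulrC.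
  by apply: eq_Rintegral => x _; rewrite mulrC.
(* Parseval with the indicator as one factor, again on truncations first. *)
have E2 f : ip psi2 (hop f) = ip psi1 f.
  apply: (ip_lim _ _ _ _ _ _ (hopP f) (trunc_cvg f)) => n.
  have [m1 i1 s1] := L12_Re _ (L n f); have [m2 i2 s2] := L12_Im _ (L n f).
  rewrite ip_real//; last exact: chartley_L2pred.
  rewrite ip_real//; last by have [] := L n f.
  by congr Complex; rewrite /= hartley_parseval_itv.
by rewrite -[LHS]/(ip psi1 _) E1 E2.
Qed.

(** A contraction that is its own inverse cannot shrink any norm. *)
Lemma hop_isometry phi : L2norm (hop phi) = L2norm phi.
Proof. by apply: le_anti; rewrite hop_norm -{1}(hopK phi) hop_norm. Qed.

End Involution.

Lemma ae_comp {R : realType} (s : R -> R) (c : R) (P : R -> Prop) :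
  measurable_fun setT s ->
  (forall A, measurable A -> leb (s @^-1` A) = (c%:E * leb A)%E) ->
  {ae (@leb R), forall x, P x} -> {ae (@leb R), forall x, P (s x)}.
Proof.
move=> ms lebs [N [mN N0 PN]]; exists (s @^-1` N); split.
- by rewrite -[_ @^-1` _]setTI; exact: ms.
- by rewrite lebs//; apply/eqP; rewrite mule_eq0 -N0 eqxx orbT.
- by move=> x /= h; apply: PN.
Qed.

(** * Measure preserving substitutions as isometries *)

Section Composition.
Context {R : realType}.
Local Notation mu := (@leb R).
Implicit Types (g h : R -> R[i]) (phi psi chi : L2 R).
Variable s : R -> R.
Hypothesis ms : measurable_fun setT s.
Hypothesis lebs : forall A, measurable A -> leb (s @^-1` A) = (1%:E * leb A)%E.

Lemma L2pred_comp g : g \in L2pred -> (g \o s) \in L2pred.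
Proof.
move=> /L2predP[mg ig]; apply/L2predP; split.
  have [m1 m2] := mg.
  by split; [exact: (measurableT_comp m1 ms)|exact: (measurableT_comp m2 ms)].
rewrite (ge0_integral_comp s 1 ms ler01 lebs (fun x => (csq (g x))%:E)) ?mul1e//.
  by apply/measurable_EFinP; exact: cmeasurable_csq.
by move=> x; rewrite lee_fin csq_ge0.
Qed.

Definition compop phi : L2 R := toL2 (phi \o s).

Lemma compop_ae phi : {ae mu, forall x, compop phi x = phi (s x)}.
Proof. by apply: toL2_ae; apply: L2pred_comp; exact: L2valP. Qed.

Lemma compop_toL2 g : g \in L2pred -> compop (toL2 g) = toL2 (g \o s).
Proof.
move=> gL; apply: toL2_unique; first exact: L2pred_comp.
by apply: aeS2 (compop_ae (toL2 g)) (ae_comp s 1 _ ms lebs (toL2_ae _ gL)) => x -> ->.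
Qed.

Lemma compop_linear : linear compop.
Proof.
move=> a phi psi; apply/L2_eqP.
have h1 : {ae mu, forall x, compop (a *: phi + psi) x =
    a * (phi : L2 R) (s x) + (psi : L2 R) (s x)}.
  have e : {ae mu, forall x, (a *: phi + psi : L2 R) x = a * (phi : L2 R) x + (psi : L2 R) x}.
    by apply: aeS2 (L2D_ae (a *: phi) psi) (L2Z_ae a phi) => x h h'; exact: etrans h (congr1 (fun z => z + _) h').
  by apply: aeS2 (compop_ae (a *: phi + psi)) (ae_comp s 1 _ ms lebs e) => x h h'; exact: etrans h h'.
have h2 : {ae mu, forall x, (a *: compop phi + compop psi : L2 R) x =
    a * compop phi x + compop psi x}.
  by apply: aeS2 (L2D_ae (a *: compop phi) (compop psi)) (L2Z_ae a (compop phi)) => x h h'; exact: etrans h (congr1 (fun z => z + _) h').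
have h3 : {ae mu, forall x, compop phi x = (phi : L2 R) (s x) /\ compop psi x = (psi : L2 R) (s x)}.
  by apply: aeS2 (compop_ae phi) (compop_ae psi).
have h4 : {ae mu, forall x, (a *: compop phi + compop psi : L2 R) x =
    a * (phi : L2 R) (s x) + (psi : L2 R) (s x)}.
  by apply: aeS2 h2 h3 => x h [e1 e2]; rewrite e1 e2 in h.
by apply: aeS2 h1 h4 => x -> ->.
Qed.

Lemma compop_isometry phi : L2norm (compop phi) = L2norm phi.
Proof.
apply/eqP; rewrite -(@eqrXn2 _ 2)// ?L2norm_ge0//; apply/eqP/EFin_inj.
rewrite L2norm_toL2; last by apply: L2pred_comp; exact: L2valP.
rewrite -ip_csq (ge0_integral_comp s 1 ms ler01 lebs (fun x => (csq (phi x))%:E)) ?mul1e//.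
  by apply/measurable_EFinP; apply: cmeasurable_csq; exact: cmeasurable_L2.
by move=> x; rewrite lee_fin csq_ge0.
Qed.

End Composition.

Section LinearMaps.
Context {R : realType}.
Variable T : L2 R -> L2 R.
Hypothesis lT : linear T.

Lemma linearD_of : {morph T : x y / x + y}.
Proof. by move=> x y; rewrite -[x in LHS]scale1r lT scale1r. Qed.

Lemma linear0_of : T 0 = 0.
Proof. by have := linearD_of 0 0; rewrite addr0 => /eqP; rewrite -[X in X == _]addr0 => /eqP/addrI. Qed.

Lemma linearZ_of a x : T (a *: x) = a *: T x.
Proof. by rewrite -[a *: x]addr0 lT linear0_of addr0. Qed.

Lemma linearB_of : {morph T : x y / x - y}.
Proof. by move=> x y; rewrite -scaleN1r linearD_of linearZ_of scaleN1r. Qed.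

End LinearMaps.

(** * The Fourier transform *)

Section FourierTransform.
Context {R : realType}.
Local Notation mu := (@leb R).
Implicit Types (g h : R -> R[i]) (phi psi chi : L2 R).

Lemma measurable_opp_real : measurable_fun setT (@GRing.opp R).
Proof. exact: oppr_measurable. Qed.

Definition refl : L2 R -> L2 R := compop (@GRing.opp R).

Lemma refl_linear : linear refl.
Proof. exact: (compop_linear _ measurable_opp_real leb_opp). Qed.

Lemma refl_isometry phi : L2norm (refl phi) = L2norm phi.
Proof. exact: (compop_isometry _ measurable_opp_real leb_opp). Qed.

Lemma reflK phi : refl (refl phi) = phi.
Proof.
have e1 := compop_ae _ measurable_opp_real leb_opp (refl phi).
have e2 := ae_comp _ 1 _ measurable_opp_real leb_opp (compop_ae _ measurable_opp_real leb_opp phi).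
by apply/L2_eqP; apply: aeS2 e1 e2 => x -> ->; rewrite opprK.
Qed.

Let ca : R[i] := Complex 2^-1 (- 2^-1).
Let cb : R[i] := Complex 2^-1 2^-1.

(* [exp (-i k x) = ca * cas (k x) + cb * cas (- k x)] with
   [ca = (1 - i) / 2] and [cb = (1 + i) / 2] *)
Definition rot phi : L2 R := ca *: phi + cb *: refl phi.

Lemma rot_linear : linear rot.
Proof.
move=> a phi psi; rewrite /rot refl_linear scalerDr scalerDr scalerDr.
rewrite !scalerA (mulrC ca a) (mulrC cb a) addrACA.
by congr (_ + _); congr (_ + _).
Qed.

(** [|ca|^2 + |cb|^2 = 1], and the cross term vanishes: [conj ca * cb = i / 2] is imaginary while
    [<phi, refl phi>] is real. *)
Lemma rot_isometry phi : L2norm (rot phi) = L2norm phi.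
Proof.
apply/eqP; rewrite -(@eqrXn2 _ 2)// ?L2norm_ge0//; apply/eqP.
rewrite (L2norm_sqrD (ca *: phi) (cb *: refl phi)) !L2normZ refl_isometry !exprMn !sqr_cabs.
have -> : rip (ca *: phi) (cb *: refl phi) = 0.
  (* The reflection is an isometry and an involution, hence symmetric. *)
  have J : ip phi (refl phi) = (ip phi (refl phi))^*%C.
    rewrite -(ip_conj phi (refl phi)).
    by rewrite -[RHS](linear_isometry_ip _ refl_linear refl_isometry) reflK.
  have I0 : Im (ip phi (refl phi)) = 0.
    by have := congr1 (@complex.Im R) J; case: (ip _ _) => a b /= ?; lra.
  rewrite /rip ipZl ipZr; move: I0; case: (ip _ _) => a b /= ->.
  by rewrite /ca /cb /=; field.
by rewrite /csq /ca /cb /=; move: (L2norm phi) => z; field.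
Qed.

Definition four phi : L2 R := rot (hop phi).

Lemma four_linear : linear four.
Proof. by move=> a phi psi; rewrite /four hop_linear rot_linear. Qed.

Lemma four_isometry phi : L2norm (four phi) = L2norm phi.
Proof. by rewrite rot_isometry hop_isometry. Qed.

(** The adjoint of [rot], with conjugated coefficients, is also its inverse, since
    [ca * conj cb + cb * conj ca = 0]; composing with [hop] gives the preimage. *)
Lemma four_onto chi : exists phi, four phi = chi.
Proof.
exists (hop (ca^*%C *: chi + cb^*%C *: refl chi)).
rewrite /four hopK /rot (refl_linear (ca^*%C) chi (cb^*%C *: refl chi)).
rewrite (linearZ_of _ refl_linear) reflK !scalerDr !scalerA.
rewrite (addrC (_ *: refl chi) (_ *: chi)) addrACA -!scalerDl.
have -> : ca * ca^*%C + cb * cb^*%C = 1.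
  by apply: complex_eq; rewrite /ca /cb /=; field.
have -> : ca * cb^*%C + cb * ca^*%C = 0.
  by apply: complex_eq; rewrite /ca /cb /=; field.
by rewrite scale1r scale0r addr0.
Qed.

Let c := (Num.sqrt (2 * pi))^-1 : R.

Let hartley_cos (u : R -> R) k : mu.-integrable setT (EFin \o u) ->
  2^-1 * (hartley u k + hartley u (- k)) = c * Rintegral mu setT (fun x => cos (k * x) * u x).
Proof.
move=> iu.
have ic t : mu.-integrable setT (EFin \o (fun x => cas (t * x) * u x)).
  apply: (integrable_bounded_mul _ _ 2) => // [|x]; last exact: cas_le2.
  by apply: measurableT_comp; [exact: measurable_cas|exact: measurable_funM].
rewrite /hartley -/c -mulrDr mulrCA; congr (_ * _).
rewrite -RintegralD// -RintegralZl//; last exact: (integrableD measurableT (ic k) (ic (- k))).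
by apply: eq_Rintegral => x _; rewrite /cas mulNr cosN sinN; field.
Qed.

Let hartley_sin (u : R -> R) k : mu.-integrable setT (EFin \o u) ->
  2^-1 * (hartley u k - hartley u (- k)) = c * Rintegral mu setT (fun x => sin (k * x) * u x).
Proof.
move=> iu.
have ic t : mu.-integrable setT (EFin \o (fun x => cas (t * x) * u x)).
  apply: (integrable_bounded_mul _ _ 2) => // [|x]; last exact: cas_le2.
  by apply: measurableT_comp; [exact: measurable_cas|exact: measurable_funM].
rewrite /hartley -/c -mulrBr mulrCA; congr (_ * _).
rewrite -RintegralB// -RintegralZl//; last exact: (integrableB measurableT (ic k) (ic (- k))).
by apply: eq_Rintegral => x _; rewrite /cas mulNr cosN sinN; field.
Qed.

(** The even and odd parts in [k] of a real Hartley transform are the cosine and sine integrals;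
    [ca] and [cb] recombine them into the exponential. *)
Lemma fourier_truncE n phi k : fourier_trunc n phi k =
  ca * chartley (trunc n phi) k + cb * chartley (trunc n phi) (- k).
Proof.
have gL := L12_trunc n _ (L2valP phi).
have [m1 i1 _] := L12_Re _ gL; have [m2 i2 _] := L12_Im _ gL.
set u := (fun x => Re (trunc n phi x)) in m1 i1; set v := (fun x => Im (trunc n phi x)) in m2 i2.
have icos (w : R -> R) : mu.-integrable setT (EFin \o w) ->
    mu.-integrable setT (EFin \o (fun x => cos (k * x) * w x)).
  apply: (integrable_bounded_mul _ _ 1) => [|x]; last exact: cos_max.
  apply: measurableT_comp; last exact: measurable_funM.
  by apply: continuous_measurable_fun; exact: continuous_cos.
have isin (w : R -> R) : mu.-integrable setT (EFin \o w) ->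
    mu.-integrable setT (EFin \o (fun x => sin (k * x) * w x)).
  apply: (integrable_bounded_mul _ _ 1) => [|x]; last exact: sin_max.
  apply: measurableT_comp; last exact: measurable_funM.
  by apply: continuous_measurable_fun; exact: continuous_sin.
have E (p : R[i] -> R) : p 0 = 0 ->
    Rintegral mu `[- n%:R, n%:R] (fun x => p (cexpi (- (k * x)) * phi x)) =
    Rintegral mu setT (fun x => p (cexpi (- (k * x)) * trunc n phi x)).
  move=> p0; rewrite Rintegral_mkcond; apply: eq_Rintegral => x _.
  rewrite patchE /trunc indicE /symm_itv; case: (x \in _); rewrite ?mul1r//.
  by rewrite mul0r mulr0 p0.
rewrite /fourier_trunc; apply: complex_eq.
  transitivity (c * Rintegral mu setT (fun x => cos (k * x) * u x + sin (k * x) * v x)).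
    rewrite /cintegral -/c /= mul0r subr0; congr (_ * _).
    rewrite -[LHS]/(Rintegral mu `[- n%:R, n%:R] (fun x => Re (cexpi (- (k * x)) * phi x))) E//.
    apply: eq_Rintegral => x _; rewrite /cexpi cosN sinN /u /v.
    by case: (trunc n phi x) => a b /=; ring.
  rewrite RintegralD//; [|exact: icos|exact: isin].
  rewrite mulrDr -hartley_cos// -hartley_sin//.
  rewrite /ca /cb /chartley -/u -/v /=.
  move: (hartley u k) (hartley v k) (hartley u (- k)) (hartley v (- k)) => a b d e.
  by field.
transitivity (c * Rintegral mu setT (fun x => cos (k * x) * v x - sin (k * x) * u x)).
  rewrite /cintegral -/c /= mul0r addr0; congr (_ * _).
  rewrite -[LHS]/(Rintegral mu `[- n%:R, n%:R] (fun x => Im (cexpi (- (k * x)) * phi x))) E//.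
  apply: eq_Rintegral => x _; rewrite /cexpi cosN sinN /u /v.
  by case: (trunc n phi x) => a b /=; ring.
rewrite RintegralB//; [|exact: icos|exact: isin].
rewrite mulrBr -hartley_cos// -hartley_sin//.
rewrite /ca /cb /chartley -/u -/v /=.
move: (hartley u k) (hartley v k) (hartley u (- k)) (hartley v (- k)) => a b d e.
by field.
Qed.

Lemma fourier_trunc_L2pred n phi : fourier_trunc n phi \in L2pred.
Proof.
have h := chartley_L2pred _ (L12_trunc n _ (L2valP phi)).
have -> : fourier_trunc n phi = (fun k => ca * chartley (trunc n phi) k +
    cb * (chartley (trunc n phi) \o -%R) k) by apply/funext => k; exact: fourier_truncE.
apply: L2predD; apply: L2predZ => //.
exact: (L2pred_comp _ measurable_opp_real leb_opp).
Qed.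

Lemma toL2_fourier_trunc n phi :
  toL2 (fourier_trunc n phi) = rot (hop0 (trunc n phi)).
Proof.
have h := chartley_L2pred _ (L12_trunc n _ (L2valP phi)).
have h' := L2pred_comp _ measurable_opp_real leb_opp _ h.
have -> : fourier_trunc n phi = (fun k => ca * chartley (trunc n phi) k +
    cb * (chartley (trunc n phi) \o -%R) k) by apply/funext => k; exact: fourier_truncE.
rewrite toL2D; [|exact: L2predZ|exact: L2predZ].
rewrite toL2Z// toL2Z// /rot /hop0 /refl.
by rewrite (compop_toL2 _ measurable_opp_real leb_opp _ h).
Qed.

(** Translates the convergence of extended-real integrals in [is_fourier] into norm convergence,
    where uniqueness of limits is known. *)
Lemma is_fourierP phi chi :
  is_fourier phi chi <-> L2cvg \oo (fun n => toL2 (fourier_trunc n phi)) chi.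
Proof.
have E n : (\int[lebesgue_measure]_k ((cabs (fourier_trunc n phi k - chi k)) ^+ 2)%:E =
    (L2norm (toL2 (fourier_trunc n phi) - chi) ^+ 2)%:E)%E.
  have fL := fourier_trunc_L2pred n phi.
  have mf := L2pred_meas _ fL.
  rewrite -L2norm_distE//; rewrite ge0_integral_leb//.
  - by apply: eq_integral => x _; rewrite sqr_cabs.
  - apply/measurable_EFinP; apply: measurable_funX; apply: cmeasurable_cabs.
    by apply: cmeasurableB => //; exact: cmeasurable_L2.
  - by move=> x _; rewrite lee_fin sqr_ge0.
rewrite /is_fourier; under eq_fun do rewrite E.
have FF : Filter (\oo : set_system nat) by exact: _.
split.
  by move=> /fine_cvg h; apply: (L2cvg_sqr _ FF).
move=> h; apply/cvg_EFin; first exact: nearW.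
have -> : fine \o (fun n => (L2norm (toL2 (fourier_trunc n phi) - chi) ^+ 2)%:E) =
    (fun n => L2norm (toL2 (fourier_trunc n phi) - chi) *
              L2norm (toL2 (fourier_trunc n phi) - chi)).
  by apply/funext => n; rewrite /= expr2.
by rewrite -[X in _ --> X](mulr0 0); apply: cvgM; exact: h.
Qed.

Lemma is_fourier_four phi : is_fourier phi (four phi).
Proof.
apply/is_fourierP; rewrite /L2cvg; under eq_fun do rewrite toL2_fourier_trunc.
rewrite /four; under eq_fun do rewrite -(linearB_of _ rot_linear) rot_isometry.
exact: hopP.
Qed.

(** The set given to [xget] is nonempty by [is_fourier_four] and has one element by uniqueness of
    limits, so the default value 0 is never taken. *)
Lemma fourierE phi : fourier phi = four phi.
Proof.
rewrite /fourier; case: xgetP => [chi _ /is_fourierP h|h].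
  by apply: (L2cvg_uniq _ \oo _ _ _ _ h); apply/is_fourierP; exact: is_fourier_four.
by have := h _ (is_fourier_four phi).
Qed.

Lemma fourier_linear : linear (@fourier R).
Proof. by move=> a phi psi; rewrite !fourierE four_linear. Qed.

Lemma fourier_isometry phi : L2norm (fourier phi) = L2norm phi.
Proof. by rewrite fourierE four_isometry. Qed.

Lemma fourier_onto chi : exists phi, fourier phi = chi.
Proof. by have [phi <-] := four_onto chi; exists phi; rewrite fourierE. Qed.

Lemma fourier_ip phi psi : ip (fourier phi) (fourier psi) = ip phi psi.
Proof. exact: (linear_isometry_ip _ fourier_linear fourier_isometry). Qed.

Lemma fourier_inj phi psi : fourier phi = fourier psi -> phi = psi.
Proof.
move=> e; apply/eqP; rewrite -subr_eq0; apply/eqP/L2norm_eq0.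
by rewrite -fourier_isometry (linearB_of _ fourier_linear) e subrr L2norm0.
Qed.

End FourierTransform.

(** * Multiplication operators and free evolution *)

Section ConvolutionIntegral.
Context {R : realType}.
Local Notation mu := (@leb R).

(** Fubini with the [t] integral taken first: a shift does not change the integral of [v].
    Integrability is asked at every [t] so that the inner [Rintegral] is a true integral for all
    [t], not just for almost all. *)
Lemma Rintegral_correlation (u v : R -> R) : mu.-integrable setT (EFin \o u) ->
  mu.-integrable setT (EFin \o v) ->
  (forall t, mu.-integrable setT (EFin \o (fun k => u k * v (k + t)))) ->
  mu.-integrable setT (EFin \o (fun t => Rintegral mu setT (fun k => u k * v (k + t)))) /\
  Rintegral mu setT (fun t => Rintegral mu setT (fun k => u k * v (k + t))) =
    Rintegral mu setT u * Rintegral mu setT v.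
Proof.
move=> iu iv iuv.
have /integrableP[/measurable_EFinP mu_ _] := iu.
have /integrableP[/measurable_EFinP mv_ _] := iv.
have vt k : mu.-integrable setT (EFin \o (fun t => v (k + t))) /\
    Rintegral mu setT (fun t => v (k + t)) = Rintegral mu setT v.
  have -> : (fun t => v (k + t)) = v \o (fun t => t + k).
    by apply/funext => t; rewrite /= addrC.
  split; first exact: (integrable_comp _ 1 (measurable_shift k) ler01 (leb_shift k)).
  by rewrite (Rintegral_comp _ 1 (measurable_shift k) ler01 (leb_shift k))// mul1r.
pose f (z : R * R) := (u z.2 * v (z.2 + z.1))%:E.
have mf : measurable_fun setT f.
  apply/measurable_EFinP; apply: measurable_funM.
    exact: measurableT_comp measurable_snd.
  apply: measurableT_comp => //; apply: measurable_funD.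
    exact: measurable_snd.
  exact: measurable_fst.
have fi : (mu \x mu)%E.-integrable setT f.
  apply/integrable21ltyP => //.
  have E k : (\int[mu]_t `|f (t, k)| = `|u k|%:E * (Rintegral mu setT (fun x => `|v x|))%:E)%E.
    have nvt : mu.-integrable setT (EFin \o (fun x => `|v x|)) by exact: integrable_norm.
    have [i1 _] := vt k.
    under eq_integral do rewrite /f /= normrM EFinM.
    rewrite integralZl//; last exact: integrable_norm.
    congr (_ * _)%E; rewrite -[RHS]mul1e.
    rewrite -[LHS]/(\int[mu]_t (`|v (k + t)|)%:E)%E.
    under eq_integral do rewrite addrC.
    rewrite (ge0_integral_comp _ 1 (measurable_shift k) ler01 (leb_shift k)
      (fun x => `|v x|%:E))//.
      by congr (_ * _)%E; rewrite /Rintegral fineK//; exact: integrable_fin_num.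
    by apply/measurable_EFinP; exact: measurableT_comp.
  under eq_integral do rewrite E.
  rewrite ge0_integralZr//; last 2 first.
  - by apply/measurable_EFinP; exact: measurableT_comp.
  - by rewrite lee_fin; apply: Rintegral_ge0.
  have /integrableP[_ iu1] := iu.
  by rewrite muleC lte_mul_pinfty ?lee_fin ?Rintegral_ge0.
have EF t : fubini_F mu f t = (Rintegral mu setT (fun k => u k * v (k + t)))%:E.
  by rewrite /fubini_F /f /= /Rintegral fineK//; exact: integrable_fin_num (iuv t).
split.
  have -> : EFin \o (fun t => Rintegral mu setT (fun k => u k * v (k + t))) = fubini_F mu f.
    by apply/funext => t; exact: esym (EF t).
  exact: integrable_fubini_F fi.
have := Fubini fi.
have -> : (fun x => \int[mu]_y f (x, y))%E = (fun t => (Rintegral mu setT (fun k => u k * v (k + t)))%:E).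
  by apply/funext => t; rewrite -EF.
have -> : (\int[mu]_y \int[mu]_x f (x, y) = \int[mu]_y (u y * Rintegral mu setT v)%:E)%E.
  apply: eq_integral => k _; have [i1 <-] := vt k.
  by rewrite /f /=; under eq_integral do rewrite EFinM; rewrite integralZl// EFinM /Rintegral fineK//;
    exact: integrable_fin_num.
move=> e; rewrite {1}/Rintegral e mulrC -RintegralZl//.
by apply: eq_Rintegral => k _; rewrite mulrC.
Qed.

End ConvolutionIntegral.

Section MultiplicationOperators.
Context {R : realType}.
Local Notation mu := (@leb R).
Implicit Types (phi psi chi : L2 R).
Variables (g : R -> R[i]) (M : R).
Hypotheses (mg : cmeasurable g) (M0 : 0 <= M).
Hypothesis gM : {ae mu, forall x, cabs (g x) <= M}.

Lemma mul_L2pred h : h \in L2pred -> (fun x => g x * h x) \in L2pred.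
Proof.
move=> hL; have [mh ih] := (L2predP _).1 hL; apply/L2predP; split; first exact: cmeasurableM.
have mc : measurable_fun setT (fun x => (csq (h x))%:E).
  by apply/measurable_EFinP; exact: cmeasurable_csq.
apply: (@le_lt_trans _ _ (\int[mu]_x ((M ^+ 2)%:E * (csq (h x))%:E))%E).
  apply: ae_ge0_le_integral => //.
  - by move=> x _; rewrite lee_fin csq_ge0.
  - by apply/measurable_EFinP; apply: cmeasurable_csq; exact: cmeasurableM.
  - by move=> x _; rewrite -EFinM lee_fin mulr_ge0 ?sqr_ge0 ?csq_ge0.
  - by apply: emeasurable_funM => //; exact: measurable_cst.
  apply: aeS gM => x h1 _; rewrite -EFinM lee_fin csqM ler_wpM2r ?csq_ge0//.
  by rewrite -sqr_cabs; apply: lerXn2r; rewrite ?nnegrE ?cabs_ge0.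
rewrite ge0_integralZl//.
- rewrite lte_mul_pinfty ?lee_fin ?sqr_ge0//.
- by move=> x _; rewrite lee_fin csq_ge0.
- by rewrite lee_fin sqr_ge0.
Qed.

Lemma mulop_ae phi : {ae mu, forall x, mulop g phi x = g x * phi x}.
Proof. by apply: toL2_ae; apply: mul_L2pred; exact: L2valP. Qed.

Lemma mulop_linear : linear (mulop g : L2 R -> L2 R).
Proof.
move=> a phi psi; rewrite /mulop.
have h1 := mul_L2pred _ (L2valP phi); have h2 := mul_L2pred _ (L2valP psi).
rewrite -toL2Z// -toL2D//; last exact: L2predZ.
apply: toL2_eq.
- by apply: mul_L2pred; exact: L2valP.
- by apply: L2predD => //; exact: L2predZ.
have e : {ae mu, forall x, (a *: phi + psi : L2 R) x = a * (phi : L2 R) x + (psi : L2 R) x}.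
  by apply: aeS2 (L2D_ae (a *: phi) psi) (L2Z_ae a phi) => x h h'; exact: etrans h (congr1 (fun z => z + _) h').
by apply: aeS e => x ->; rewrite mulrDr mulrCA.
Qed.

Lemma mulop_norm phi : L2norm (mulop g phi : L2 R) <= M * L2norm phi.
Proof.
rewrite -(@ler_pXn2r _ 2)// ?nnegrE ?mulr_ge0 ?L2norm_ge0//.
have mc (psi : L2 R) : measurable_fun setT (fun x => (csq (psi x))%:E).
  by apply/measurable_EFinP; apply: cmeasurable_csq; exact: cmeasurable_L2.
have -> : (M * L2norm phi) ^+ 2 = M ^+ 2 * L2norm phi ^+ 2 by rewrite exprMn.
rewrite -lee_fin (EFinM (M ^+ 2)) -!ip_csq -ge0_integralZl//.
- apply: ae_ge0_le_integral => //.
  + by move=> x _; rewrite lee_fin csq_ge0.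
  + by move=> x _; rewrite -EFinM lee_fin mulr_ge0 ?sqr_ge0 ?csq_ge0.
  + by apply: emeasurable_funM => //; exact: measurable_cst.
  apply: aeS2 (mulop_ae phi) gM => x -> h1 _.
  rewrite -EFinM lee_fin csqM ler_wpM2r ?csq_ge0//.
  by rewrite -sqr_cabs; apply: lerXn2r; rewrite ?nnegrE ?cabs_ge0.
- by move=> x _; rewrite lee_fin csq_ge0.
- by rewrite lee_fin sqr_ge0.
Qed.

(** Surjectivity of the Fourier transform provides an element of the set behind [funP]; any element
    chosen from it has the prescribed transform almost everywhere. *)
Lemma funP_fourier phi : fourier (funP g phi) = mulop g (fourier phi).
Proof.
have [chi Fchi] := fourier_onto (mulop g (fourier phi)).
rewrite /funP; case: xgetP => [psi _ h|h].
  have {}h : {ae mu, forall k, fourier psi k = g k * fourier phi k} := h.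
  by apply/L2_eqP; apply: aeS2 h (mulop_ae (fourier phi)) => x h h'; exact: etrans h (esym h').
by case: (h chi) => //=; rewrite Fchi; exact: mulop_ae.
Qed.

Lemma funP_linear : linear (funP g : L2 R -> L2 R).
Proof.
have h a phi psi : fourier (funP g (a *: phi + psi)) = fourier (a *: funP g phi + funP g psi).
  have e1 := funP_fourier (a *: phi + psi); rewrite e1.
  have e2 := fourier_linear a phi psi; rewrite e2.
  have e3 := fourier_linear a (funP g phi) (funP g psi); rewrite e3.
  have e4 := mulop_linear a (fourier phi) (fourier psi); rewrite e4.
  exact: (congr2 (fun x y => a *: x + y) (esym (funP_fourier phi)) (esym (funP_fourier psi))).
by move=> a phi psi; apply: fourier_inj; exact: h.
Qed.

Lemma funP_norm phi : L2norm (funP g phi) <= M * L2norm phi.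
Proof. by rewrite -fourier_isometry funP_fourier -[in leRHS]fourier_isometry mulop_norm. Qed.

Lemma ip_funP phi psi :
  ip phi (funP g psi) = ip (fourier phi) (mulop g (fourier psi)).
Proof. by rewrite -fourier_ip funP_fourier. Qed.

End MultiplicationOperators.

Section MultiplicationLimits.
Context {R : realType}.
Local Notation mu := (@leb R).
Implicit Types (phi psi chi : L2 R).

(** Bounded pointwise convergence of multipliers gives strong convergence. It serves both the
    continuity of [evol0] in time and the limit of [f(P/r)] as [r] grows. *)
Lemma mulop_cvg (g_ : nat -> R -> R[i]) (g : R -> R[i]) (M : R) phi :
  (forall n, cmeasurable (g_ n)) -> cmeasurable g -> 0 <= M ->
  (forall n, {ae mu, forall x, cabs (g_ n x) <= M}) ->
  {ae mu, forall x, cabs (g x) <= M} ->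
  {ae mu, forall x, csq (g_ n x - g x) @[n --> \oo] --> (0 : R)} ->
  L2cvg \oo (fun n => mulop (g_ n) phi) (mulop g phi : L2 R).
Proof.
move=> mg_ mg M0 gM_ gM gc.
have FF : Filter (\oo : set_system nat) by exact: _.
apply: (L2cvg_sqr _ FF).
have B n : {ae mu, forall x, cabs (g_ n x - g x) <= M + M}.
  apply: aeS2 (gM_ n) gM => x h1 h2; apply: le_trans (cabsD _ _) _.
  by rewrite lerD// !cabsE csqN -!cabsE.
(* The multipliers are bounded only almost everywhere, whereas the domination used here must hold at
   every point; capping at [(2 M)^2] changes the integrand on a null set only. *)
pose d n x := Num.min (csq (g_ n x - g x)) ((M + M) ^+ 2) * csq (phi x).
have md n : measurable_fun setT (d n).
  apply: measurable_funM; last by apply: cmeasurable_csq; exact: cmeasurable_L2.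
  apply: measurable_minr; last exact: measurable_cst.
  by apply: cmeasurable_csq; exact: cmeasurableB.
have e : (fun n => L2norm (mulop (g_ n) phi - mulop g phi : L2 R) ^+ 2) =
    (fun n => Rintegral mu setT (d n)).
  apply/funext => n; apply: EFin_inj; rewrite /Rintegral fineK; last first.
    have : mu.-integrable setT (EFin \o d n).
      apply: (le_integrable measurableT) (integrableZl measurableT ((M + M) ^+ 2)
        (L2pred_csq_integrable _ (L2valP phi))).
        exact/measurable_EFinP.
      move=> x _; rewrite lee_fin !ger0_norm.
      + by rewrite /= ler_wpM2r ?csq_ge0// ge_min lexx orbT.
      + by rewrite /= mulr_ge0 ?csq_ge0 ?sqr_ge0.
      + by rewrite /d mulr_ge0 ?csq_ge0// le_min csq_ge0 sqr_ge0.
    exact: integrable_fin_num.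
  rewrite -ip_csq; apply: ae_eq_integral => //.
  - by apply/measurable_EFinP; apply: cmeasurable_csq; exact: cmeasurable_L2.
  - exact/measurable_EFinP.
  have a1 : {ae mu, forall x, mulop (g_ n) phi x = g_ n x * phi x /\
      mulop g phi x = g x * phi x}.
    by apply: aeS2 (mulop_ae _ _ (mg_ n) M0 (gM_ n) phi) (mulop_ae _ _ mg M0 gM phi).
  have a2 : {ae mu, forall x, (mulop (g_ n) phi - mulop g phi : L2 R) x =
      (g_ n x - g x) * phi x}.
    by apply: aeS2 (L2B_ae (mulop (g_ n) phi) (mulop g phi)) a1 => x -> [-> ->]; rewrite mulrBl.
  apply: aeS2 a2 (B n) => x -> h _; rewrite csqM /d; congr (_ * _)%:E.
  by rewrite min_l// -sqr_cabs; apply: lerXn2r; rewrite ?nnegrE ?cabs_ge0 ?addr_ge0.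
rewrite e.
have [||||_ c] := @Rdominated_convergence R mu setT measurableT d (cst 0)
    (fun x => (M + M) ^+ 2 * csq (phi x)) md.
- exact: measurable_cst.
- apply: aeS gc => x h _; rewrite /d -[X in _ --> X](mul0r (csq (phi x))).
  apply: cvgMl; apply: (squeeze_cvgr _ (cvg_cst 0) h); apply: nearW => n.
  by rewrite le_min csq_ge0 sqr_ge0 /= ge_min lexx.
- exact: (integrableZl measurableT _ (L2pred_csq_integrable _ (L2valP phi))).
- move=> n x _; rewrite ger0_norm.
    by rewrite /= ler_wpM2r ?csq_ge0// ge_min lexx orbT.
  by rewrite /d mulr_ge0 ?csq_ge0// le_min csq_ge0 sqr_ge0.
by rewrite /= Rintegral_cst// mul0r in c.
Qed.

End MultiplicationLimits.

Lemma csq_cexpi_cvg {R : realType} (u : nat -> R) (a : R) : u n @[n --> \oo] --> a ->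
  csq (cexpi (u n) - cexpi a) @[n --> \oo] --> (0 : R).
Proof.
move=> h.
have E n : csq (cexpi (u n) - cexpi a) =
  (cos (u n) - cos a) * (cos (u n) - cos a) + (sin (u n) - sin a) * (sin (u n) - sin a).
  by rewrite /csq /cexpi /= !expr2.
under eq_fun do rewrite E.
have hc : cos (u n) - cos a @[n --> \oo] --> (0 : R).
  rewrite -[X in _ --> X](subrr (cos a)); apply: cvgB; last exact: cvg_cst.
  exact: (cvg_comp _ _ h (@continuous_cos R _)).
have hs : sin (u n) - sin a @[n --> \oo] --> (0 : R).
  rewrite -[X in _ --> X](subrr (sin a)); apply: cvgB; last exact: cvg_cst.
  exact: (cvg_comp _ _ h (@continuous_sin R _)).
have -> : (0 : R) = 0 * 0 + 0 * 0 by rewrite mul0r addr0.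
by apply: cvgD; exact: cvgM.
Qed.

(** * The free evolution as translation in Fourier variables *)

Section FreeEvolution.
Context {R : realType}.
Local Notation mu := (@leb R).
Implicit Types (phi psi chi : L2 R).

Lemma cabs_cexpi (x : R) : cabs (cexpi x) = 1.
Proof. by rewrite cabsE csq_cexpi sqrtr1. Qed.

Lemma continuous_cexpi_Re (t : R) : continuous (fun x : R => Re (cexpi (- (t * x)))).
Proof.
move=> x; apply: (@continuous_comp _ _ _ (fun x => - (t * x)) cos); last exact: continuous_cos.
by apply: cvgN; apply: cvgMr; exact: cvg_id.
Qed.

Lemma continuous_cexpi_Im (t : R) : continuous (fun x : R => Im (cexpi (- (t * x)))).
Proof.
move=> x; apply: (@continuous_comp _ _ _ (fun x => - (t * x)) sin); last exact: continuous_sin.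
by apply: cvgN; apply: cvgMr; exact: cvg_id.
Qed.

Lemma cmeasurable_cexpi (t : R) : cmeasurable (fun x : R => cexpi (- (t * x))).
Proof.
by split; apply: continuous_measurable_fun;
  [exact: continuous_cexpi_Re|exact: continuous_cexpi_Im].
Qed.

Let cexpi_le1 (t : R) : {ae mu, forall x, cabs (cexpi (- (t * x))) <= 1}.
Proof. by apply: aeW => x; rewrite cabs_cexpi. Qed.

Lemma evol0_ae t phi : {ae mu, forall x, evol0 t phi x = cexpi (- (t * x)) * phi x}.
Proof. exact: mulop_ae (cmeasurable_cexpi t) ler01 (cexpi_le1 t) phi. Qed.

Lemma evol0_linear t : linear (@evol0 R t).
Proof. exact: mulop_linear (cmeasurable_cexpi t) ler01 (cexpi_le1 t). Qed.

Lemma evol0_isometry t phi : L2norm (evol0 t phi) = L2norm phi.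
Proof.
apply/eqP; rewrite -(@eqrXn2 _ 2)// ?L2norm_ge0//; apply/eqP/EFin_inj.
rewrite -!ip_csq; apply: ae_eq_integral => //.
- by apply/measurable_EFinP; apply: cmeasurable_csq; exact: cmeasurable_L2.
- by apply/measurable_EFinP; apply: cmeasurable_csq; exact: cmeasurable_L2.
- by apply: aeS (evol0_ae t phi) => x ->; rewrite csqM csq_cexpi mul1r.
Qed.

Lemma evol0_ip t phi psi : ip (evol0 t phi) (evol0 t psi) = ip phi psi.
Proof. exact: (linear_isometry_ip _ (evol0_linear t) (evol0_isometry t)). Qed.

Lemma evol0_0 phi : evol0 0 phi = phi.
Proof.
apply/L2_eqP; apply: aeS (evol0_ae 0 phi) => x ->.
by rewrite mul0r oppr0 cexpi0 mul1r.
Qed.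

Lemma evol0D s t phi : evol0 s (evol0 t phi) = evol0 (s + t) phi.
Proof.
apply/L2_eqP.
have h : {ae mu, forall x, evol0 s (evol0 t phi) x =
    cexpi (- (s * x)) * (cexpi (- (t * x)) * phi x)}.
  by apply: aeS2 (evol0_ae s (evol0 t phi)) (evol0_ae t phi) => x -> ->.
by apply: aeS2 h (evol0_ae (s + t) phi) => x -> ->; rewrite mulrA -cexpiD mulrDl opprD.
Qed.

Lemma ip_evol0N t phi psi : ip phi (evol0 (- t) psi) = ip (evol0 t phi) psi.
Proof. by rewrite -(evol0_ip t) evol0D subrr evol0_0. Qed.

Lemma evol0_continuous (u : nat -> R) (t : R) phi : u n @[n --> \oo] --> t ->
  L2cvg \oo (fun n => evol0 (u n) phi) (evol0 t phi).
Proof.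
move=> ut; apply: (mulop_cvg _ _ 1 phi (fun n => cmeasurable_cexpi (u n))
  (cmeasurable_cexpi t) ler01 (fun n => cexpi_le1 (u n)) (cexpi_le1 t)).
by apply: aeW => x; apply: csq_cexpi_cvg; apply: cvgN; exact: cvgMl.
Qed.

(** The phase only shifts the frequency and commutes with the cut-off in [x], so the relation is
    exact before the limit in [n]. *)
Lemma fourier_trunc_evol0 n t phi k :
  fourier_trunc n (evol0 t phi) k = fourier_trunc n phi (k + t).
Proof.
rewrite /fourier_trunc; congr (_ * _).
have mD : measurable (`[- n%:R, n%:R]%classic : set R) by exact: measurable_itv.
have m1 : cmeasurable (fun x => cexpi (- (k * x)) * evol0 t phi x).
  by apply: cmeasurableM; [exact: cmeasurable_cexpi|exact: cmeasurable_L2].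
have m2 : cmeasurable (fun x => cexpi (- ((k + t) * x)) * phi x).
  by apply: cmeasurableM; [exact: cmeasurable_cexpi|exact: cmeasurable_L2].
have e : {ae mu, forall x, cexpi (- (k * x)) * evol0 t phi x = cexpi (- ((k + t) * x)) * phi x}.
  by apply: aeS (evol0_ae t phi) => x ->; rewrite mulrA -cexpiD mulrDl opprD.
have [a1 a2] := m1; have [b1 b2] := m2.
rewrite -[LHS]/(cintegral mu _ _) -[RHS]/(cintegral mu _ _).
congr Complex; congr fine; apply: ae_eq_integral => //.
- by apply/measurable_EFinP; exact: measurable_funTS.
- by apply/measurable_EFinP; exact: measurable_funTS.
- by apply: aeS e => x ->.
- by apply/measurable_EFinP; exact: measurable_funTS.
- by apply/measurable_EFinP; exact: measurable_funTS.
- by apply: aeS e => x ->.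
Qed.

(** The truncated relation passes to the limit because translation is an isometry. *)
Lemma fourier_evol0 t phi :
  fourier (evol0 t phi) = compop (fun k => k + t) (fourier phi).
Proof.
have mt := measurable_shift t; have lt := leb_shift t.
have h : L2cvg \oo (fun n => toL2 (fourier_trunc n (evol0 t phi)))
    (compop (fun k => k + t) (fourier phi)).
  have E n : toL2 (fourier_trunc n (evol0 t phi)) =
      compop (fun k => k + t) (toL2 (fourier_trunc n phi)).
    rewrite (compop_toL2 _ mt lt _ (fourier_trunc_L2pred n phi)).
    by congr toL2; apply/funext => k; exact: fourier_trunc_evol0.
  rewrite /L2cvg; under eq_fun do rewrite E -(linearB_of _ (compop_linear _ mt lt))
    (compop_isometry _ mt lt).
  by rewrite fourierE; apply/is_fourierP; exact: is_fourier_four.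
rewrite [LHS]fourierE; symmetry.
by apply: (L2cvg_uniq _ \oo _ _ _ _ h); apply/is_fourierP; exact: is_fourier_four.
Qed.

End FreeEvolution.

Lemma ae_eq_integrable {R : realType} (u v : R -> R) : measurable_fun setT v ->
  {ae (@leb R), forall x, u x = v x} -> (@leb R).-integrable setT (EFin \o u) ->
  (@leb R).-integrable setT (EFin \o v).
Proof.
move=> mv uv /integrableP[mu_ iu]; apply/integrableP; split; first exact/measurable_EFinP.
apply: le_lt_trans iu; rewrite le_eqVlt; apply/orP; left; apply/eqP.
apply: ae_eq_integral => //.
- by apply: measurableT_comp => //; exact/measurable_EFinP.
- exact: measurableT_comp.
- by apply: aeS uv => x h _; rewrite /= h.
Qed.

Section FreeSojournTime.
Context {R : realType}.
Local Notation mu := (@leb R).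
Implicit Types (phi psi chi : L2 R).
Variables (g : R -> R[i]) (M : R).
Hypotheses (mg : cmeasurable g) (M0 : 0 <= M).
Hypothesis gM : {ae mu, forall x, cabs (g x) <= M}.

Lemma ip_funP_evol0 t phi :
  cintegrable mu setT (fun k => g k * (csq (fourier phi (k + t)))%:C%C) /\
  ip (evol0 t phi) (funP g (evol0 t phi)) =
    cintegral mu setT (fun k => g k * (csq (fourier phi (k + t)))%:C%C).
Proof.
set chi := fourier phi; set chit := compop (fun k => k + t) chi.
have mt := measurable_shift t; have lt := leb_shift t.
have e1 : {ae mu, forall k, chit k = chi (k + t)} by exact: compop_ae mt lt chi.
have e2 := mulop_ae _ _ mg M0 gM chit.
have e : {ae mu, forall k, (chit k)^*%C * mulop g chit k = g k * (csq (chi (k + t)))%:C%C}.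
  apply: aeS2 e1 e2 => k h ->; rewrite h.
  by case: (g k) => a b; case: (chi (k + t)) => c d; rewrite /csq /=; apply: complex_eq => /=; ring.
have m1 : cmeasurable (fun k => (chit k)^*%C * mulop g chit k).
  by apply: cmeasurableM; [apply: cmeasurable_conj|]; exact: cmeasurable_L2.
have m2 : cmeasurable (fun k => g k * (csq (chi (k + t)))%:C%C).
  apply: cmeasurableM => //; split => /=; last exact: measurable_cst.
  by apply: (measurableT_comp (cmeasurable_csq _ (cmeasurable_L2 chi)) mt).
split; last first.
  by rewrite (ip_funP _ _ mg M0 gM) fourier_evol0 -/chi -/chit; exact: cintegral_ae.
have [i1 i2] := ip_integrable chit (mulop g chit).
have [a1 a2] := m1; have [b1 b2] := m2.
split.
  by apply: (ae_eq_integrable _ _ b1 _ i1); apply: aeS e => x ->.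
by apply: (ae_eq_integrable _ _ b2 _ i2); apply: aeS e => x ->.
Qed.

(** The integrand is the correlation of [g] with [|phi^|^2], whose time integral is a product of two
    integrals; Plancherel identifies one of them as the squared norm of [phi]. *)
Lemma free_sojourn_time phi : cintegrable mu setT g ->
  cintegrable mu setT (fun t => ip (evol0 t phi) (funP g (evol0 t phi))) /\
  cintegral mu setT (fun t => ip (evol0 t phi) (funP g (evol0 t phi))) =
    (L2norm phi ^+ 2)%:C%C * cintegral mu setT g.
Proof.
move=> [i1 i2]; pose v k := csq (fourier phi k).
have iv : mu.-integrable setT (EFin \o v) by exact: (L2pred_csq_integrable _ (L2valP _)).
have Ev : Rintegral mu setT v = L2norm phi ^+ 2.
  by rewrite -(fourier_isometry phi); apply: EFin_inj; rewrite -ip_csq /Rintegral fineK//;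
    exact: integrable_fin_num.
have ER (x : R[i]) (y : R) : Re (x * y%:C%C) = Re x * y by case: x => a b /=; ring.
have EI (x : R[i]) (y : R) : Im (x * y%:C%C) = Im x * y by case: x => a b /=; ring.
have j1 t : mu.-integrable setT (EFin \o (fun k => Re (g k) * v (k + t))).
  have [[+ _] _] := ip_funP_evol0 t phi; apply: eq_integrable => // k _.
  by rewrite /= -ER.
have j2 t : mu.-integrable setT (EFin \o (fun k => Im (g k) * v (k + t))).
  have [[_ +] _] := ip_funP_evol0 t phi; apply: eq_integrable => // k _.
  by rewrite /= -EI.
have [k1 E1] := Rintegral_correlation _ _ i1 iv j1.
have [k2 E2] := Rintegral_correlation _ _ i2 iv j2.
have F1 t : Re (ip (evol0 t phi) (funP g (evol0 t phi))) =
    Rintegral mu setT (fun k => Re (g k) * v (k + t)).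
  by have [_ ->] := ip_funP_evol0 t phi; apply: eq_Rintegral => k _; rewrite ER.
have F2 t : Im (ip (evol0 t phi) (funP g (evol0 t phi))) =
    Rintegral mu setT (fun k => Im (g k) * v (k + t)).
  by have [_ ->] := ip_funP_evol0 t phi; apply: eq_Rintegral => k _; rewrite EI.
split; first by split; [under eq_fun do rewrite F1|under eq_fun do rewrite F2].
rewrite /cintegral -!/(Rintegral _ _ _).
under eq_Rintegral do rewrite F1.
under [X in Complex _ X]eq_Rintegral do rewrite F2.
by rewrite E1 E2 Ev; apply: complex_eq => /=; rewrite -!/(Rintegral _ _ _); ring.
Qed.

End FreeSojournTime.

(** * Integrability of [f] from its decay *)

Section Decay.
Context {R : realType}.
Local Notation mu := (@leb R).

Lemma powR_neg_cvg0 (a : R) : a < 0 -> (1 + x) `^ a @[x --> +oo] --> (0 : R).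
Proof.
move=> a0; apply/cvgr0Pnorm_le => e e0.
have na : 0 < - a by rewrite oppr_gt0.
near=> x.
have x0 : 0 <= x by near: x; exact: nbhs_pinfty_ge.
have x1 : 0 < 1 + x by rewrite ltr_pwDl.
rewrite ger0_norm ?powR_ge0// -[a]opprK powRN -[e]invrK lef_pV2 ?posrE ?invr_gt0 ?powR_gt0//.
have -> : e^-1 = (e^-1 `^ (- a)^-1) `^ (- a).
  by rewrite -powRrM mulVf ?gt_eqF// powRr1// invr_ge0 ltW.
apply: ge0_ler_powR; rewrite ?nnegrE ?powR_ge0 ?ltW//.
apply: (@lt_le_trans _ _ x); last by rewrite lerDr.
by near: x; exact: nbhs_pinfty_gt.
Unshelve. all: by end_near. Qed.

(** [1 + |x|] replaces the Japanese bracket because its powers have the elementary primitive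
    [- (1 + x)^(1 - rho) / (rho - 1)] on the half line. *)
Lemma integral_decay (rho : R) : 1 < rho ->
  (\int[mu]_x ((1 + `|x|) `^ (- rho))%:E < +oo)%E.
Proof.
move=> rho1.
have pos (x : R) : 0 < 1 + `|x| by rewrite ltr_pwDl.
have cp : continuous (fun x : R => (1 + `|x|) `^ (- rho)).
  move=> x; have h1 : 1 + `|y| @[y --> x] --> 1 + `|x|.
    by apply: cvgD; [exact: cvg_cst|exact: norm_continuous].
  have h2 : y `^ (- rho) @[y --> 1 + `|x|] --> (1 + `|x|) `^ (- rho).
    apply: (differentiable_continuous (f := fun y : R => y `^ (- rho))); apply/derivable1_diffP.
    by have [] := is_derive1_powR (- rho) (pos x).
  exact: cvg_comp h1 h2.
rewrite -ge0_integral_leb//; last first.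
  by apply/measurable_EFinP; exact: continuous_measurable_fun.
rewrite ge0_symfun_integralT; [|by move=> x; exact: powR_ge0|exact: cp|]; last first.
  by move=> x; rewrite /= normrN.
have -> : [set x : R | 0 <= x] = `[0, +oo[%classic.
  by apply/seteqP; split => z /=; rewrite in_itv /= andbT.
pose F (x : R) := - (rho - 1)^-1 * (1 + x) `^ (1 - rho).
have dF (x : R) : - 1 < x -> is_derive x 1 F ((1 + x) `^ (- rho)).
  move=> x1; have x0 : 0 < 1 + x by lra.
  have d1 : is_derive x 1 ((cst 1 : R -> R) \+ id) (0 + 1) by exact: is_deriveD.
  have d2 := is_derive1_powR (1 - rho) x0.
  have d3 := is_derive1_comp d2 d1.
  have d4 := is_derive1_comp (is_derive_scale (- (rho - 1)^-1) _) d3.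
  apply: (is_derive_eq d4).
  rewrite add0r addrAC subrr add0r mulr1 mulrA.
  rewrite [X in X * _](_ : _ = 1) ?mul1r//.
  by field; lra.
have E : (\int[lebesgue_measure]_(x in `[0%R, +oo[) ((1 + `|x|) `^ (- rho))%:E = 0%:E - (F 0)%:E)%E.
  apply: ge0_continuous_FTC2y.
  - by move=> x _; exact: powR_ge0.
  - exact: continuous_subspaceT.
  - rewrite -[X in _ --> X](mulr0 (- (rho - 1)^-1)); apply: cvgMr.
    by apply: powR_neg_cvg0; lra.
  - by move=> x x0; have [] := dF x (lt_trans (ltrN10 _) x0).
  - apply: cvg_at_right_filter; apply/differentiable_continuous/derivable1_diffP.
    by have [] := dF 0 (ltrN10 _).
  - move=> x; rewrite in_itv /= andbT => x0; rewrite derive1E.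
    by have [_ ->] := dF x (lt_trans (ltrN10 _) x0); rewrite gtr0_norm.
by rewrite E -EFinB -EFinM ltry.
Qed.

Lemma decay_integrable (f : R -> R[i]) (rho C : R) : cmeasurable f -> 1 < rho -> 0 < C ->
  {ae mu, forall x, cabs (f x) <= C * (jap x) `^ (- rho)} -> cintegrable mu setT f.
Proof.
move=> mf rho1 C0 fC; apply/cintegrable_cabs => //.
have mc : measurable_fun setT (fun x => (cabs (f x))%:E).
  by apply/measurable_EFinP; exact: cmeasurable_cabs.
apply/integrableP; split => //.
under eq_integral do rewrite gee0_abs ?lee_fin ?cabs_ge0//.
have pos (x : R) : 0 < 1 + `|x| by rewrite ltr_pwDl.
have rho0 : 0 <= rho by lra.
(* The factor [2^rho] comes from [1 + |x| <= 2 <x>], that is [(1 + |x|)^2 <= 4 (1 + |x|^2)]. *)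
have J (x : R) : (jap x) `^ (- rho) <= 2 `^ rho * (1 + `|x|) `^ (- rho).
  have jp : 0 < jap x by rewrite sqrtr_gt0 ltr_pwDl// sqr_ge0.
  rewrite !powRN -[leRHS]invrK invf_div lef_pV2 ?posrE ?divr_gt0 ?powR_gt0//.
  rewrite ler_pdivrMr ?powR_gt0// -powRM; [|exact: ltW|by []].
  have j0 := ltW jp; have p0 := ltW (pos x).
  apply: ge0_ler_powR; rewrite ?nnegrE ?mulr_ge0//.
  rewrite -(@ler_pXn2r _ 2)// ?nnegrE ?mulr_ge0 ?ltW//.
  rewrite exprMn sqr_sqrtr ?addr_ge0 ?sqr_ge0//.
  by have := sqr_ge0 (`|x| - 1); have := sqr_ge0 (`|x|); move: `|x| => y; nra.
have mp : measurable_fun setT (fun x : R => (1 + `|x|) `^ (- rho)).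
  apply: (measurableT_comp (f := fun y : R => y `^ (- rho))); first exact: measurable_powR.
  by apply: measurable_funD => //; exact: normr_measurable.
apply: (@le_lt_trans _ _ (\int[mu]_x ((C * 2 `^ rho)%:E * ((1 + `|x|) `^ (- rho))%:E))%E).
  apply: ae_ge0_le_integral => //.
  - by move=> x _; rewrite lee_fin cabs_ge0.
  - by move=> x _; rewrite -EFinM lee_fin !mulr_ge0 ?powR_ge0 ?ltW.
  - by apply: emeasurable_funM; [exact: measurable_cst|exact/measurable_EFinP].
  apply: aeS fC => x h _; rewrite -EFinM lee_fin (le_trans h)// -mulrA.
  by rewrite ler_wpM2l// ltW.
rewrite ge0_integralZl//.
- apply: lte_mul_pinfty; [|by []|exact: integral_decay].
  by rewrite lee_fin mulr_ge0 ?powR_ge0 ?ltW.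
- exact/measurable_EFinP.
- by rewrite lee_fin mulr_ge0 ?powR_ge0 ?ltW.
Qed.

End Decay.

(** * Functional calculus *)

Section SpectralMeasure.
Context {R : realType}.
Implicit Types (phi psi chi : L2 R) (A B : set R).
Variable E : set R -> L2 R -> L2 R.
Hypothesis pvm : projection_valued_measure E.

Let proj B : measurable B -> orthogonal_projection (E B).
Proof. by have [h _ _] := pvm; exact: h. Qed.

Lemma pvm_linear B : measurable B -> linear (E B).
Proof. by move=> /proj[]. Qed.

Lemma pvm_idem B phi : measurable B -> E B (E B phi) = E B phi.
Proof. by move=> /proj[]. Qed.

Lemma pvm_ip B phi psi : measurable B -> ip phi (E B psi) = ip (E B phi) psi.
Proof. by move=> /proj[_ _ h]; exact: h. Qed.

Lemma pvmT phi : E setT phi = phi.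
Proof. by have [_ h _] := pvm. Qed.

Lemma pvm_norm_sqr B phi : measurable B -> rip phi (E B phi) = L2norm (E B phi) ^+ 2.
Proof. by move=> mB; rewrite -ripxx /rip -pvm_ip// pvm_idem. Qed.

Lemma pvm_ipxx B phi : measurable B -> ip phi (E B phi) = (L2norm (E B phi) ^+ 2)%:C%C.
Proof. by move=> mB; rewrite -ipxx -pvm_ip// pvm_idem. Qed.

Lemma pvm_contraction B phi : measurable B -> L2norm (E B phi) <= L2norm phi.
Proof.
move=> mB; have := rip_le phi (E B phi); rewrite pvm_norm_sqr//.
have := L2norm_ge0 (E B phi); rewrite le_eqVlt => /orP[/eqP <- _|n0].
  exact: L2norm_ge0.
by rewrite expr2 ler_pM2r.
Qed.

(** Additivity over a sequence of empty sets makes the multiples [n v] converge; consecutive ones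
    differ by [v], which must then be 0. *)
Lemma pvm0 phi : E set0 phi = 0.
Proof.
have [_ _ /(_ (fun=> set0) (fun=> measurable0))] := pvm.
move=> /(_ (fun _ _ _ _ => ltac:(by rewrite setI0 => -[])) phi); rewrite bigcup0//.
set v := E set0 phi; under eq_fun do rewrite sumr_const card_ord.
move=> h; apply: L2norm_eq0; apply/eqP; rewrite eq_le L2norm_ge0 andbT leNgt; apply/negP => n0.
have FF : Filter (\oo : set_system nat) by exact: _.
have e0 : 0 < L2norm v / 2 by rewrite divr_gt0.
have := L2cvg_lt \oo FF _ _ _ e0 h; move=> [N _ H].
have h1 := H N (leqnn N); have h2 := H N.+1 (leqW (leqnn N)).
have := L2norm_triangleB (v *+ N.+1) v (v *+ N).
rewrite (mulrS v N) -addrA subrr addr0 -mulrS (L2norm_distC v).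
by move: h1 h2 => /=; move: (L2norm _) (L2norm _) (L2norm _) => a b c; lra.
Qed.

Lemma pvmU A B phi : measurable A -> measurable B -> A `&` B = set0 ->
  E (A `|` B) phi = E A phi + E B phi.
Proof.
move=> mA mB AB0.
have [_ _ /(_ (bigcup2 A B))] := pvm.
move=> /(_ _ _ phi); rewrite bigcup2E => h.
have {}h := h (fun n => ltac:(by case: n => [|[|n]]; rewrite /bigcup2 /=)).
have {}h := h (ltac:(by rewrite -trivIset_bigcup2)).
apply: (L2cvg_uniq _ \oo _ _ _ _ h); rewrite /L2cvg.
apply: cvg_near_cst; exists 2%N => // -[|[|n]]// _ /=.
rewrite !big_ord_recl /= big1 ?addr0; last by move=> i _; rewrite /bigcup2 /= pvm0.
by rewrite subrr L2norm0.
Qed.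

Let spectral_distrU A B phi : measurable A -> measurable B -> A `&` B = set0 ->
  L2norm (E (A `|` B) phi) ^+ 2 = L2norm (E A phi) ^+ 2 + L2norm (E B phi) ^+ 2.
Proof.
move=> mA mB AB0; rewrite -!pvm_norm_sqr//; last exact: measurableU.
by rewrite pvmU// ripDr.
Qed.

(** Additivity gives [|E(A u B) E(B) phi|^2 = |E(A) E(B) phi|^2 + |E(B) phi|^2], while a projection
    cannot increase the norm of [E(B) phi]. *)
Let pvm_disj A B phi : measurable A -> measurable B -> A `&` B = set0 ->
  E A (E B phi) = 0.
Proof.
move=> mA mB AB0; have := spectral_distrU A B (E B phi) mA mB AB0.
have := pvm_contraction (A `|` B) (E B phi) (measurableU _ _ mA mB).
rewrite -(@ler_pXn2r _ 2)// ?nnegrE ?L2norm_ge0// => h1 h2.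
rewrite h2 pvm_idem// gerDr in h1.
by apply: L2norm_eq0; apply/eqP; rewrite -sqrf_eq0 eq_le h1 sqr_ge0.
Qed.

(** Both sets are split along their intersection; idempotence keeps the common piece and [pvm_disj]
    removes the others. *)
Lemma pvmI A B phi : measurable A -> measurable B -> E A (E B phi) = E (A `&` B) phi.
Proof.
move=> mA mB.
have mI := measurableI _ _ mA mB; have mD := measurableD mB mA.
have mD' := measurableD mA mB.
have split A' B' psi : measurable A' -> measurable B' ->
    E B' psi = E (A' `&` B') psi + E (B' `\` A') psi.
  move=> m1 m2; rewrite -[in LHS](setUIDK B' A') pvmU ?(setIC B' A')//.
  - exact: measurableI.
  - exact: measurableD.
  - by apply/seteqP; split => x //= [[]] ? ? [].
rewrite (split A B phi)// (linearD_of _ (pvm_linear _ mA)).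
rewrite (pvm_disj A (B `\` A))//; last by apply/seteqP; split => x //= [] ? [].
rewrite addr0 (split B A)// setIC pvm_idem//.
rewrite (pvm_disj (A `\` B))// ?addr0//.
by apply/seteqP; split => x //= [[]] ? ? [].
Qed.

(* The vacuous mention of [pvm] keeps it an argument of [spectral_meas], so that
   the measure structure declared below can be inferred. *)
Definition spectral_meas phi : set R -> \bar R := let _ := pvm in spectral_distr E phi.

Let sm0 phi : spectral_meas phi set0 = 0%E.
Proof. by rewrite /spectral_meas /spectral_distr pvm0 L2norm0 expr0n. Qed.

Let sm_ge0 phi B : (0 <= spectral_meas phi B)%E.
Proof. by rewrite lee_fin sqr_ge0. Qed.

(** Norm convergence of the partial sums is paired with [phi], using
    [|E(B) phi|^2 = <phi, E(B) phi>], which is linear in the vector [E(B) phi]. *)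
Let sm_additive phi : semi_sigma_additive (spectral_meas phi).
Proof.
move=> F mF tF mU; rewrite /spectral_meas /spectral_distr.
have FF : Filter (\oo : set_system nat) by exact: _.
have [_ _ /(_ F mF tF phi) h] := pvm.
have := ip_continuous_r \oo FF _ _ phi h; rewrite pvm_norm_sqr// => h'.
apply/cvg_EFin; first by apply: nearW => n; rewrite sumEFin.
have -> : fine \o (fun n => \sum_(0 <= i < n) (L2norm (E (F i) phi) ^+ 2)%:E)%E =
    (fun n => rip phi (\sum_(k < n) E (F k) phi)).
  apply/funext => n; rewrite /= sumEFin /= big_mkord.
  rewrite (big_morph (rip phi) (ripDr phi) (_ : rip phi 0 = 0)); last by rewrite /rip ip0r.
  by apply: eq_bigr => k _; rewrite pvm_norm_sqr.
exact: h'.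
Qed.

HB.instance Definition _ phi := isMeasure.Build _ _ _ (spectral_meas phi)
  (sm0 phi) (sm_ge0 phi) (sm_additive phi).

Let sm_fin phi : fin_num_fun (spectral_meas phi).
Proof. by []. Qed.

HB.instance Definition _ phi := Measure_isFinite.Build _ _ _ (spectral_meas phi) (sm_fin phi).

Lemma spectral_measT phi : spectral_meas phi setT = (L2norm phi ^+ 2)%:E.
Proof. by rewrite /spectral_meas /spectral_distr pvmT. Qed.

Lemma bounded_spectral_integrable phi (u : R -> R) (K : R) : measurable_fun setT u ->
  (forall x, `|u x| <= K) -> (spectral_meas phi).-integrable setT (EFin \o u).
Proof.
move=> mu_ uK; have iK := finite_measure_integrable_cst (spectral_meas phi) K.
apply: (le_integrable measurableT _ _ (iK setT measurableT)).
  exact/measurable_EFinP.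
by move=> x _; rewrite /= lee_fin (le_trans (uK x))// ler_norm.
Qed.

End SpectralMeasure.

(** * Operators attached to simple functions *)

Section SimpleFunctions.
Context {R : realType}.
Implicit Types (phi psi chi : L2 R).

(** The sets may overlap and the index is any finite type, so that a product of two such functions
    is again one, indexed by pairs. *)
Definition simp (I : finType) (c : I -> R[i]) (B : I -> set R) (x : R) : R[i] :=
  \sum_i c i * (\1_(B i) x)%:C%C.

Definition simpop (E : set R -> L2 R -> L2 R) (I : finType) (c : I -> R[i])
    (B : I -> set R) phi : L2 R :=
  \sum_i c i *: E (B i) phi.

Variable E : set R -> L2 R -> L2 R.
Hypothesis pvm : projection_valued_measure E.
Local Notation nu := (spectral_meas E pvm).

Lemma simp_mul (I J : finType) (c : I -> R[i]) B (d : J -> R[i]) C x :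
  simp I c B x * simp J d C x =
  simp (I * J)%type (fun p => c p.1 * d p.2) (fun p => B p.1 `&` C p.2) x.
Proof.
rewrite /simp big_distrlr /= pair_bigA; apply: eq_bigr => -[i j] _ /=.
rewrite mulrACA; congr (_ * _); rewrite indicI /=.
by apply: complex_eq => /=; ring.
Qed.

Lemma simp_conj (I : finType) (c : I -> R[i]) B x :
  (simp I c B x)^*%C = simp I (fun i => (c i)^*%C) B x.
Proof.
rewrite /simp (rmorph_sum (@conjc R)); apply: eq_bigr => i _.
by case: (c i) => a b /=; apply: complex_eq => /=; ring.
Qed.

Section Measurable.
Variables (I : finType) (c : I -> R[i]) (B : I -> set R).
Hypothesis mB : forall i, measurable (B i).

Lemma cmeasurable_sum (F : I -> R -> R[i]) : (forall i, cmeasurable (F i)) ->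
  cmeasurable (fun x => \sum_i F i x).
Proof.
move=> mF; elim: (index_enum I) => [|i r IH].
  by under eq_fun do rewrite big_nil; exact: cmeasurable_cst.
by under eq_fun do rewrite big_cons; exact: cmeasurableD.
Qed.

Lemma cmeasurable_simp : cmeasurable (simp I c B).
Proof.
apply: cmeasurable_sum => i; apply: cmeasurableM; first exact: cmeasurable_cst.
exact: cmeasurable_indic.
Qed.

Lemma cintegral_simp phi : cintegral (nu phi) setT (simp I c B) =
  \sum_i c i * (L2norm (E (B i) phi) ^+ 2)%:C%C.
Proof.
have i1 i : cintegrable (nu phi) setT (fun x => (\1_(B i) x)%:C%C : R[i]).
  split => /=.
    apply: (bounded_spectral_integrable _ pvm _ _ 1); first exact: measurable_indic.
    by move=> x; rewrite indicE; case: (_ \in _); rewrite ?normr1 ?normr0.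
  by apply: (bounded_spectral_integrable _ pvm _ _ 0) => // x; rewrite normr0.
have e1 i : cintegral (nu phi) setT (fun x => (\1_(B i) x)%:C%C : R[i]) =
    (L2norm (E (B i) phi) ^+ 2)%:C%C.
  apply: complex_eq => /=; last by rewrite integral0.
  by rewrite integral_indic// setIT.
suff h (r : seq I) : cintegrable (nu phi) setT (fun x => \sum_(i <- r) c i * (\1_(B i) x)%:C%C) /\
    cintegral (nu phi) setT (fun x => \sum_(i <- r) c i * (\1_(B i) x)%:C%C) =
    \sum_(i <- r) c i * (L2norm (E (B i) phi) ^+ 2)%:C%C by have [] := h (index_enum I).
elim: r => [|i r [IH1 IH2]].
  under eq_fun do rewrite big_nil; rewrite big_nil; split.
    by split; exact: integrable0.
  by apply: complex_eq; rewrite /= integral0.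
have j := cintegrableZ (nu phi) setT measurableT (c i) _ (i1 i).
under eq_fun do rewrite big_cons; rewrite big_cons; split; first exact: cintegrableD.
by rewrite cintegralD// cintegralZ// e1 IH2.
Qed.

Lemma simpop_linear : linear (simpop E I c B).
Proof.
move=> a phi psi; rewrite /simpop scaler_sumr -big_split; apply: eq_bigr => i _ /=.
by rewrite (pvm_linear _ pvm _ (mB i)) scalerDr !scalerA mulrC.
Qed.

End Measurable.

Lemma ip_sumr phi (I : finType) (F : I -> L2 R) :
  ip phi (\sum_i F i) = \sum_i ip phi (F i).
Proof. exact: (big_morph (ip phi) (ipDr phi) (ip0r phi)). Qed.

Lemma ip_suml phi (I : finType) (F : I -> L2 R) :
  ip (\sum_i F i) phi = \sum_i ip (F i) phi.
Proof.
apply: (big_morph (ip^~ phi) (fun x y => ipDl phi x y)).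
by rewrite ip_conj ip0r conjc0.
Qed.

Section TwoFamilies.
Variables (I J : finType) (c : I -> R[i]) (B : I -> set R) (d : J -> R[i]) (C : J -> set R).
Hypotheses (mB : forall i, measurable (B i)) (mC : forall j, measurable (C j)).

Lemma ip_simpop phi : ip phi (simpop E I c B phi) = cintegral (nu phi) setT (simp I c B).
Proof.
rewrite cintegral_simp// /simpop ip_sumr; apply: eq_bigr => i _.
by rewrite ipZr pvm_ipxx.
Qed.

Lemma simpop_comp phi : simpop E I c B (simpop E J d C phi) =
  simpop E (I * J)%type (fun p => c p.1 * d p.2) (fun p => B p.1 `&` C p.2) phi.
Proof.
rewrite /simpop.
transitivity (\sum_i \sum_j (c i * d j) *: E (B i `&` C j) phi); last first.
  by rewrite pair_bigA.
apply: eq_bigr => i _.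
have lE := pvm_linear _ pvm _ (mB i).
rewrite (big_morph _ (linearD_of _ lE) (linear0_of _ lE)) scaler_sumr.
by apply: eq_bigr => j _; rewrite (linearZ_of _ lE) scalerA pvmI.
Qed.

(** Symmetry and [pvmI] reduce [<E(B_i) phi, E(C_j) phi>] to the mass of the intersection. This is
    the isometry between simple functions in [L^2] of the spectral measure and vectors of [L2]. *)
Lemma ip_simpop2 phi : ip (simpop E I c B phi) (simpop E J d C phi) =
  cintegral (nu phi) setT (fun x => (simp I c B x)^*%C * simp J d C x).
Proof.
transitivity (cintegral (nu phi) setT (simp (I * J)%type (fun p => (c p.1)^*%C * d p.2)
    (fun p => B p.1 `&` C p.2))); last first.
  by apply: eq_cintegral => x _; rewrite simp_conj simp_mul.
rewrite cintegral_simp; last by move=> p; exact: measurableI.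
rewrite /simpop ip_suml.
transitivity (\sum_i \sum_j (c i)^*%C * d j * (L2norm (E (B i `&` C j) phi) ^+ 2)%:C%C);
  last by rewrite pair_bigA.
apply: eq_bigr => i _.
rewrite ip_sumr; apply: eq_bigr => j _.
by rewrite ipZl ipZr mulrA -pvm_ip// pvmI// pvm_ipxx//; exact: measurableI.
Qed.

End TwoFamilies.

Lemma L2norm_simpop (I : finType) (c : I -> R[i]) B phi : (forall i, measurable (B i)) ->
  L2norm (simpop E I c B phi) ^+ 2 = Rintegral (nu phi) setT (fun x => csq (simp I c B x)).
Proof.
move=> mB; rewrite -ripxx /rip ip_simpop2//=; apply: eq_Rintegral => x _.
by case: (simp _ _ _ _) => a b; rewrite /csq /=; ring.
Qed.

End SimpleFunctions.

Section ComplexLimits.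
Context {R : realType}.

Lemma csq_cvg0 (u : nat -> R[i]) (z : R[i]) : csq (u n - z) @[n --> \oo] --> (0 : R) ->
  Re (u n) @[n --> \oo] --> Re z /\ Im (u n) @[n --> \oo] --> Im z.
Proof.
move=> h; have H (p : R[i] -> R) : (forall w, p w ^+ 2 <= csq w) ->
    (forall v w, p (v - w) = p v - p w) -> p (u n) @[n --> \oo] --> p z.
  move=> p1 p2; apply/cvgrPdist_lt => e e0.
  have /cvgr0Pnorm_lt/(_ (e ^+ 2)) := h; rewrite exprn_gt0// => /(_ erefl).
  apply: filterS => n; rewrite (ger0_norm (csq_ge0 _)) => hn.
  rewrite distrC -p2 -(@ltr_pXn2r _ 2)// ?nnegrE ?normr_ge0 ?ltW//.
  by rewrite real_normK ?num_real//; exact: le_lt_trans hn.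
split; apply: H.
- by move=> w; rewrite lerDl sqr_ge0.
- by move=> v w; rewrite cReD cReN.
- by move=> w; rewrite lerDr sqr_ge0.
- by move=> v w; rewrite cImD cImN.
Qed.

End ComplexLimits.

Section FunctionalCalculus.
Context {R : realType}.
Implicit Types (phi psi chi : L2 R).
Variable E : set R -> L2 R -> L2 R.
Hypothesis pvm : projection_valued_measure E.
Local Notation nu := (spectral_meas E pvm).

(** Complex polarization: the difference form [b] satisfies [b(x, y) + b(y, x) = 0], and replacing
    [y] by [i y] gives [b(x, y) - b(y, x) = 0]. *)
Lemma linear_diag_eq (A A' : L2 R -> L2 R) : linear A -> linear A' ->
  (forall phi, ip phi (A phi) = ip phi (A' phi)) -> A = A'.
Proof.
move=> lA lA' h; apply/funext => psi; apply: ip_eq => phi.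
have q chi : ip chi (A chi) - ip chi (A' chi) = 0 by rewrite h subrr.
pose b x y := ip x (A y) - ip x (A' y).
have bD x y : b x y + b y x = 0.
  have := q (x + y); rewrite (linearD_of _ lA) (linearD_of _ lA') !ipDl !ipDr => e.
  rewrite -[RHS]e /b -[LHS]addr0 -(q x) -[LHS]addr0 -(q y); ring.
have bZ x y : b x ('i%C *: y) = 'i%C * b x y.
  by rewrite /b (linearZ_of _ lA) (linearZ_of _ lA') !ipZr mulrBr.
have bZl x y : b ('i%C *: y) x = - 'i%C * b y x.
  rewrite /b !ipZl -mulrBr; congr (_ * _).
  by apply: complex_eq => /=; rewrite ?oppr0.
have e1 := bD phi psi; have e2 := bD phi ('i%C *: psi).
rewrite bZ bZl mulNr -mulrBr in e2.
apply/eqP; rewrite -subr_eq0 -/(b phi psi); move: e1 e2.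
case: (b phi psi) => x y; case: (b psi phi) => x' y' /= e1 e2.
have h1 := congr1 (@complex.Re R) e1; have h2 := congr1 (@complex.Im R) e1.
have h3 := congr1 (@complex.Re R) e2; have h4 := congr1 (@complex.Im R) e2.
rewrite /= in h1 h2 h3 h4; apply/eqP; apply: complex_eq => /=; lra.
Qed.

(** Diagonal values determine a linear operator, so the [xget] in [funcalc] must return any
    candidate that has them. *)
Lemma funcalcE (g : R -> R[i]) (A : L2 R -> L2 R) : linear A ->
  (forall phi, ip phi (A phi) = cintegral (nu phi) setT g) -> funcalc E g = A.
Proof.
move=> lA hA; rewrite /funcalc; case: xgetP => [A' _ [lA' hA']|h].
  by apply: linear_diag_eq => // phi; rewrite hA hA'.
by case: (h A).
Qed.

(** The approximating families stay abstract because they are instantiated twice: by step functions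
    for one exponential, and by their pairwise products for the group law. *)
Variables (I_ : nat -> finType) (c_ : forall n, I_ n -> R[i]) (B_ : forall n, I_ n -> set R).
Arguments c_ : clear implicits.
Arguments B_ : clear implicits.
Hypothesis mB : forall n i, measurable (B_ n i).
Variable g : R -> R[i].
Hypothesis mg : cmeasurable g.
Hypothesis g1 : forall x, csq (g x) <= 1.
Local Notation s n := (simp (I_ n) (c_ n) (B_ n)).
Local Notation u n := (simpop E (I_ n) (c_ n) (B_ n)).
Hypothesis s1 : forall n x, csq (s n x) <= 1.
Hypothesis sg : forall x, csq (s n x - g x) @[n --> \oo] --> (0 : R).

Let ms n : cmeasurable (s n) := cmeasurable_simp (I_ n) (c_ n) (B_ n) (mB n).

Let csqB_le4 z w : csq z <= 1 -> csq w <= 1 -> csq (z - w) <= (4 : R).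
Proof. by move=> z1 w1; have := csqD z (- w); rewrite csqN; lra. Qed.

Let icsq phi h : cmeasurable h -> (forall x, csq (h x) <= 4) ->
  (nu phi).-integrable setT (EFin \o (fun x => csq (h x))).
Proof.
move=> mh h4; apply: (bounded_spectral_integrable _ pvm _ _ 4).
  exact: cmeasurable_csq.
by move=> x; rewrite ger0_norm ?csq_ge0.
Qed.

(** The two families have different index types, so their difference is not a [simpop]; the square
    is expanded and each term evaluated by [ip_simpop2]. *)
Let simpop_dist phi m n : L2norm (u m phi - u n phi) ^+ 2 =
  Rintegral (nu phi) setT (fun x => csq (s m x - s n x)).
Proof.
have i4 (p : R -> R) : measurable_fun setT p -> (forall x, `|p x| <= 1) ->
    (nu phi).-integrable setT (EFin \o p).
  by move=> mp p1; exact: (bounded_spectral_integrable _ pvm _ _ 1).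
have mp : measurable_fun setT (fun x => Re ((s m x)^*%C * s n x)).
  by have [] := cmeasurableM _ _ (cmeasurable_conj _ (ms m)) (ms n).
have p1 x : `|Re ((s m x)^*%C * s n x)| <= 1.
  apply: le_trans (Re_cabs _) _; rewrite cabsM !cabsE csqJ.
  have h n' : Num.sqrt (csq (s n' x)) <= 1 by rewrite -sqrtr1 ler_wsqrtr.
  by rewrite mulr_ile1 ?sqrtr_ge0.
have ip_ := i4 _ mp p1.
have iC n' : (nu phi).-integrable setT (EFin \o (fun x => csq (s n' x))).
  apply: i4; first exact: cmeasurable_csq.
  by move=> x; rewrite ger0_norm ?csq_ge0.
rewrite (L2norm_sqrD (u m phi) (- u n phi)) L2normN ripNr !L2norm_simpop//.
rewrite {1}/rip ip_simpop2//= -/(Rintegral _ _ _).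
transitivity (Rintegral (nu phi) setT (fun x => (csq (s m x) + csq (s n x)) +
    (- 2) * Re ((s m x)^*%C * s n x))); last first.
  apply: eq_Rintegral => x _.
  by case: (s m x) => a b; case: (s n x) => c d; rewrite /csq /=; ring.
rewrite RintegralD//; last 2 first.
- exact: (integrableD measurableT (iC m) (iC n)).
- exact: (integrableZl measurableT (- 2) ip_).
rewrite RintegralD// RintegralZl//.
move: (Rintegral _ _ _) (Rintegral _ _ _) (Rintegral _ _ _) => a b c; ring.
Qed.

Let d phi n := Rintegral (nu phi) setT (fun x => csq (s n x - g x)).

Let d_cvg0 phi : d phi n @[n --> \oo] --> (0 : R).
Proof.
have [|||||_ c] := @Rdominated_convergence R (nu phi) setT measurableT
    (fun n x => csq (s n x - g x)) (cst 0) (cst 4).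
- by move=> n; apply: cmeasurable_csq; exact: cmeasurableB.
- exact: measurable_cst.
- by apply: aeW => x _; exact: sg.
- exact: (finite_measure_integrable_cst (nu phi) 4 measurableT).
- by move=> n x _; rewrite ger0_norm ?csq_ge0// csqB_le4.
by rewrite /= Rintegral_cst// mul0r in c.
Qed.

(** The approximants converge in [L^2] of the finite measure [nu phi] by bounded convergence, and
    [simpop_dist] transports the Cauchy property to [L2]. *)
Let simpop_ex phi : exists chi, L2cvg \oo (fun n => u n phi) chi.
Proof.
apply: L2_complete => e e0.
have e4 : 0 < e ^+ 2 / 4 by rewrite divr_gt0// exprn_gt0.
have /cvgr0Pnorm_lt/(_ _ e4) [N _ H] := d_cvg0 phi.
exists N => m n Nm Nn.
have d0 k : 0 <= d phi k by apply: Rintegral_ge0 => x _; exact: csq_ge0.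
have := H m Nm; have := H n Nn; rewrite /= !ger0_norm// => hn hm.
rewrite -(@ltr_pXn2r _ 2)// ?nnegrE ?L2norm_ge0 ?ltW// simpop_dist.
apply: (@le_lt_trans _ _ (2 * (d phi m + d phi n))); last by lra.
have i k : (nu phi).-integrable setT (EFin \o (fun x => csq (s k x - g x))).
  by apply: icsq; [exact: cmeasurableB|move=> x; exact: csqB_le4].
rewrite /d -RintegralD// -RintegralZl//; last exact: (integrableD measurableT (i m) (i n)).
apply: le_Rintegral => //.
- by apply: icsq; [exact: cmeasurableB|move=> x; exact: csqB_le4].
- exact: (integrableZl measurableT 2 (integrableD measurableT (i m) (i n))).
move=> x _; have := csqD (s m x - g x) (- (s n x - g x)); rewrite csqN.
by rewrite opprB addrA subrK.
Qed.

Let lim phi : L2 R := sval (cid (simpop_ex phi)).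

Let limP phi : L2cvg \oo (fun n => u n phi) (lim phi).
Proof. exact: svalP (cid (simpop_ex phi)). Qed.

Let lim_linear : linear lim.
Proof.
have FF : Filter (\oo : set_system nat) by exact: _.
move=> a phi psi; apply: (L2cvg_uniq _ \oo _ _ _ _ (limP (a *: phi + psi))).
rewrite /L2cvg; under eq_fun do rewrite (simpop_linear E pvm _ _ _ (mB _)).
exact: (L2cvgL \oo FF _ _ a _ _ (limP phi) (limP psi)).
Qed.

(** The identity for simple functions passes to the limit: norm convergence on the left, domination
    by 1 for the finite measure on the right. *)
Let lim_ip phi : ip phi (lim phi) = cintegral (nu phi) setT g.
Proof.
have FF : Filter (\oo : set_system nat) by exact: _.
have h1 : {ae nu phi, forall x, setT x -> Re (s n x) @[n --> \oo] --> Re (g x)}.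
  by apply: aeW => x _; have [] := csq_cvg0 _ _ (sg x).
have h2 : {ae nu phi, forall x, setT x -> Im (s n x) @[n --> \oo] --> Im (g x)}.
  by apply: aeW => x _; have [] := csq_cvg0 _ _ (sg x).
have le1 n x : cabs (s n x) <= 1 by rewrite cabsE -sqrtr1 ler_wsqrtr.
have i1 := finite_measure_integrable_cst (nu phi) 1 measurableT.
have [m1 m2] := mg.
have [_ c1] := @Rdominated_convergence R (nu phi) setT measurableT _ _ _
  (fun n => (ms n).1) m1 h1 i1 (fun n x _ => le_trans (Re_cabs _) (le1 n x)).
have [_ c2] := @Rdominated_convergence R (nu phi) setT measurableT _ _ _
  (fun n => (ms n).2) m2 h2 i1 (fun n x _ => le_trans (Im_cabs _) (le1 n x)).
have k1 := ip_continuous_r \oo FF _ _ phi (limP phi).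
have k2 := ip_continuous_r \oo FF _ _ ('i%C *: phi) (limP phi).
have e1 : (fun n => rip phi (u n phi)) = (fun n => Rintegral (nu phi) setT (fun x => Re (s n x))).
  by apply/funext => n; rewrite /rip ip_simpop.
have imE psi chi : rip ('i%C *: psi) chi = Im (ip psi chi).
  by rewrite /rip ipZl; case: (ip psi chi) => a b /=; ring.
have e2 : (fun n => rip ('i%C *: phi) (u n phi)) = (fun n => Rintegral (nu phi) setT (fun x => Im (s n x))).
  by apply/funext => n; rewrite imE ip_simpop.
rewrite e1 in k1; rewrite e2 imE in k2.
have e3 := etrans (esym (cvg_lim (@norm_hausdorff _ _) k1)) (cvg_lim (@norm_hausdorff _ _) c1).
have e4 := etrans (esym (cvg_lim (@norm_hausdorff _ _) k2)) (cvg_lim (@norm_hausdorff _ _) c2).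
by apply: complex_eq; [exact: e3|exact: e4].
Qed.

Let funcalc_lim : funcalc E g = lim.
Proof. exact: (funcalcE g lim lim_linear lim_ip). Qed.

Lemma simpop_cvg phi : L2cvg \oo (fun n => u n phi) (funcalc E g phi).
Proof. by rewrite funcalc_lim; exact: limP. Qed.

Lemma funcalc_linear : linear (funcalc E g).
Proof. by rewrite funcalc_lim; exact: lim_linear. Qed.

Lemma simpop_le n phi : L2norm (u n phi) <= L2norm phi.
Proof.
rewrite -(@ler_pXn2r _ 2)// ?nnegrE ?L2norm_ge0// (L2norm_simpop E pvm)//.
have -> : L2norm phi ^+ 2 = Rintegral (nu phi) setT (cst 1).
  by rewrite Rintegral_cst// mul1r; exact: esym (congr1 fine (spectral_measT E pvm phi)).
apply: le_Rintegral => //.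
- by apply: icsq => // x; apply: le_trans (s1 n x) _; rewrite ler1n.
- exact: (finite_measure_integrable_cst (nu phi) 1 measurableT).
Qed.

Lemma funcalc_le phi : L2norm (funcalc E g phi) <= L2norm phi.
Proof.
have FF : Filter (\oo : set_system nat) by exact: _.
have c := L2norm_continuous \oo FF _ _ (simpop_cvg phi).
rewrite -(cvg_lim (@norm_hausdorff _ _) c); apply: limr_le.
  by apply/cvg_ex; eexists; exact: c.
by apply: nearW => n; exact: simpop_le.
Qed.

End FunctionalCalculus.

(** * Step approximation of the exponentials *)

Section StepFunctions.
Context {R : realType}.

Lemma simp_disjoint (I : finType) (c : I -> R[i]) (B : I -> set R) x :
  (forall i j, B i x -> B j x -> i = j) ->
  (exists2 i, B i x & simp I c B x = c i) \/
  (simp I c B x = 0 /\ forall i, ~ B i x).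
Proof.
move=> dB; have [[i Bi]|nB] := pselect (exists i, B i x).
  left; exists i => //; rewrite /simp (bigD1 i)//= big1 ?addr0.
    by rewrite indicE mem_set//= mulr1.
  move=> j ji; rewrite indicE memNset ?mulr0// => Bj.
  by rewrite (dB _ _ Bi Bj) eqxx in ji.
right; split; last by move=> i Bi; apply: nB; exists i.
rewrite /simp big1// => i _; rewrite indicE memNset ?mulr0// => Bi.
by apply: nB; exists i.
Qed.

(** With [N = n + 1], the interval from [-N] to [N] is cut into pieces of length [1 / N], hence
    [2 N^2] of them; [step_point] is the left end of a piece. *)
Definition step_size (n : nat) : nat := (2 * n.+1 ^ 2)%N.

Definition step_index (n : nat) : finType := 'I_(step_size n).

Definition step_set (n : nat) (k : step_index n) : set R :=
  (fun x => n.+1%:R * x + n.+1%:R ^+ 2) @^-1` `[(k : nat)%:R, (k : nat).+1%:R[%classic.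

Definition step_point (n : nat) (k : step_index n) : R := (k : nat)%:R / n.+1%:R - n.+1%:R.

Lemma measurable_step_set n k : measurable (step_set n k).
Proof.
rewrite /step_set -[X in measurable X]setTI.
by apply: (measurable_affine n.+1%:R) => //; exact: measurable_itv.
Qed.

Lemma step_set_disjoint n i j x : step_set n i x -> step_set n j x -> i = j.
Proof.
rewrite /step_set /= !in_itv /= => /truncn_def hi /truncn_def hj.
by apply: val_inj; rewrite /= -hi -hj.
Qed.

Lemma step_set_point n k x : step_set n k x -> `|step_point n k - x| <= n.+1%:R^-1.
Proof.
rewrite /step_set /step_point /= in_itv /= => /andP[h1 h2].
have m0 : (0 : R) < n.+1%:R by [].
rewrite -[X in _ < X]natr1 in h2.
have {}h1 : (k : nat)%:R / n.+1%:R <= x + n.+1%:R.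
  by rewrite ler_pdivrMr// mulrDl -expr2 mulrC.
have {}h2 : x + n.+1%:R < (k : nat)%:R / n.+1%:R + n.+1%:R^-1.
  by rewrite -[X in _ < _ + X]mul1r -mulrDl ltr_pdivlMr// mulrDl -expr2 mulrC.
rewrite ler_norml; move: h1 h2; move: ((k : nat)%:R / n.+1%:R : R) (n.+1%:R^-1 : R) (n.+1%:R : R) => a b c ? ?; apply/andP; split; lra.
Qed.

Lemma step_set_exists n x : `|x| < n.+1%:R -> exists k, step_set n k x.
Proof.
rewrite ltr_norml => /andP[h1 h2]; have m0 : (0 : R) < n.+1%:R by [].
pose y : R := n.+1%:R * x + n.+1%:R ^+ 2.
have y0 : 0 <= y by rewrite /y; move: h1 h2 m0; move: (n.+1%:R) => m; nra.
have y1 : y < (step_size n)%:R.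
  by rewrite /y /step_size natrM natrX; move: h1 h2 m0; move: (n.+1%:R) => m; nra.
have /andP[t1 t2] := truncn_itv y0.
have tN : (Num.truncn y < step_size n)%N by rewrite -(ltr_nat R); exact: le_lt_trans y1.
by exists (Ordinal tN); rewrite /step_set /= in_itv /= t1.
Qed.

Variable t : R.
Local Notation e_ := (fun x : R => cexpi (- (t * x))).

Definition step_coef (n : nat) (k : step_index n) : R[i] := e_ (step_point n k).

Definition step_exp n : R -> R[i] := simp (step_index n) (step_coef n) (step_set n).

Lemma step_exp_le1 n x : csq (step_exp n x) <= 1.
Proof.
have := simp_disjoint _ (step_coef n) (step_set n) x (fun i j => step_set_disjoint n i j x).
by rewrite /step_exp => -[[i _ ->]|[-> _]]; rewrite ?csq_cexpi// /csq /= expr0n addr0.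
Qed.

Lemma step_exp_cvg x : csq (step_exp n x - e_ x) @[n --> \oo] --> (0 : R).
Proof.
(* [p] is the grid point at which the exponential is sampled. Outside the grid it is set to [x]
   itself, which keeps the distance bound; any fixed [x] lies inside for large [n]. *)
have P n : exists p : R, `|p - x| <= n.+1%:R^-1 /\ (`|x| < n.+1%:R -> step_exp n x = e_ p).
  have := simp_disjoint _ (step_coef n) (step_set n) x (fun i j => step_set_disjoint n i j x).
  move=> [[i Bi e]|[_ nB]].
    by exists (step_point n i); split=> [|_]; [exact: step_set_point|rewrite /step_exp e].
  exists x; split; first by rewrite subrr normr0 invr_ge0.
  by move=> /step_set_exists[k] /(nB k).
have [p /all_and2[p1 p2]] := choice P.
have px : p n @[n --> \oo] --> x.
  apply/cvgrPdist_le => e e0.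
  have h : (n.+1%:R^-1 : R) @[n --> \oo] --> 0 by exact: cvg_harmonic.
  have /cvgr0Pnorm_le/(_ e e0) := h; apply: filterS => n.
  rewrite ger0_norm ?invr_ge0// => hn; rewrite distrC; exact: le_trans (p1 n) hn.
have h : - (t * p n) @[n --> \oo] --> - (t * x) by apply: cvgN; apply: cvgMr.
have := csq_cexpi_cvg _ _ h; apply: cvg_trans; apply: near_eq_cvg.
near=> n; rewrite p2//.
have : `|x| <= n%:R by near: n; exact: nbhs_infty_ger.
by move=> /le_lt_trans; apply; rewrite ltr_nat.
Unshelve. all: by end_near. Qed.

End StepFunctions.

(** * The unitary group generated by [H] *)

Section UnitaryGroup.
Context {R : realType}.
Implicit Types (phi psi chi : L2 R).
Variable E : set R -> L2 R -> L2 R.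
Hypothesis pvm : projection_valued_measure E.

Let cexpi_le1 (t : R) x : csq (cexpi (- (t * x))) <= 1.
Proof. by rewrite csq_cexpi. Qed.

Let evol_cvg t phi : L2cvg \oo (fun n => simpop E (step_index n) (step_coef t n) (step_set n) phi)
    (evol E t phi).
Proof.
exact: (simpop_cvg _ pvm _ _ _ measurable_step_set _ (cmeasurable_cexpi t) (cexpi_le1 t)
  (step_exp_le1 t) (step_exp_cvg t)).
Qed.

Lemma evol_linear t : linear (evol E t).
Proof.
exact: (funcalc_linear _ pvm _ _ _ measurable_step_set _ (cmeasurable_cexpi t) (cexpi_le1 t)
  (step_exp_le1 t) (step_exp_cvg t)).
Qed.

Let evol_le t phi : L2norm (evol E t phi) <= L2norm phi.
Proof.
exact: (funcalc_le _ pvm _ _ _ measurable_step_set _ (cmeasurable_cexpi t) (cexpi_le1 t)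
  (step_exp_le1 t) (step_exp_cvg t)).
Qed.

Lemma evol_0 phi : evol E 0 phi = phi.
Proof.
rewrite /evol (funcalcE _ pvm _ id)// => psi.
rewrite ipxx; apply: complex_eq.
  transitivity (Rintegral (spectral_meas E pvm psi) setT (cst 1)).
    rewrite Rintegral_cst// mul1r; exact: esym (congr1 fine (spectral_measT E pvm psi)).
  by apply: eq_Rintegral => x _; rewrite mul0r oppr0 cexpi0.
transitivity (Rintegral (spectral_meas E pvm psi) setT (cst 0)).
  by rewrite Rintegral_cst// mul0r.
by apply: eq_Rintegral => x _; rewrite mul0r oppr0 cexpi0.
Qed.

(** The products of the approximants have two limits: the composition of the evolutions, and, since
    they are operators of the product simple functions, the evolution at time [s + t]. *)
Lemma evolD s t phi : evol E s (evol E t phi) = evol E (s + t) phi.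
Proof.
pose u r n := simpop E (step_index n) (step_coef r n) (step_set n).
have FF : Filter (\oo : set_system nat) by exact: _.
have c1 : L2cvg \oo (fun n => u s n (u t n phi)) (evol E s (evol E t phi)).
  have h1 := evol_cvg t phi; have h2 := evol_cvg s (evol E t phi).
  apply: (ltL2cvg _ FF) => e e0; have e2 : 0 < e / 2 by rewrite divr_gt0.
  have := L2cvg_lt _ FF _ _ _ e2 h1; have := L2cvg_lt _ FF _ _ _ e2 h2.
  apply: filterS2 => n k2 k1.
  (* The outer operator depends on [n] too; its uniform contraction property controls the error of
     the inner limit. *)
  apply: le_lt_trans (L2norm_triangleB _ (u s n (evol E t phi)) _) _.
  have lu : linear (u s n).
    exact: (simpop_linear E pvm _ _ _ (measurable_step_set n)).
  rewrite -(linearB_of _ lu).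
  have := simpop_le _ pvm _ (step_coef s) _ measurable_step_set (step_exp_le1 s) n
    (u t n phi - evol E t phi).
  rewrite -/(u s n _); move: k1 k2; rewrite -!/(u _ n _).
  by move: (L2norm _) (L2norm _) (L2norm _) => a b c; lra.
apply: (L2cvg_uniq _ \oo _ _ _ _ c1); rewrite /L2cvg /u.
under eq_fun do rewrite (simpop_comp E pvm _ _ _ _ _ _ (measurable_step_set _) (measurable_step_set _)).
have E2 n x := simp_mul (step_index n) (step_index n) (step_coef s n) (step_set n)
  (step_coef t n) (step_set n) x.
apply: (simpop_cvg _ pvm _ _ _ _ _ (cmeasurable_cexpi (s + t)) (cexpi_le1 (s + t))).
- by move=> n p; apply: measurableI; exact: measurable_step_set.
- move=> n x; rewrite -E2 csqM mulr_ile1 ?csq_ge0//; exact: step_exp_le1.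
move=> x.
(* From [a d - a' d' = a (d - d') + (a - a') d'] with [|a| <= 1] and [|d'| = 1]. *)
have b n : csq (simp (step_index n * step_index n)%type
      (fun p => step_coef s n p.1 * step_coef t n p.2)
      (fun p => step_set n p.1 `&` step_set n p.2) x - cexpi (- ((s + t) * x))) <=
    2 * (csq (step_exp t n x - cexpi (- (t * x))) + csq (step_exp s n x - cexpi (- (s * x)))).
  rewrite -E2 -/(step_exp s n x) -/(step_exp t n x) mulrDl opprD cexpiD.
  set a := step_exp s n x; set a' := cexpi (- (s * x)); set d := step_exp t n x.
  set d' := cexpi (- (t * x)).
  have -> : a * d - a' * d' = a * (d - d') + (a - a') * d' by ring.
  apply: le_trans (csqD _ _) _; rewrite !csqM csq_cexpi mulr1 ler_wpM2l// lerD2r.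
  by rewrite -[leRHS]mul1r ler_wpM2r ?csq_ge0//; exact: step_exp_le1.
have h : 2 * (csq (step_exp t n x - cexpi (- (t * x))) + csq (step_exp s n x - cexpi (- (s * x))))
    @[n --> \oo] --> (0 : R).
  rewrite -[X in _ --> X](mulr0 2) -[X in 2 * X](addr0 0); apply: cvgMr.
  by apply: cvgD; exact: step_exp_cvg.
apply: (squeeze_cvgr _ (cvg_cst 0) h); apply: nearW => n.
by apply/andP; split; [exact: csq_ge0|exact: b].
Qed.

(** The operators at times [t] and [-t] are both contractions and compose to the identity. *)
Lemma evol_isometry t phi : L2norm (evol E t phi) = L2norm phi.
Proof.
apply/eqP; rewrite eq_le evol_le /= -[leLHS](congr1 L2norm (evol_0 phi)) -(addNr t) -evolD.
exact: evol_le.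
Qed.

End UnitaryGroup.

Section FilterShift.
Context {R : realType}.

Lemma cvg_addr_pinfty (t : R) : s + t @[s --> +oo] --> +oo.
Proof.
move=> P [M [_ h]]; exists (M - t); split; first exact: num_real.
by move=> x hx; apply: h; rewrite -ltrBlDr.
Qed.

Lemma cvg_addr_ninfty (t : R) : s + t @[s --> -oo] --> -oo.
Proof.
move=> P [M [_ h]]; exists (M - t); split; first exact: num_real.
by move=> x hx; apply: h; rewrite -ltrBrDr.
Qed.

End FilterShift.

(** * Wave and scattering operators *)

Section WaveOperator.
Context {R : realType}.
Implicit Types (phi psi chi : L2 R).
Variable E : set R -> L2 R -> L2 R.
Hypothesis pvm : projection_valued_measure E.
Variables (F : set_system R) (W : L2 R -> L2 R).
Hypothesis FF : ProperFilter F.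
Hypothesis F_shift : forall t, s + t @[s --> F] --> F.
Hypothesis WW : wave_operator E F W.

Lemma wave_isometry phi : L2norm (W phi) = L2norm phi.
Proof.
have FF' : Filter F by exact: _.
have h := L2norm_continuous F FF' _ _ (WW phi).
have e : (fun t => L2norm (evol E (- t) (evol0 t phi))) = cst (L2norm phi).
  by apply/funext => t; rewrite (evol_isometry _ pvm) evol0_isometry.
rewrite e in h.
rewrite -(cvg_lim (@norm_hausdorff _ _) h).
exact: (cvg_lim (@norm_hausdorff _ _) (cvg_cst _)).
Qed.

Lemma wave_linear : linear W.
Proof.
move=> a phi psi; apply: (L2cvg_uniq _ F _ _ _ _ (WW (a *: phi + psi))).
have e t : evol E (- t) (evol0 t (a *: phi + psi)) =
    a *: evol E (- t) (evol0 t phi) + evol E (- t) (evol0 t psi).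
  have e1 := evol0_linear t a phi psi; rewrite e1.
  exact: (evol_linear _ pvm (- t)).
rewrite /L2cvg; under eq_fun do rewrite e.
have FF' : Filter F by exact: _.
exact: (L2cvgL F FF' _ _ a _ _ (WW phi) (WW psi)).
Qed.

(** The limit defining [W phi] is taken along the shifted time [s + t]; applying [e^{-itH}] then
    cancels the shift on the left and leaves [e^{-itH_0}] on the right. *)
Lemma wave_intertwining t phi : evol E t (W phi) = W (evol0 t phi).
Proof.
have h : L2cvg F (fun s => evol E (- s) (evol0 s (evol0 t phi))) (evol E t (W phi)).
  have h1 : L2norm (evol E (- (s + t)) (evol0 (s + t) phi) - W phi) @[s --> F] --> (0 : R).
    exact: (cvg_comp _ _ (F_shift t) (WW phi)).
  rewrite /L2cvg; apply: cvg_trans h1; apply: near_eq_cvg; apply: nearW => s.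
  rewrite -(evol_isometry _ pvm t) (linearB_of _ (evol_linear _ pvm t)) (evolD _ pvm).
  by rewrite (_ : t - (s + t) = - s) ?evol0D//; ring.
exact: (L2cvg_uniq _ F _ _ _ _ h (WW (evol0 t phi))).
Qed.

End WaveOperator.

Section Scattering.
Context {R : realType}.
Implicit Types (phi psi chi : L2 R).
Variables (Wm Wp : L2 R -> L2 R).
Hypotheses (lWp : linear Wp) (iWp : forall phi, L2norm (Wp phi) = L2norm phi).
Hypothesis iWm : forall phi, L2norm (Wm phi) = L2norm phi.
Hypothesis WmWp : range Wm = range Wp.

(** Equality of ranges writes [Wm phi] as [Wp psi], and the adjoint of an isometry recovers [psi].
    This is the relation that allows the outgoing description for positive times. *)
Lemma scatteringP phi : Wp (scattering Wm Wp phi) = Wm phi.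
Proof.
have : range Wp (Wm phi) by rewrite -WmWp; exists phi.
move=> [psi _ e]; rewrite -e /scattering /adjoint; congr Wp.
have ip_iso := linear_isometry_ip _ lWp iWp.
(* [psi] itself satisfies the defining property of the adjoint, so the default value of [xget] is
   excluded. *)
case: xgetP => [chi _ h|h]; last by case: (h psi) => chi; rewrite -e ip_iso.
apply: ip_eq => x; rewrite ip_conj h -e ip_iso.
by rewrite -ip_conj.
Qed.

Lemma scattering_isometry phi : L2norm (scattering Wm Wp phi) = L2norm phi.
Proof. by rewrite -iWp scatteringP iWm. Qed.

End Scattering.

(** * Quadratic forms along continuous paths of vectors *)

Section QuadraticForms.
Context {R : realType}.
Local Notation mu := (@leb R).
Implicit Types (phi psi chi : L2 R).

(** Complex Cauchy-Schwarz from the real one, by multiplying [phi] by [z = <phi, psi>] so that the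
    product becomes [|z|^2]. *)
Lemma cabs_ip_le phi psi : cabs (ip phi psi) <= L2norm phi * L2norm psi.
Proof.
set z := ip phi psi.
have := rip_le (z *: phi) psi; rewrite /rip ipZl -/z L2normZ.
have -> : Re (z^*%C * z) = cabs z * cabs z.
  by rewrite -expr2 sqr_cabs; case: z => a b; rewrite /csq /=; ring.
have := cabs_ge0 z; rewrite le_eqVlt => /orP[/eqP <- _|z0].
  by rewrite mulr_ge0 ?L2norm_ge0.
by rewrite -mulrA ler_pM2l.
Qed.

Variables (T : L2 R -> L2 R) (K : R).
Hypotheses (lT : linear T) (TK : forall phi, L2norm (T phi) <= K * L2norm phi).

(** Changing one argument at a time. This estimate gives both measurability in time and the
    domination used for large [r]; for two vectors of norm [N] its constant is [K (N + N)]. *)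
Lemma quad_form_diff phi psi : cabs (ip phi (T phi) - ip psi (T psi)) <=
  K * (L2norm phi + L2norm psi) * L2norm (phi - psi).
Proof.
have -> : ip phi (T phi) - ip psi (T psi) = ip phi (T (phi - psi)) + ip (phi - psi) (T psi).
  by rewrite (linearB_of _ lT) ipBr ipBl; ring.
apply: le_trans (cabsD _ _) _.
have h1 := le_trans (cabs_ip_le phi (T (phi - psi)))
  (ler_wpM2l (L2norm_ge0 phi) (TK (phi - psi))).
have h2 := le_trans (cabs_ip_le (phi - psi) (T psi))
  (ler_wpM2l (L2norm_ge0 (phi - psi)) (TK psi)).
apply: le_trans (lerD h1 h2) _.
by move: (L2norm phi) (L2norm psi) (L2norm (phi - psi)) => a b d; rewrite le_eqVlt; apply/orP; left; apply/eqP; ring.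
Qed.

(** Continuity along sequences is what dominated convergence provides, and it is enough for
    measurability of functions of a real variable. *)
Definition L2continuous (c : R -> L2 R) := forall (u : nat -> R) t,
  u n @[n --> \oo] --> t -> L2cvg \oo (fun n => c (u n)) (c t).

Lemma seq_continuous_measurable (v : R -> R) :
  (forall (u : nat -> R) t, u n @[n --> \oo] --> t -> v (u n) @[n --> \oo] --> v t) ->
  measurable_fun setT v.
Proof.
move=> h; apply: continuous_measurable_fun => t.
by apply/(@cvg_nbhsP _ R^o) => u; exact: h.
Qed.

Lemma measurable_L2norm (c : R -> L2 R) : L2continuous c ->
  measurable_fun setT (fun t => L2norm (c t)).
Proof.
move=> cc; apply: seq_continuous_measurable => u t ut.
have FF : Filter (\oo : set_system nat) by exact: _.
exact: (L2norm_continuous \oo FF _ _ (cc u t ut)).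
Qed.

Lemma L2continuousB (c c' : R -> L2 R) : L2continuous c -> L2continuous c' ->
  L2continuous (fun t => c t - c' t).
Proof.
move=> cc cc' u t ut; have FF : Filter (\oo : set_system nat) by exact: _.
have h := L2cvgL \oo FF _ _ (-1) _ _ (cc' u t ut) (cc u t ut).
have e (x y : L2 R) : - 1 *: y + x = x - y by rewrite scaleN1r addrC.
by rewrite e in h; have -> : (fun n => c (u n) - c' (u n)) = (fun n => -1 *: c' (u n) + c (u n))
  by apply/funext => n; rewrite e.
Qed.

Lemma cmeasurable_quad_form (c : R -> L2 R) (N : R) : L2continuous c ->
  (forall t, L2norm (c t) = N) -> cmeasurable (fun t => ip (c t) (T (c t))).
Proof.
move=> cc cN.
have H (p : R[i] -> R) : (forall z, `|p z| <= cabs z) -> (forall z w, p (z - w) = p z - p w) ->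
    measurable_fun setT (fun t => p (ip (c t) (T (c t)))).
  move=> p1 p2; apply: seq_continuous_measurable => u t ut.
  have h : K * (N + N) * L2norm (c (u n) - c t) @[n --> \oo] --> (0 : R).
    by rewrite -[X in _ --> X](mulr0 (K * (N + N))); apply: cvgMr; exact: cc.
  apply/cvgrPdist_le => e e0; have /cvgr0Pnorm_le/(_ e e0) := h; apply: filterS => n hn.
  rewrite distrC -p2; apply: le_trans (p1 _) _; apply: le_trans (quad_form_diff _ _) _.
  by rewrite !cN; exact: le_trans (ler_norm _) hn.
by split; apply: H => *; rewrite ?Re_cabs ?Im_cabs// ?cReD ?cReN ?cImD ?cImN.
Qed.

End QuadraticForms.

(** * Splitting and reflecting time integrals *)

Section HalfLines.
Context {R : realType}.
Local Notation mu := (@leb R).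
Local Notation neg := (`]-oo, 0]%classic : set R).
Local Notation pos := (`[0, +oo[%classic : set R).
Local Notation spos := (`]0, +oo[%classic : set R).

(** The open positive half line makes the cover disjoint. Later statements use the closed one, as in
    [tau_free]; the two differ by the null set reduced to 0. *)
Lemma setT_halves : (setT : set R) = neg `|` spos.
Proof.
apply/seteqP; split => // x _; rewrite /= !in_itv /= andbT.
by have [h|h] := leP x 0; [left|right].
Qed.

Lemma halves_disjoint : [disjoint neg & spos].
Proof.
rewrite disj_set2E; apply/eqP/seteqP; split => // x /=; rewrite !in_itv /= andbT => -[h1 h2].
by move: (lt_le_trans h2 h1); rewrite ltxx.
Qed.

Lemma integrable_halves (u : R -> R) : measurable_fun setT u ->
  mu.-integrable neg (EFin \o u) -> mu.-integrable pos (EFin \o u) ->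
  mu.-integrable setT (EFin \o u).
Proof.
move=> mu_ /integrableP[_ i1] i2; apply/integrableP; split; first exact/measurable_EFinP.
have /integrableP[_ i3] : mu.-integrable spos (EFin \o u).
  apply: (integrableS _ _ _ i2); [exact: measurable_itv|exact: measurable_itv|].
  by move=> x /=; rewrite !in_itv /= !andbT => /ltW.
rewrite setT_halves ge0_integral_setU//; first exact: lte_add_pinfty.
- by rewrite -setT_halves; apply/measurable_EFinP; exact: measurableT_comp.
- exact: halves_disjoint.
Qed.

Lemma Rintegral_halves (u : R -> R) : measurable_fun setT u ->
  mu.-integrable setT (EFin \o u) ->
  Rintegral mu setT u = Rintegral mu neg u + Rintegral mu pos u.
Proof.
move=> mu_ iu.
have mneg : measurable neg by exact: measurable_itv.
have mspos : measurable spos by exact: measurable_itv.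
have mpos : measurable pos by exact: measurable_itv.
have mE D : measurable_fun D (EFin \o u) by apply/measurable_EFinP; exact: measurable_funTS.
rewrite {1}setT_halves Rintegral_setU//; last 2 first.
- by rewrite -setT_halves.
- exact: halves_disjoint.
congr (_ + _); rewrite /Rintegral; congr fine.
rewrite -integral_leb// -[RHS]integral_leb//.
exact: (@integral_itv_obnd_cbnd R 0 +oo%O (EFin \o u) (mE spos)).
Qed.

Lemma Rintegral_reflect (u : R -> R) : mu.-integrable neg (EFin \o u) ->
  mu.-integrable pos (EFin \o (fun t => u (- t))) /\
  Rintegral mu pos (fun t => u (- t)) = Rintegral mu neg u.
Proof.
move=> iu.
have E : pos = -%R @^-1` neg.
  by apply/seteqP; split => x /=; rewrite !in_itv /= andbT oppr_le0.
have mneg : measurable neg by exact: measurable_itv.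
split; first by rewrite E; exact: (integrable_comp_in _ 1 measurable_opp_real ler01 leb_opp).
by rewrite [X in Rintegral _ X _]E (Rintegral_comp_in _ 1 measurable_opp_real ler01 leb_opp) ?mul1r.
Qed.

Lemma cintegrable_halves (g : R -> R[i]) : cmeasurable g ->
  cintegrable mu neg g -> cintegrable mu pos g -> cintegrable mu setT g.
Proof. by move=> [m1 m2] [a1 a2] [b1 b2]; split; exact: integrable_halves. Qed.

Lemma cintegral_halves (g : R -> R[i]) : cmeasurable g -> cintegrable mu setT g ->
  [/\ cintegrable mu neg g, cintegrable mu pos g &
   cintegral mu setT g = cintegral mu neg g + cintegral mu pos g].
Proof.
move=> [m1 m2] [i1 i2]; split.
- by split; [apply: integrableS i1|apply: integrableS i2] => //; exact: measurable_itv.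
- by split; [apply: integrableS i1|apply: integrableS i2] => //; exact: measurable_itv.
- by apply: complex_eq; rewrite ?cReD ?cImD /=; exact: Rintegral_halves.
Qed.

Lemma cintegral_reflect (g : R -> R[i]) : cintegrable mu neg g ->
  cintegrable mu pos (fun t => g (- t)) /\
  cintegral mu pos (fun t => g (- t)) = cintegral mu neg g.
Proof.
move=> [/(Rintegral_reflect (fun t => Re (g t)))[i1 e1]
        /(Rintegral_reflect (fun t => Im (g t)))[i2 e2]].
by split; [split|apply: complex_eq; [exact: e1|exact: e2]].
Qed.

End HalfLines.

(** * Localization in momentum *)

Section Localization.
Context {R : realType}.
Local Notation mu := (@leb R).
Implicit Types (phi psi chi : L2 R).
Variables (f : R -> R[i]) (M : R).
Hypotheses (mf : cmeasurable f) (M0 : 0 <= M).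
Hypothesis fM : {ae mu, forall x, cabs (f x) <= M}.

Let measurable_scale (r : R) : measurable_fun setT (fun x : R => x / r).
Proof. by apply: measurable_funM; [exact: measurable_id|exact: measurable_cst]. Qed.

Let leb_scale (r : R) : 0 < r -> forall A, measurable A ->
  leb ((fun x : R => x / r) @^-1` A) = (r%:E * leb A)%E.
Proof.
move=> r0 A mA; have := leb_affine r^-1 0; rewrite invr_gt0 invrK => /(_ r0 A mA) <-.
by congr leb; apply/seteqP; split => x /=; rewrite addr0 mulrC.
Qed.

Lemma scaled_meas r : cmeasurable (fun k => f (k / r)).
Proof.
by have [m1 m2] := mf; split; [exact: (measurableT_comp m1 (measurable_scale r))|
  exact: (measurableT_comp m2 (measurable_scale r))].
Qed.

Lemma scaled_ae r (P : R -> Prop) : 0 < r -> {ae mu, forall x, P x} ->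
  {ae mu, forall x, P (x / r)}.
Proof. by move=> r0; exact: (ae_comp _ r _ (measurable_scale r) (leb_scale r r0)). Qed.

Lemma scaled_bound r : 0 < r -> {ae mu, forall k, cabs (f (k / r)) <= M}.
Proof. by move=> r0; exact: (scaled_ae r (fun x => cabs (f x) <= M)). Qed.

Lemma scaled_integral r : 0 < r -> cintegrable mu setT f ->
  cintegrable mu setT (fun k => f (k / r)) /\
  cintegral mu setT (fun k => f (k / r)) = r%:C%C * cintegral mu setT f.
Proof.
move=> r0 [i1 i2].
have j (u : R -> R) : mu.-integrable setT (EFin \o u) ->
    mu.-integrable setT (EFin \o (fun k => u (k / r))) /\
    Rintegral mu setT (fun k => u (k / r)) = r * Rintegral mu setT u.
  move=> iu; split.
    exact: (integrable_comp _ r (measurable_scale r) (ltW r0) (leb_scale r r0)).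
  exact: (Rintegral_comp _ r (measurable_scale r) (ltW r0) (leb_scale r r0)).
have [a1 b1] := j (fun x => Re (f x)) i1; have [a2 b2] := j (fun x => Im (f x)) i2.
split; first by split.
apply: complex_eq; rewrite ?cReM ?cImM /= mul0r ?subr0 ?addr0; [exact: b1|exact: b2].
Qed.

Local Notation Fr r := (funP (fun k => f (k / r))).

Lemma Fr_linear r : 0 < r -> linear (Fr r : L2 R -> L2 R).
Proof. by move=> r0; exact: (funP_linear _ _ (scaled_meas r) M0 (scaled_bound r r0)). Qed.

Lemma Fr_norm r phi : 0 < r -> L2norm (Fr r phi) <= M * L2norm phi.
Proof. by move=> r0; exact: (funP_norm _ _ (scaled_meas r) M0 (scaled_bound r r0)). Qed.

Lemma Tr0_value r phi : 0 < r -> cintegrable mu setT f ->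
  cintegrable mu setT (Tr0_integrand f r phi) /\
  Tr0 f r phi = (r * L2norm phi ^+ 2)%:C%C * cintegral mu setT f.
Proof.
move=> r0 fi; have [i1 e1] := scaled_integral r r0 fi.
have [i2 e2] := free_sojourn_time _ _ (scaled_meas r) M0 (scaled_bound r r0) phi i1.
split; first exact: i2.
rewrite -[LHS]/(cintegral mu setT _) [LHS]e2 e1 mulrA; congr (_ * _).
by apply: complex_eq => /=; ring.
Qed.

Hypothesis f1 : exists2 delta : R, 0 < delta & {ae mu, forall x, `|x| < delta -> f x = 1}.

(** For each frequency [k] one has [|k| / u n < delta] eventually, so the multiplier becomes exactly
    1 there. *)
Lemma Fr_cvg (u : nat -> R) phi : (forall n, 0 < u n) -> u n @[n --> \oo] --> +oo ->
  L2cvg \oo (fun n => Fr (u n) phi) phi.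
Proof.
move=> u0 uy; have [delta d0 fd] := f1.
have c1 : cabs (1 : R[i]) = 1 by rewrite cabsE /csq /= expr1n expr0n addr0 sqrtr1.
have h : L2cvg \oo (fun n => mulop (fun k => f (k / u n)) (fourier phi))
    (mulop (cst 1) (fourier phi)).
  (* [M + 1] bounds the multipliers and their limit 1 at once. *)
  apply: (mulop_cvg _ _ (M + 1) _ (fun n => scaled_meas (u n)) (cmeasurable_cst 1)).
  - by rewrite addr_ge0.
  - by move=> n; apply: aeS (scaled_bound _ (u0 n)) => x hx; rewrite (le_trans hx)// lerDl.
  - by apply: aeW => x; rewrite c1 lerDr.
  (* Each [n] has its own null set where the rescaled condition on [f] fails; only countably many
     occur along a sequence. *)
  have ha : {ae mu, forall x, forall n, `|x / u n| < delta -> f (x / u n) = 1}.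
    apply: ae_foralln => n.
    exact: (scaled_ae _ (fun y => `|y| < delta -> f y = 1) (u0 n) fd).
  apply: aeS ha => x hx; apply: cvg_near_cst.
  have : \forall n \near \oo, `|x| / delta < u n by exact: (cvgryPgt _).1.
  apply: filterS => n hn; rewrite hx ?subrr /csq /= ?expr0n ?addr0//.
  by rewrite normrM normfV (gtr0_norm (u0 n)) ltr_pdivrMr// mulrC -ltr_pdivrMr.
have e : mulop (cst 1) (fourier phi) = fourier phi.
  have c1' : {ae mu, forall x, cabs (cst (1 : R[i]) x) <= 1} by apply: aeW => x; rewrite c1.
  apply/L2_eqP; have := mulop_ae (cst 1) 1 (cmeasurable_cst 1) ler01 c1' (fourier phi).
  by apply: aeS => x ->; rewrite mul1r.
rewrite e in h; move: h; rewrite /L2cvg; apply: cvg_trans; apply: near_eq_cvg.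
apply: nearW => n.
rewrite -[RHS]fourier_isometry (linearB_of _ fourier_linear).
by rewrite (funP_fourier _ _ (scaled_meas (u n)) M0 (scaled_bound _ (u0 n))).
Qed.

Lemma cmeasurable_localization r (c : R -> L2 R) (N : R) : 0 < r -> L2continuous c ->
  (forall t, L2norm (c t) = N) -> cmeasurable (localization f r c).
Proof.
move=> r0 cc cN.
exact: (cmeasurable_quad_form _ M (Fr_linear r r0) (fun phi => Fr_norm r phi r0) c N).
Qed.

Section Comparison.
(** In the application [a] is the path of a wave operator applied to the free evolution, [b] the
    free path, and [D] a half line of times. *)
Variables (D : set R) (a b : R -> L2 R) (N : R).
Hypothesis mD : measurable D.
Hypotheses (ca : L2continuous a) (cb : L2continuous b).
Hypotheses (aN : forall t, L2norm (a t) = N) (bN : forall t, L2norm (b t) = N).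
Hypothesis iab : (\int[lebesgue_measure]_(t in D) (L2norm (a t - b t))%:E < +oo)%E.

Let diff r t := localization f r a t - localization f r b t.

Let N0 : 0 <= N.
Proof. by rewrite -(aN 0) L2norm_ge0. Qed.

(** The dominating function for all [r] simultaneously. *)
Let iw : mu.-integrable D (EFin \o (fun t => M * (N + N) * L2norm (a t - b t))).
Proof.
have mw : measurable_fun setT (fun t => L2norm (a t - b t)).
  by apply: measurable_L2norm; exact: L2continuousB.
have mwD : measurable_fun D (EFin \o (fun t => L2norm (a t - b t))).
  by apply/measurable_EFinP; exact: measurable_funTS.
have i : mu.-integrable D (EFin \o (fun t => L2norm (a t - b t))).
  apply/integrableP; split => //; have h := iab; rewrite ge0_integral_leb// in h.
    by under eq_integral do rewrite gee0_abs ?lee_fin ?L2norm_ge0//.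
  by move=> t _; rewrite lee_fin L2norm_ge0.
exact: (integrableZl mD (M * (N + N)) i).
Qed.

Let diff_le r t : 0 < r -> cabs (diff r t) <= M * (N + N) * L2norm (a t - b t).
Proof.
move=> r0; have := quad_form_diff _ M (Fr_linear r r0) (fun phi => Fr_norm r phi r0) (a t) (b t).
by rewrite aN bN.
Qed.

Let mdiff r : 0 < r -> cmeasurable (diff r).
Proof.
move=> r0; apply: cmeasurableB; [exact: (cmeasurable_localization r _ N)|].
exact: (cmeasurable_localization r _ N).
Qed.

Lemma localization_diff_integrable r : 0 < r -> cintegrable mu D (diff r).
Proof.
move=> r0; have [m1 m2] := mdiff r r0.
split; apply: (le_integrable mD _ _ iw).
- by apply/measurable_EFinP; exact: measurable_funTS.
- move=> t _; rewrite lee_fin (le_trans (Re_cabs _))// (le_trans (diff_le r t r0))//.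
  exact: ler_norm.
- by apply/measurable_EFinP; exact: measurable_funTS.
- move=> t _; rewrite lee_fin (le_trans (Im_cabs _))// (le_trans (diff_le r t r0))//.
  exact: ler_norm.
Qed.

Lemma localization_diff_cvg (u : nat -> R) : (forall n, 0 < u n) -> u n @[n --> \oo] --> +oo ->
  cabs (cintegral mu D (diff (u n))) @[n --> \oo] --> (0 : R).
Proof.
move=> u0 uy.
have d0 t : cabs (diff (u n) t) @[n --> \oo] --> (0 : R).
  have B n : cabs (diff (u n) t) <= N * L2norm (Fr (u n) (a t) - a t) +
      N * L2norm (Fr (u n) (b t) - b t).
    (* Since [a t] and [b t] have the same norm [N], the number [N^2] is subtracted from both forms;
       each is then measured by [F_r - 1], which tends strongly to 0. *)
    have -> : diff (u n) t = ip (a t) (Fr (u n) (a t) - a t) - ip (b t) (Fr (u n) (b t) - b t).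
      have key (x y z : R[i]) : x - y = (x - z) - (y - z) by ring.
      by rewrite /diff /localization !ipBr (ipxx (a t)) (ipxx (b t)) aN bN; exact: key.
    apply: le_trans (cabsD _ _) _.
    have -> (z : R[i]) : cabs (- z) = cabs z by rewrite !cabsE csqN.
    by apply: lerD; apply: le_trans (cabs_ip_le _ _) _; rewrite ?aN ?bN.
  have h : N * L2norm (Fr (u n) (a t) - a t) + N * L2norm (Fr (u n) (b t) - b t)
      @[n --> \oo] --> (0 : R).
    rewrite -[X in _ --> X](addr0 0) -[X in X + _](mulr0 N) -[X in _ + X](mulr0 N).
    by apply: cvgD; apply: cvgMr; exact: Fr_cvg.
  apply: (squeeze_cvgr _ (cvg_cst 0) h); apply: nearW => n.
  by rewrite cabs_ge0 B.
have H (p : R[i] -> R) : (forall z, `|p z| <= cabs z) ->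
    (forall r, 0 < r -> measurable_fun setT (fun t => p (diff r t))) ->
    Rintegral mu D (fun t => p (diff (u n) t)) @[n --> \oo] --> (0 : R).
  move=> p1 p2.
  have [|||||_ c] := @Rdominated_convergence R mu D mD
    (fun n t => p (diff (u n) t)) (cst 0) (fun t => M * (N + N) * L2norm (a t - b t)).
  - by move=> n; apply: measurable_funTS; exact: p2.
  - exact: measurable_cst.
  - apply: aeW => t _; apply: norm_cvg0; have := d0 t => h.
    apply: (squeeze_cvgr _ (cvg_cst 0) h); apply: nearW => n.
    by rewrite normr_ge0 p1.
  - exact: iw.
  - by move=> n t _; rewrite (le_trans (p1 _))// diff_le.
  by move: c; rewrite /Rintegral integral0.
have h1 := H (@complex.Re R) (@Re_cabs R) (fun r r0 => (mdiff r r0).1).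
have h2 := H (@complex.Im R) (@Im_cabs R) (fun r r0 => (mdiff r r0).2).
have h : `|Rintegral mu D (fun t => Re (diff (u n) t))| +
    `|Rintegral mu D (fun t => Im (diff (u n) t))| @[n --> \oo] --> (0 : R).
  have z : (0 : R) = `|0 : R| + `|0 : R| by rewrite normr0 addr0.
  by rewrite [X in _ --> X]z; exact: (cvgD (cvg_norm h1) (cvg_norm h2)).
apply: (squeeze_cvgr _ (cvg_cst 0) h); apply: nearW => n.
by rewrite cabs_ge0; exact: cabs_le.
Qed.

End Comparison.

End Localization.

(** * Time delay *)

Section LimitsAtInfinity.
Context {R : realType}.
Implicit Types (u v : R -> R[i]).

(** A sequence tending to infinity is eventually above 1. Its maximum with 1 has the same tail and
    only positive terms, so estimates valid for [0 < r] apply at every index. *)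
Lemma pinfty_cvg0 (w : R -> R) :
  (forall s : nat -> R, (forall n, 0 < s n) -> s n @[n --> \oo] --> +oo ->
     w (s n) @[n --> \oo] --> (0 : R)) ->
  w r @[r --> +oo] --> (0 : R).
Proof.
move=> h; apply/cvg_pinftyP => s sy; pose s' n := Num.max (s n) 1.
have s1 : \forall n \near \oo, 1 < s n by exact: (cvgryPgt _).1.
have es : \forall n \near \oo, s' n = s n.
  by apply: filterS s1 => n hn; rewrite /s' max_l// ltW.
have s'0 n : 0 < s' n by rewrite /s' lt_max ltr01 orbT.
have s'y : s' n @[n --> \oo] --> +oo.
  by apply: cvg_trans sy; apply: near_eq_cvg; apply: filterS es => n ->.
have := h s' s'0 s'y; apply: cvg_trans; apply: near_eq_cvg.
by apply: filterS es => n ->.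
Qed.

Lemma eq_cvg_to_pinfty u v l : (forall r, 0 < r -> u r = v r) ->
  cvg_to_pinfty u l -> cvg_to_pinfty v l.
Proof.
move=> uv; apply: cvg_trans; apply: near_eq_cvg.
by apply: filterS (nbhs_pinfty_gt (num_real (0 : R))) => r r0; rewrite uv.
Qed.

Lemma cvg_to_pinfty_close u v l : cabs (v r - u r) @[r --> +oo] --> (0 : R) ->
  cvg_to_pinfty u l -> cvg_to_pinfty v l.
Proof.
move=> d c; have h : cabs (v r - u r) + cabs (u r - l) @[r --> +oo] --> (0 : R).
  by rewrite -[X in _ --> X](addr0 0); exact: cvgD d c.
apply: (squeeze_cvgr _ (cvg_cst 0) h); apply: nearW => r.
rewrite cabs_ge0; have -> : v r - l = (v r - u r) + (u r - l) by rewrite addrA subrK.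
exact: cabsD.
Qed.

End LimitsAtInfinity.

Section TimeDelay.
Context {R : realType}.
Local Notation mu := (@leb R).
Local Notation neg := (`]-oo, 0]%classic : set R).
Local Notation pos := (`[0, +oo[%classic : set R).
Implicit Types (phi psi chi : L2 R).
Variables (f : R -> R[i]) (M : R).
Hypotheses (mf : cmeasurable f) (M0 : 0 <= M).
Hypothesis fM : {ae mu, forall x, cabs (f x) <= M}.
Hypothesis fi : cintegrable mu setT f.
Hypothesis f1 : exists2 delta : R, 0 < delta & {ae mu, forall x, `|x| < delta -> f x = 1}.
Variables (E : set R -> L2 R -> L2 R) (Wm Wp S : L2 R -> L2 R).
Hypotheses (lWm : linear Wm) (lWp : linear Wp).
Hypotheses (iWm : forall phi, L2norm (Wm phi) = L2norm phi).
Hypotheses (iWp : forall phi, L2norm (Wp phi) = L2norm phi).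
Hypothesis evolW : forall t phi, evol E t (Wm phi) = Wm (evol0 t phi).
Hypothesis evolWp : forall t phi, evol E t (Wp phi) = Wp (evol0 t phi).
Hypothesis WS : forall phi, Wp (S phi) = Wm phi.
Hypothesis iS : forall phi, L2norm (S phi) = L2norm phi.

Lemma Tr0_scattering r phi : 0 < r -> Tr0 f r phi = Tr0 f r (S phi).
Proof.
move=> r0; have [_ ->] := Tr0_value f M mf M0 fM r phi r0 fi.
by have [_ ->] := Tr0_value f M mf M0 fM r (S phi) r0 fi; rewrite iS.
Qed.

Lemma tau_in_tau r phi : 0 < r -> tau_in E Wm f r phi = tau E Wm S f r phi.
Proof.
move=> r0; rewrite /tau_in /tau -Tr0_scattering//; congr (_ - _).
by move: (Tr0 _ _ _) => -[a b]; apply: complex_eq => /=; field.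
Qed.

Let evol0_path phi : L2continuous (fun t => evol0 t phi).
Proof. by move=> u t ut; exact: evol0_continuous. Qed.

Let isometry_path (W : L2 R -> L2 R) phi : linear W ->
  (forall psi, L2norm (W psi) = L2norm psi) -> L2continuous (fun t => W (evol0 t phi)).
Proof.
move=> lW iW u t ut; rewrite /L2cvg.
under eq_fun do rewrite -(linearB_of _ lW) iW.
exact: evol0_continuous.
Qed.

Let path_norm (W : L2 R -> L2 R) phi : (forall psi, L2norm (W psi) = L2norm psi) ->
  forall t, L2norm (W (evol0 t phi)) = L2norm phi.
Proof. by move=> iW t; rewrite iW evol0_isometry. Qed.

(** The outer unitaries move to the left argument, which turns the two terms into the free integrand
    at times [t] and [-t]. *)
Lemma tau_free_integrandE r psi t : tau_free_integrand f r psi t =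
  Tr0_integrand f r psi t - Tr0_integrand f r psi (- t).
Proof.
have e1 := ip_evol0N t psi (Defs.funP (fun k => f (k / r)) (evol0 t psi)).
have e2 := ip_evol0N (- t) psi (Defs.funP (fun k => f (k / r)) (evol0 (- t) psi)).
rewrite opprK in e2; rewrite /tau_free_integrand ipBr.
exact: (congr2 (fun x y => x - y) e1 e2).
Qed.

Let Tr0_halves r psi : 0 < r ->
  [/\ cintegrable mu neg (Tr0_integrand f r psi), cintegrable mu pos (Tr0_integrand f r psi) &
   Tr0 f r psi = cintegral mu neg (Tr0_integrand f r psi) + cintegral mu pos (Tr0_integrand f r psi)].
Proof.
move=> r0; have [i _] := Tr0_value f M mf M0 fM r psi r0 fi.
have m : cmeasurable (Tr0_integrand f r psi).
  exact: (cmeasurable_localization f M mf M0 fM r _ (L2norm psi) r0 (evol0_path psi)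
    (fun t => evol0_isometry t psi)).
exact: cintegral_halves.
Qed.

(** Reflection of time carries the second term to the negative half line: the integral measures the
    asymmetry between future and past sojourn. *)
Lemma tau_free_integral r psi : 0 < r ->
  cintegrable mu pos (tau_free_integrand f r psi) /\
  cintegral mu pos (tau_free_integrand f r psi) =
    cintegral mu pos (Tr0_integrand f r psi) - cintegral mu neg (Tr0_integrand f r psi).
Proof.
move=> r0; have [in_ ip_ _] := Tr0_halves r psi r0.
have mpos : measurable pos by exact: measurable_itv.
have [i2 e2] := cintegral_reflect _ in_.
have i3 := cintegrableZ mu pos mpos (-1) _ i2.
have e t : tau_free_integrand f r psi t =
    Tr0_integrand f r psi t + (-1) * Tr0_integrand f r psi (- t).
  by rewrite tau_free_integrandE mulN1r.
split.
  apply: (eq_cintegrable mu pos mpos _ _ (fun t _ => esym (e t))).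
  exact: (cintegrableD mu pos mpos _ _ ip_ i3).
have e3 := etrans (cintegralZ mu pos mpos (-1) _ i2)
  (etrans (congr1 (fun z => -1 * z) e2) (mulN1r _)).
exact: (etrans (eq_cintegral mu pos _ _ (fun t _ => e t))
  (etrans (cintegralD mu pos mpos _ _ ip_ i3) (congr2 +%R erefl e3))).
Qed.

Variable phi : L2 R.
Hypothesis hm : (\int[lebesgue_measure]_(t in `]-oo, 0%R])
  (L2norm (Wm (evol0 t phi) - evol0 t phi))%:E < +oo)%E.
Hypothesis hp : (\int[lebesgue_measure]_(t in `[0%R, +oo[)
  (L2norm (Wp (evol0 t (S phi)) - evol0 t (S phi)))%:E < +oo)%E.

(** [Dm] compares the interacting and free integrands in the past, in terms of [phi]; [Dp] does so
    in the future, in terms of [S phi]. *)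
Let Dm r t := localization f r (fun t => Wm (evol0 t phi)) t -
  localization f r (fun t => evol0 t phi) t.
Let Dp r t := localization f r (fun t => Wp (evol0 t (S phi))) t -
  localization f r (fun t => evol0 t (S phi)) t.

Let mneg : measurable neg. Proof. exact: measurable_itv. Qed.
Let mpos : measurable pos. Proof. exact: measurable_itv. Qed.

Let iDm r : 0 < r -> cintegrable mu neg (Dm r).
Proof.
exact: (localization_diff_integrable f M mf M0 fM neg _ _ (L2norm phi) mneg
  (isometry_path Wm phi lWm iWm) (evol0_path phi) (path_norm Wm phi iWm)
  (fun t => evol0_isometry t phi) hm).
Qed.

Let iDp r : 0 < r -> cintegrable mu pos (Dp r).
Proof.
exact: (localization_diff_integrable f M mf M0 fM pos _ _ (L2norm (S phi)) mpos
  (isometry_path Wp (S phi) lWp iWp) (evol0_path (S phi)) (path_norm Wp (S phi) iWp)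
  (fun t => evol0_isometry t (S phi)) hp).
Qed.

Let TrEm r t : Tr_integrand E Wm f r phi t = Tr0_integrand f r phi t + Dm r t.
Proof. by rewrite /Tr_integrand /Tr0_integrand /Dm /localization evolW [RHS]addrC subrK. Qed.

Let TrEp r t : Tr_integrand E Wm f r phi t = Tr0_integrand f r (S phi) t + Dp r t.
Proof. by rewrite /Tr_integrand /Tr0_integrand /Dp /localization -WS evolWp [RHS]addrC subrK. Qed.

Lemma Tr_split r : 0 < r -> cintegrable mu setT (Tr_integrand E Wm f r phi) /\
  Tr E Wm f r phi =
    (cintegral mu neg (Tr0_integrand f r phi) + cintegral mu neg (Dm r)) +
    (cintegral mu pos (Tr0_integrand f r (S phi)) + cintegral mu pos (Dp r)).
Proof.
move=> r0.
have [n1 _ _] := Tr0_halves r phi r0; have [_ p1 _] := Tr0_halves r (S phi) r0.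
have n2 := iDm r r0; have p2 := iDp r r0.
have m : cmeasurable (Tr_integrand E Wm f r phi).
  apply: (cmeasurable_localization f M mf M0 fM r _ (L2norm phi) r0).
    by move=> u t ut; rewrite evolW; under eq_fun do rewrite evolW; exact: isometry_path.
  by move=> t; rewrite evolW path_norm.
have i : cintegrable mu setT (Tr_integrand E Wm f r phi).
  apply: (cintegrable_halves _ m).
    apply: (eq_cintegrable mu neg mneg _ _ (fun t _ => esym (TrEm r t))).
    exact: (cintegrableD mu neg mneg _ _ n1 n2).
  apply: (eq_cintegrable mu pos mpos _ _ (fun t _ => esym (TrEp r t))).
  exact: (cintegrableD mu pos mpos _ _ p1 p2).
split=> //; have [_ _ e] := cintegral_halves _ m i.
have e1 := etrans (eq_cintegral mu neg _ _ (fun t _ => TrEm r t)) (cintegralD mu neg mneg _ _ n1 n2).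
have e2 := etrans (eq_cintegral mu pos _ _ (fun t _ => TrEp r t)) (cintegralD mu pos mpos _ _ p1 p2).
exact: (etrans e (congr2 +%R e1 e2)).
Qed.

(** An exact identity at each finite [r]: the free integrals cancel and only the two interaction
    remainders are left. *)
Let tau_in_free r : 0 < r -> tau_in E Wm f r phi - tau_free S f r phi =
  cintegral mu neg (Dm r) + cintegral mu pos (Dp r).
Proof.
(* Here [a], [b] are the past and future free integrals of [phi], and [a'], [b'] those of [S phi].
   From [a + b = a' + b'], half the difference of asymmetries equals [b' - b], which is also
   [T - T0 - x - y]. *)
have alg (T T0 a b a' b' x y i1 i2 : R[i]) : T = (a + x) + (b' + y) -> T0 = a + b ->
    T0 = a' + b' -> i1 = b - a -> i2 = b' - a' ->
    T - T0 - (2^-1 * i2 - 2^-1 * i1) = x + y.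
  move=> -> e0 e -> ->; have -> : a' = a + b - b' by rewrite -e0 e addrK.
  by rewrite e0; field.
move=> r0; have [_ E1] := tau_free_integral r phi r0.
have [_ E2] := tau_free_integral r (S phi) r0.
have [_ _ e1] := Tr0_halves r phi r0; have [_ _ e2] := Tr0_halves r (S phi) r0.
have [_ e3] := Tr_split r r0.
exact: (alg _ _ _ _ _ _ _ _ _ _ e3 e1 (etrans (Tr0_scattering r phi r0) e2) E1 E2).
Qed.

Lemma tau_in_free_cvg :
  cabs (tau_in E Wm f r phi - tau_free S f r phi) @[r --> +oo] --> (0 : R).
Proof.
apply: pinfty_cvg0 => s s0 sy.
have c1 := localization_diff_cvg f M mf M0 fM f1 neg _ _ (L2norm phi) mneg
  (isometry_path Wm phi lWm iWm) (evol0_path phi) (path_norm Wm phi iWm)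
  (fun t => evol0_isometry t phi) hm s s0 sy.
have c2 := localization_diff_cvg f M mf M0 fM f1 pos _ _ (L2norm (S phi)) mpos
  (isometry_path Wp (S phi) lWp iWp) (evol0_path (S phi)) (path_norm Wp (S phi) iWp)
  (fun t => evol0_isometry t (S phi)) hp s s0 sy.
have h : cabs (cintegral mu neg (Dm (s n))) + cabs (cintegral mu pos (Dp (s n)))
    @[n --> \oo] --> (0 : R).
  by rewrite -[X in _ --> X](addr0 0); exact: (cvgD c1 c2).
apply: (squeeze_cvgr _ (cvg_cst 0) h); apply: nearW => n.
by rewrite cabs_ge0 tau_in_free// cabsD.
Qed.

Lemma tau_limits l :
  cvg_to_pinfty (fun r => tau_in E Wm f r phi) l \/
  cvg_to_pinfty (fun r => tau E Wm S f r phi) l \/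
  cvg_to_pinfty (fun r => tau_free S f r phi) l ->
  [/\ cvg_to_pinfty (fun r => tau_in E Wm f r phi) l,
      cvg_to_pinfty (fun r => tau E Wm S f r phi) l &
      cvg_to_pinfty (fun r => tau_free S f r phi) l].
Proof.
have fwd : cvg_to_pinfty (fun r => tau_free S f r phi) l ->
    cvg_to_pinfty (fun r => tau_in E Wm f r phi) l.
  exact: cvg_to_pinfty_close tau_in_free_cvg.
have bwd : cvg_to_pinfty (fun r => tau_in E Wm f r phi) l ->
    cvg_to_pinfty (fun r => tau_free S f r phi) l.
  apply: cvg_to_pinfty_close; have := tau_in_free_cvg; apply: cvg_trans.
  apply: near_eq_cvg; apply: nearW => r.
  by rewrite -opprB !cabsE csqN.
have e1 : cvg_to_pinfty (fun r => tau_in E Wm f r phi) l ->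
    cvg_to_pinfty (fun r => tau E Wm S f r phi) l.
  by apply: eq_cvg_to_pinfty => r r0; exact: tau_in_tau.
have e2 : cvg_to_pinfty (fun r => tau E Wm S f r phi) l ->
    cvg_to_pinfty (fun r => tau_in E Wm f r phi) l.
  by apply: eq_cvg_to_pinfty => r r0; rewrite tau_in_tau.
have all3 : cvg_to_pinfty (fun r => tau_in E Wm f r phi) l ->
    [/\ cvg_to_pinfty (fun r => tau_in E Wm f r phi) l,
        cvg_to_pinfty (fun r => tau E Wm S f r phi) l &
        cvg_to_pinfty (fun r => tau_free S f r phi) l].
  by move=> h; split; [exact: h|exact: e1 h|exact: bwd h].
by move=> [h|[h|h]]; apply: all3; [exact: h|exact: e2 h|exact: fwd h].
Qed.

End TimeDelay.

Theorem lemma3p2 (R : realType)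
    (f : R -> R[i])
    (f_meas : cmeasurable f)
    (f_bounded : exists M : R, {ae lebesgue_measure, forall x : R, cabs (f x) <= M})
    (f_even : {ae lebesgue_measure, forall x : R, f x = f `|x|})
    (f_decay : exists rho C : R, [/\ 1 < rho, 0 < C &
       {ae lebesgue_measure, forall x : R, cabs (f x) <= C * (jap x) `^ (- rho)}])
    (f_one : exists2 delta : R, 0 < delta &
       {ae lebesgue_measure, forall x : R, `|x| < delta -> f x = 1})
    (H : unbounded_op R) (H_sa : selfadjoint H)
    (E : set R -> L2 R -> L2 R) (E_H : spectral_measure_of H E)
    (Wm Wp : L2 R -> L2 R)
    (Wm_wave : wave_operator E (ninfty_nbhs R) Wm)
    (Wp_wave : wave_operator E (pinfty_nbhs R) Wp)
    (Wm_complete : range Wm = ac_subspace E)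
    (Wp_complete : range Wp = ac_subspace E)
    (H_smooth : forall (s : R) (T : (nat -> L2 R) -> L2 R),
       1 / 2 < s -> bounded_Sobolev (- s) T ->
       locally_smooth E (fun phi => T (L2_to_Sobolev (- s) phi))
         (~` sigma_pp H)) :
  let S := scattering Wm Wp in
  (forall (r : R) (phi : L2 R), 0 < r ->
     [/\ cintegrable lebesgue_measure setT (Tr0_integrand f r phi),
         Tr0 f r phi = (r * L2norm phi ^+ 2)%:C%C *
                       cintegral lebesgue_measure setT f,
         Tr0 f r phi = Tr0 f r (S phi) &
         cintegrable lebesgue_measure setT (Tr_integrand E Wm f r phi) ->
         tau_in E Wm f r phi = tau E Wm S f r phi])
  /\
  ({ae lebesgue_measure, forall x : R, 0 <= f x} ->
   forall phi : L2 R, D0 H phi ->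
   (\int[lebesgue_measure]_(t in `]-oo, 0%R])
      (L2norm (Wm (evol0 t phi) - evol0 t phi))%:E < +oo)%E ->
   (\int[lebesgue_measure]_(t in `[0%R, +oo[)
      (L2norm (Wp (evol0 t (S phi)) - evol0 t (S phi)))%:E < +oo)%E ->
   (forall r : R, 0 < r ->
      [/\ cintegrable lebesgue_measure setT (Tr_integrand E Wm f r phi),
          cintegrable lebesgue_measure `[0, +oo[ (tau_free_integrand f r phi) &
          cintegrable lebesgue_measure `[0, +oo[
            (tau_free_integrand f r (S phi))]) /\
   forall l : R[i],
     cvg_to_pinfty (fun r => tau_in E Wm f r phi) l \/
     cvg_to_pinfty (fun r => tau E Wm S f r phi) l \/
     cvg_to_pinfty (fun r => tau_free S f r phi) l ->
     [/\ cvg_to_pinfty (fun r => tau_in E Wm f r phi) l,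
         cvg_to_pinfty (fun r => tau E Wm S f r phi) l &
         cvg_to_pinfty (fun r => tau_free S f r phi) l]).

Proof.
move=> S.
have pvm : projection_valued_measure E by have [] := E_H.
have FFm : ProperFilter (ninfty_nbhs R) by exact: _.
have FFp : ProperFilter (pinfty_nbhs R) by exact: _.
have iWm := wave_isometry E pvm _ _ FFm Wm_wave.
have lWm := wave_linear E pvm _ _ FFm Wm_wave.
have iWp := wave_isometry E pvm _ _ FFp Wp_wave.
have lWp := wave_linear E pvm _ _ FFp Wp_wave.
have evolWm := wave_intertwining E pvm _ _ FFm cvg_addr_ninfty Wm_wave.
have evolWp := wave_intertwining E pvm _ _ FFp cvg_addr_pinfty Wp_wave.
(* Completeness enters here: both ranges are the absolutely continuous subspace, whence
   [Wp (S phi) = Wm phi]. *)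
have WmWp : range Wm = range Wp by rewrite Wm_complete Wp_complete.
have WS := scatteringP Wm Wp lWp iWp WmWp.
have iS := scattering_isometry Wm Wp lWp iWp iWm WmWp.
(* The essential bound is replaced by its absolute value, so that it can serve as a bound on
   operator norms. *)
have [M fM] : exists2 M, 0 <= M & {ae (@leb R), forall x, cabs (f x) <= M}.
  have [M fM] := f_bounded; exists `|M| => //.
  have {}fM : {ae (@leb R), forall x, cabs (f x) <= M} := fM.
  by apply: aeS fM => x hx; rewrite (le_trans hx)// ler_norm.
have M0 := fM; move=> fM'.
have fi : cintegrable (@leb R) setT f.
  have [rho [C [rho1 C0 fC]]] := f_decay.
  exact: (decay_integrable f rho C f_meas rho1 C0 fC).
have f1 : exists2 delta : R, 0 < delta & {ae (@leb R), forall x, `|x| < delta -> f x = 1}.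
  exact: f_one.
split.
  move=> r phi r0; have [i e] := Tr0_value f M f_meas M0 fM' r phi r0 fi.
  split; [exact: i|exact: e| |].
  - exact: (Tr0_scattering f M f_meas M0 fM' fi S iS r phi r0).
  - by move=> _; exact: (tau_in_tau f M f_meas M0 fM' fi E Wm S iS r phi r0).
move=> _ phi _ hm hp; split.
  move=> r r0.
  have [h1 _] := Tr_split f M f_meas M0 fM' fi E Wm Wp S lWm lWp iWm iWp evolWm evolWp WS
    phi hm hp r r0.
  have [h2 _] := tau_free_integral f M f_meas M0 fM' fi r phi r0.
  have [h3 _] := tau_free_integral f M f_meas M0 fM' fi r (S phi) r0.
  by split; [exact: h1|exact: h2|exact: h3].
exact: (tau_limits f M f_meas M0 fM' fi f1 E Wm Wp S lWm lWp iWm iWp evolWm evolWp WS iS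
  phi hm hp).
Qed.
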